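(* Let $\omega^{(0)}_n(z_1,\dots,z_n)$, $n\ge 2$, be the family of meromorphic differentials on $(\mathbb{P}^1)^n$ defined by $$\omega^{(0)}_2(w,z)=B(w,z)-B(w,\iota z),\qquad B(w,z)=\frac{dw\,dz}{(w-z)^2},$$ and, for $I=\{u_1,\dots,u_m\}$ with $m=|I|\ge 2$, by the involution identity $$\omega^{(0)}_{|I|+1}(z,I)+\omega^{(0)}_{|I|+1}(\iota z,I)=\sum_{s=2}^{|I|}\ \sum_{\substack{I_1\sqcup\dots\sqcup I_s=I\\ I_1,\dots,I_s\neq\emptyset}}\frac1s\,\operatorname*{Res}_{q=z}\Big(\frac{dy(z)\,dx(q)}{(y(z)-y(q))^s}\prod_{j=1}^s\frac{\omega^{(0)}_{|I_j|+1}(q,I_j)}{dx(q)}\Big),$$ together with the requirements that, for $|I|\ge2$, $\omega^{(0)}_{|I|+1}(z,I)$ (as a differential in $z$) has poles at most at points where the right-hand side of the involution identity has poles, and that it is holomorphic at every $z=u_k$ and at every $z=\iota\beta_i$. Then for every $n\ge 2$ the differential $\omega^{(0)}_n(z_1,\dots,z_n)$ is symmetric in its arguments $z_1,\dots,z_n$, i.e. invariant under all permutations of $(z_1,\dots,z_n)$.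
   Context: Setting. $\iota:\mathbb{P}^1\to\mathbb{P}^1$ is a holomorphic involution different from the identity, i.e. $\iota z=\frac{az+b}{cz-a}$ with $a,b,c\in\mathbb{C}$, $a^2+bc\ne 0$. The map $x:\mathbb{P}^1\to\mathbb{P}^1$ is a ramified covering (a rational function) with simple ramification points $\{\beta_i\}$, such that $\iota$ does not fix or permute any ramification points of $x$ and no $\iota\beta_i$ is a pole of $x$. Put $y(z)=-x(\iota z)$. Conventions. Differentials in several variables are of the form $f(z_1,\dots,z_n)\,dz_1\cdots dz_n$ with $f$ rational and commuting $dz_i$; $\omega(\iota z,\dots)$ denotes pullback in that variable. For $I=\{u_1,\dots,u_m\}$, $\omega^{(0)}_{|I|+1}(z,I)$ means $\omega^{(0)}_{m+1}(z,u_1,\dots,u_m)$. Sums over $I_1\sqcup\dots\sqcup I_s=I$ run over all ordered tuples $(I_1,\dots,I_s)$ of disjoint non-empty subsets with union $I$. Known fact (Hock–Wulkenhaar). Under the stated pole conditions the solution exists, is unique, and is produced recursively for $|I|\ge 2$ by \begin{align*} \omega^{(0)}_{|I|+1}(z,I)&=\sum_i\operatorname*{Res}_{q=\beta_i}K_i(z,q)\sum_{\substack{I_1\sqcup I_2=I\\ I_1,I_2\ne\emptyset}}\omega^{(0)}_{|I_1|+1}(q,I_1)\,\omega^{(0)}_{|I_2|+1}(\sigma_i(q),I_2)\\ &\quad-\sum_{k=1}^m d_{u_k}\Big[\operatorname*{Res}_{q=\iota u_k}\sum_{\substack{I_1\sqcup I_2=I\\ I_1,I_2\neq\emptyset}}\tilde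 K(z,q,u_k)\,d_{u_k}^{-1}\big(\omega^{(0)}_{|I_1|+1}(q,I_1)\,\omega^{(0)}_{|I_2|+1}(q,I_2)\big)\Big], \end{align*} where $\sigma_i\ne\mathrm{id}$ is the local Galois involution near $\beta_i$ ($x(\sigma_i(z))=x(z)$, $\lim_{z\to\beta_i}\sigma_i(z)=\beta_i$), $d_{u}$ is the exterior differential in $u$, $d_u^{-1}\omega(u)=\int_{u'=\infty}^{u'=u}\omega(u')$, and $$K_i(z,q)=\frac{\frac12\big(\frac{dz}{z-q}-\frac{dz}{z-\sigma_i(q)}\big)}{dx(\sigma_i(q))\,(y(q)-y(\sigma_i(q)))},\qquad \tilde K(z,q,u)=\frac{\frac12\big(\frac{d(\iota z)}{\iota z-\iota q}-\frac{d(\iota z)}{\iota z-u}\big)}{dx(q)\,(y(q)-y(\iota u))}.$$ *)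

(* Defs.v *)
From HB Require Import structures.
From mathcomp Require Import all_boot all_order perm all_algebra.
From mathcomp Require Import complex reals mpoly.

Set Implicit Arguments.
Unset Strict Implicit.
Unset Printing Implicit Defensive.

Import Order.TTheory GRing.Theory Num.Theory.
Local Open Scope ring_scope.

Notation ratfun K := {fraction {poly K}}.
Notation mratfun K n := {fraction {mpoly K[n]}}.

Section UnivariateRatfun.
Variable K : fieldType.
Implicit Types f g : ratfun K.

(* [repr f] need not be in lowest terms; numerator and denominator are made
   coprime (and are thus defined up to a common non-zero constant), so that
   the roots of [rden f] are the finite poles of f and, for f != 0, those of
   [rnum f] its finite zeros. *)
Definition rnum f : {poly K} :=
  let r := frac (repr f) in r.1 %/ gcdp r.1 r.2.
Definition rden f : {poly K} :=
  let r := frac (repr f) in r.2 %/ gcdp r.1 r.2.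

Definition rX : ratfun K := tofrac 'X.

Definition rC : {rmorphism K -> ratfun K} := @tofrac {poly K} \o @polyC K.

Definition rderiv f : ratfun K :=
  tofrac ((rnum f)^`() * rden f - rnum f * (rden f)^`())
    / tofrac (rden f) ^+ 2.

(* f(t) for f in K(z) and t in an extension [phi : K -> L] which is not a pole
   of f. *)
Definition rcomp (L : fieldType) (phi : {rmorphism K -> L}) f (t : L) : L :=
  (map_poly phi (rnum f)).[t] / (map_poly phi (rden f)).[t].

Definition reval f (t : K) : K := rcomp idfun f t.

(* Coefficient of (q - t)^-1 in the Laurent expansion of f at q = t: with k the
   order of the pole, it is the Taylor coefficient of order k - 1 of
   (q - t)^k f(q).  Meaningful in characteristic 0. *)
Definition residue f (t : K) : K :=
  let k := mup t (rden f) in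
  if k is j.+1
  then reval (iter j rderiv ((rX - rC t) ^+ k * f)) t / (j`!)%:R
  else 0.

(* f(z)dz |-> f(g(z))g'(z)dz *)
Definition pullback (g f : ratfun K) : ratfun K :=
  rcomp rC f g * rderiv g.

End UnivariateRatfun.

Arguments rC {K}.

Definition rmap (K L : fieldType) (phi : {rmorphism K -> L}) (f : ratfun K) :
  ratfun L := rcomp (@rC L \o phi) f (rX L).

(* P^1(K); [None] is the point at infinity. *)
Definition P1 (K : Type) := option K.

Section ProjectiveLine.
Variable K : fieldType.
Implicit Types (f : ratfun K) (p : P1 K).

Definition fun_pole f p : bool :=
  if p is Some t then root (rden f) t
  else root (rden (rcomp rC f (rX K)^-1)) 0.

(* Poles of the differential f(z)dz; at infinity the coordinate is 1/z. *)
Definition diff_pole f p : bool :=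
  if p is Some t then root (rden f) t
  else root (rden (pullback (rX K)^-1 f)) 0.

(* Order of vanishing at p of the differential f(z)dz, f != 0 (and 0 when p is
   a pole of it). *)
Definition diff_zero_order f p : nat :=
  if p is Some t then mup t (rnum f)
  else mup 0 (rnum (pullback (rX K)^-1 f)).

(* The ramification points of x are the zeros of dx on P^1; in particular the
   multiple poles of x, where dx has a pole, are not counted. *)
Definition ramified (x : ratfun K) p : bool :=
  (0 < diff_zero_order (rderiv x) p)%N.

Definition simply_ramified (x : ratfun K) p : bool :=
  diff_zero_order (rderiv x) p == 1%N.

End ProjectiveLine.

Section Involution.
Variables (K : fieldType) (a b c : K).

Definition invol (t : K) : K := (a * t + b) / (c * t - a).

Definition involP (p : P1 K) : P1 K :=
  match p with
  | Some t => if c * t - a == 0 then None else Some (invol t)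
  | None => if c == 0 then None else Some (a / c)
  end.

(* d(invol t)/dt *)
Definition dinvol (t : K) : K := - (a ^+ 2 + b * c) / (c * t - a) ^+ 2.

End Involution.

Section MultivariateRatfun.
Variable K : fieldType.

Definition mC n : {rmorphism K -> mratfun K n} :=
  @tofrac {mpoly K[n]} \o @mpolyC n K.

Definition mX n (i : 'I_n) : mratfun K n := tofrac ('X_i : {mpoly K[n]}).

(* f(v_0, ..., v_(n-1)) for v with values in an extension [phi : K -> L].  The
   fraction [repr f] is not reduced, so this is only meaningful when the
   denominator does not vanish at v, e.g. for the v algebraically independent
   over K, which are the only ones used below. *)
Definition mcomp n (L : fieldType) (phi : {rmorphism K -> L}) (v : 'I_n -> L)
    (f : mratfun K n) : L :=
  let r := frac (repr f) in mmap phi v r.1 / mmap phi v r.2.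

(* The point (z, u_1, ..., u_m). *)
Definition vcons (L : Type) m (z : L) (u : 'I_m -> L) (i : 'I_m.+1) : L :=
  if unlift ord0 i is Some k then u k else z.

(* In K(z, u_1, ..., u_m) the variable z has index 0. *)
Definition zvar m : mratfun K m.+1 := mX ord0.
Definition uvar m (k : 'I_m) : mratfun K m.+1 := mX (lift ord0 k).

(* f(z, u_1, ..., u_m) as a function of z with coefficients in
   K(u_1, ..., u_m). *)
Definition as_fun_of_z m (f : mratfun K m.+1) : ratfun (mratfun K m) :=
  mcomp (@rC (mratfun K m) \o @mC m)
    (vcons (rX (mratfun K m)) (fun k => @rC (mratfun K m) (mX k))) f.

(* f(z_(s 0), ..., z_(s (n-1))) *)
Definition permute_vars n (s : 'S_n) (f : mratfun K n) : mratfun K n :=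
  mcomp (@mC n) (fun i => mX (s i)) f.

End MultivariateRatfun.

Arguments mC {K} n.
Arguments mX {K n} i.
Arguments uvar K {m} k.

(* (I_1, ..., I_s) pairwise disjoint, non-empty, with union {1, ..., m}. *)
Definition ordered_partition m s (P : {ffun 'I_s -> {set 'I_m}}) : bool :=
  [&& [forall j, P j != set0],
      [forall j, forall k, (j != k) ==> [disjoint P j & P k]] &
      \bigcup_j P j == [set: 'I_m]].

Section Omega.
Variable K : fieldType.
Variables (a b c : K) (x : ratfun K).

Definition yfun : ratfun K :=
  - rcomp rC x (invol (rC a) (rC b) (rC c) (rX K)).

(* A differential f dz_1 ... dz_n on (P^1)^n is given by its coefficient f;
   n-th term of the family: omega n in n variables, numbered from 0. *)
Variable omega : forall n, mratfun K n.

(* B(w, z) - B(w, invol z), the second term being pulled back in z. *)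
Definition omega2 : mratfun K 2 :=
  let w : mratfun K 2 := mX ord0 in
  let z : mratfun K 2 := mX ord_max in
  let A := mC 2 a in let B := mC 2 b in let C := mC 2 c in
  (w - z) ^- 2 - dinvol A B C z / (w - invol A B C z) ^+ 2.

Section Identity.
Variable m : nat.
Local Notation F := (mratfun K m.+1).
Local Notation z := (zvar K m).

(* Constants of F as constant functions of q, and K -> F(q). *)
Local Notation cstF := (@rC F).
Local Notation cstK := (@rC F \o mC m.+1).
Local Notation q := (rX F).

(* omega_(|J|+1)(q, J); [enum_val] lists J increasingly. *)
Definition omega_block (J : {set 'I_m}) : ratfun F :=
  mcomp cstK (vcons q (fun k : 'I_#|J| => cstF (uvar K (enum_val k))))
    (omega #|J|.+1).

(* Coefficient of dq in the differential whose residue at q = z is taken. *)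
Definition integrand s (P : {ffun 'I_s -> {set 'I_m}}) : ratfun F :=
  let dx_q := rcomp cstK (rderiv x) q in
  let dy_z := cstF (rcomp (mC m.+1) (rderiv yfun) z) in
  let y_z := cstF (rcomp (mC m.+1) yfun z) in
  let y_q := rcomp cstK yfun q in
  dy_z * dx_q / (y_z - y_q) ^+ s * \prod_(j < s) (omega_block (P j) / dx_q).

Definition identity_rhs : F :=
  \sum_(2 <= s < m.+1)
    \sum_(P : {ffun 'I_s -> {set 'I_m}} | ordered_partition P)
      s%:R^-1 * residue (integrand P) z.

Definition identity_lhs : F :=
  let A := mC m.+1 a in let B := mC m.+1 b in let C := mC m.+1 c in
  omega m.+1
  + mcomp (mC m.+1) (vcons (invol A B C z) (uvar K)) (omega m.+1)
    * dinvol A B C z.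

Definition involution_identity : Prop := identity_lhs = identity_rhs.

(* Points of P^1 at generic u_1, ..., u_m: the poles in z may be algebraic over
   K(u_1, ..., u_m), hence the quantification over its extensions L. *)
Definition poles_from_rhs : Prop :=
  forall (L : fieldType) (phi : {rmorphism mratfun K m -> L}) (p : P1 L),
    diff_pole (rmap phi (as_fun_of_z (omega m.+1))) p ->
    diff_pole (rmap phi (as_fun_of_z identity_rhs)) p.

Definition holomorphic_at_u : Prop :=
  forall k : 'I_m, ~~ diff_pole (as_fun_of_z (omega m.+1)) (Some (mX k)).

Definition holomorphic_at_invol_ram : Prop :=
  forall p : P1 K, ramified x p ->
    ~~ diff_pole (as_fun_of_z (omega m.+1)) (omap (mC m) (involP a b c p)).

End Identity.

End Omega.

(* Main.v *)
Require Import Defs.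
From HB Require Import structures.
From mathcomp Require Import all_boot all_order perm all_algebra.
From mathcomp Require Import complex reals mpoly.
From mathcomp Require Import ring fieldext.
From mathcomp Require boolp.
Set Implicit Arguments.
Unset Strict Implicit.
Unset Printing Implicit Defensive.
Import Order.TTheory GRing.Theory Num.Theory.
Import Defs.
Local Open Scope ring_scope.

(** The symmetric group is generated by the transpositions of the first argument
    with another one, so let X_0 be the first argument, the one which is singled
    out in the definition of the correlators, to be exchanged with X_k.

    Let iota be the involution, and let J range over the sets of arguments other
    than X_0 and X_k. The differentials A_J = omega(q, X_0, J) and
    C_J = omega(q, X_k, J) in q are collected as the coefficients of series A and
    C in parameters eps_j of square zero, and the omega(q, J)/dx, J non-empty, as
    the coefficients of a series delta. With D = d/dy, the residues of the
    involution identity are computed by integration by parts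
    ([residue_generic]), and all the identities for C_J together read
    ([variation_invol])

      iota^* C / dy = - \sum_n (-1)^n/n! D^n (delta^n C/dy),

    and the same holds for A, with the same delta. The operator on the right is
    the transpose, for the residue pairing, of the substitution y -> y + delta; by
    Lagrange inversion ([taylor_diffK]) it is the action on differentials of the
    inverse substitution. Thus on A and on C the involution acts, up to sign, as a
    nilpotent change of variable. Two consequences follow. Firstly, A_J and
    - iota^* A_J differ by an exact form; as A_J is regular at p or at iota p for
    every p, apart from the explicit omega_2, its residues vanish and it has a
    rational primitive alpha_J ([block_primitive]). Secondly, the form alpha C and
    its image under iota are cohomologous, the two signs cancelling
    ([exchanged_product_exact], [exchange_diff_invol]).

    Let f be the coefficient in alpha C of the set of all the arguments other than
    X_0 and X_k. Its residues at p and iota p are equal. The correlators have no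
    poles in their first argument except at the zeros of dx and at the images
    under iota of the other arguments ([correlator_regular]), apart from the
    double pole of omega_2 on the diagonal; so f is regular at p or at iota p
    unless p is one of X_0, X_k and their images ([good_place_dichotomy]). At X_0
    the residue of f is - C_I(X_0), and at X_k it is A_I(X_k), where I is the set
    of all the other arguments. The sum of all residues being zero,
    2 (A_I(X_k) - C_I(X_0)) = 0 ([exchange_contour]): this is the asserted
    invariance.

    The arguments X_i are the variables of the field K(X_0, ..., X_m), and q is
    a variable over this field; poles are located over its algebraic extensions. *)

(** * Rational functions and their values *)

Section FractionRepr.
Variable R : idomainType.

Lemma fraction_repr (f : {fraction R}) :
  f = tofrac (frac (repr f)).1 / tofrac (frac (repr f)).2.
Proof.
have d0F : tofrac (frac (repr f)).2 != 0 :> {fraction R}.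
  by rewrite tofrac_eq0 denom_ratioP.
apply: (mulIf d0F); rewrite mulfVK // -{1}[f]reprK; set r := repr f in d0F *.
unlock FracField.tofrac; rewrite -[LHS]FracField.pi_mul.
apply/eqmodP; rewrite /= FracField.equivfE /FracField.mulf.
by rewrite !numden_Ratio ?mulr1 ?mul1r ?oner_eq0 ?denom_ratioP // mulrC.
Qed.

End FractionRepr.

(* From here on fractions enter only through their field structure. *)
Opaque FracField.add FracField.mul FracField.inv FracField.opp FracField.tofrac.

Section Reduced.
Variable K : fieldType.
Implicit Types (f g : ratfun K) (n d p : {poly K}).

Lemma rnum_rden_scaled f : exists2 e : {poly K},
  (frac (repr f)).1 = e * rnum f & (frac (repr f)).2 = e * rden f.
Proof.
exists (gcdp (frac (repr f)).1 (frac (repr f)).2).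
  by rewrite mulrC divpK // dvdp_gcdl.
by rewrite mulrC divpK // dvdp_gcdr.
Qed.

Lemma rden_neq0 f : rden f != 0.
Proof.
have [e _ Ed] := rnum_rden_scaled f.
by have := denom_ratioP (repr f); rewrite {1}Ed mulf_eq0 negb_or => /andP[].
Qed.

Lemma rnum_rden_coprime f : coprimep (rnum f) (rden f).
Proof.
rewrite /rnum /rden coprimep_div_gcd //.
by rewrite (negPf (denom_ratioP _)) orbT.
Qed.

Lemma rfracE f : f = tofrac (rnum f) / tofrac (rden f).
Proof.
rewrite {1}[f]fraction_repr.
have [e En Ed] := rnum_rden_scaled f.
have := denom_ratioP (repr f); rewrite {1}Ed mulf_eq0 negb_or => /andP[e0 d0].
rewrite En Ed !tofracM -mulf_div divff ?mul1r // tofrac_eq0 //.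
Qed.

(** Every representation of a rational function is a common multiple of the
    reduced one, so that its poles can be read off any representation. *)
Lemma rfrac_scaled f n d : d != 0 -> f = tofrac n / tofrac d ->
  exists2 e : {poly K}, n = e * rnum f & d = e * rden f.
Proof.
move=> d0 Ef.
have cr : n * rden f = rnum f * d.
  apply/eqP; rewrite -tofrac_eq !tofracM.
  have := rfracE f; rewrite [X in X = _]Ef => /eqP.
  by rewrite eqr_div ?tofrac_eq0 ?rden_neq0 // => /eqP ->.
have dv : rden f %| d.
  rewrite -(@Gauss_dvdpr _ _ (rnum f)) 1?coprimep_sym ?rnum_rden_coprime //.
  by rewrite -cr dvdp_mull.
exists (d %/ rden f); last by rewrite divpK.
apply: (mulIf (rden_neq0 f)); rewrite cr mulrAC divpK // mulrC.
by [].
Qed.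

Lemma rfracP f : exists nd : {poly K} * {poly K},
  nd.2 != 0 /\ f = tofrac nd.1 / tofrac nd.2.
Proof. by exists (rnum f, rden f); split; [exact: rden_neq0 | exact: rfracE]. Qed.

End Reduced.

Section Evaluation.
Variables (K L : fieldType) (phi : {rmorphism K -> L}) (t : L).
Implicit Types (f g : ratfun K) (n d p : {poly K}).

Local Notation ev p := (map_poly phi p).[t].

Definition reg_at f := ev (rden f) != 0.

Lemma rcomp_frac n d : ev d != 0 ->
  rcomp phi (tofrac n / tofrac d) t = ev n / ev d.
Proof.
move=> dt0; have d0 : d != 0.
  by apply: contraNneq dt0 => ->; rewrite rmorph0 horner0.
move Ef: (tofrac n / tofrac d) => f.
have [e En Ed] := rfrac_scaled d0 (esym Ef); rewrite /rcomp.
move: dt0; rewrite En Ed !rmorphM !hornerM mulf_eq0 negb_or.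
by case/andP=> e0 r0; rewrite -mulf_div divff ?mul1r.
Qed.

Lemma reg_at_frac n d : ev d != 0 -> reg_at (tofrac n / tofrac d).
Proof.
move=> dt0; have d0 : d != 0.
  by apply: contraNneq dt0 => ->; rewrite rmorph0 horner0.
move Ef: (tofrac n / tofrac d) => f.
have [e _ Ed] := rfrac_scaled d0 (esym Ef).
move: dt0; rewrite Ed rmorphM hornerM mulf_eq0 negb_or.
by case/andP.
Qed.

Variant reg_at_spec f : Prop :=
  RegAtSpec n d of ev d != 0 & d != 0 & f = tofrac n / tofrac d.

Lemma reg_atP f : reg_at f -> reg_at_spec f.
Proof.
move=> h; apply: (@RegAtSpec f (rnum f) (rden f)) => //.
  exact: rden_neq0.
exact: rfracE.
Qed.

Lemma reg_at_tofrac p : reg_at (tofrac p).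
Proof.
rewrite -[tofrac p]divr1 -tofrac1; apply: reg_at_frac.
by rewrite rmorph1 hornerC oner_neq0.
Qed.

Lemma rcomp_tofrac p : rcomp phi (tofrac p) t = ev p.
Proof.
rewrite -[tofrac p]divr1 -tofrac1 rcomp_frac rmorph1 hornerC ?oner_neq0 //.
by rewrite divr1.
Qed.

Lemma reg_atC k : reg_at (rC k).
Proof. exact: reg_at_tofrac. Qed.

Lemma rcompC k : rcomp phi (rC k) t = phi k.
Proof. by rewrite rcomp_tofrac map_polyC hornerC. Qed.

Lemma reg_atX : reg_at (rX K).
Proof. exact: reg_at_tofrac. Qed.

Lemma rcompX : rcomp phi (rX K) t = t.
Proof. by rewrite rcomp_tofrac map_polyX hornerX. Qed.

Lemma reg_rcompD f g : reg_at f -> reg_at g ->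
  reg_at (f + g) /\ rcomp phi (f + g) t = rcomp phi f t + rcomp phi g t.
Proof.
case/reg_atP=> n d dt d0 ->; case/reg_atP=> n' d' dt' d0' ->.
rewrite addf_div ?tofrac_eq0 // -!tofracM -tofracD.
have dd : ev (d * d') != 0 by rewrite rmorphM hornerM mulf_neq0.
split; first exact: reg_at_frac.
by rewrite !rcomp_frac // rmorphD !rmorphM hornerD !hornerM addf_div.
Qed.

Lemma reg_rcompM f g : reg_at f -> reg_at g ->
  reg_at (f * g) /\ rcomp phi (f * g) t = rcomp phi f t * rcomp phi g t.
Proof.
case/reg_atP=> n d dt d0 ->; case/reg_atP=> n' d' dt' d0' ->.
rewrite mulf_div -!tofracM.
have dd : ev (d * d') != 0 by rewrite rmorphM hornerM mulf_neq0.
split; first exact: reg_at_frac.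
by rewrite !rcomp_frac // !rmorphM !hornerM mulf_div.
Qed.

Lemma reg_atD f g : reg_at f -> reg_at g -> reg_at (f + g).
Proof. by move=> hf /(reg_rcompD hf)[]. Qed.
Lemma reg_atM f g : reg_at f -> reg_at g -> reg_at (f * g).
Proof. by move=> hf /(reg_rcompM hf)[]. Qed.
Lemma rcompD f g : reg_at f -> reg_at g ->
  rcomp phi (f + g) t = rcomp phi f t + rcomp phi g t.
Proof. by move=> hf /(reg_rcompD hf)[]. Qed.
Lemma rcompM f g : reg_at f -> reg_at g ->
  rcomp phi (f * g) t = rcomp phi f t * rcomp phi g t.
Proof. by move=> hf /(reg_rcompM hf)[]. Qed.

Lemma reg_at0 : reg_at 0.
Proof. by rewrite -tofrac0 reg_at_tofrac. Qed.
Lemma reg_at1 : reg_at 1.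
Proof. by rewrite -tofrac1 reg_at_tofrac. Qed.
Lemma rcomp0 : rcomp phi 0 t = 0.
Proof. by rewrite -tofrac0 rcomp_tofrac rmorph0 horner0. Qed.
Lemma rcomp1 : rcomp phi 1 t = 1.
Proof. by rewrite -tofrac1 rcomp_tofrac rmorph1 hornerC. Qed.

Lemma reg_atN f : reg_at f -> reg_at (- f).
Proof. by move=> h; rewrite -mulN1r -tofrac1 -tofracN reg_atM ?reg_at_tofrac. Qed.
Lemma reg_atB f g : reg_at f -> reg_at g -> reg_at (f - g).
Proof. by move=> h h'; rewrite reg_atD ?reg_atN. Qed.
Lemma rcompN f : reg_at f -> rcomp phi (- f) t = - rcomp phi f t.
Proof.
move=> h; apply/eqP; rewrite -subr_eq0 opprK addrC -rcompD ?reg_atN //.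
by rewrite subrr rcomp0.
Qed.
Lemma rcompB f g : reg_at f -> reg_at g ->
  rcomp phi (f - g) t = rcomp phi f t - rcomp phi g t.
Proof. by move=> h h'; rewrite rcompD ?reg_atN ?rcompN. Qed.

Lemma reg_atX_n f (n : nat) : reg_at f -> reg_at (f ^+ n).
Proof. by move=> h; elim: n => [|n ih]; rewrite ?expr0 ?exprS ?reg_at1 ?reg_atM. Qed.

Lemma rcompX_n f (n : nat) : reg_at f -> rcomp phi (f ^+ n) t = rcomp phi f t ^+ n.
Proof.
move=> h; elim: n => [|n ih]; first by rewrite !expr0 rcomp1.
by rewrite !exprS rcompM ?reg_atX_n // ih.
Qed.

Lemma reg_atV f : reg_at f -> rcomp phi f t != 0 -> reg_at f^-1.
Proof.
case/reg_atP=> n d dt d0 ->; rewrite rcomp_frac // mulf_eq0 negb_or invf_div.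
by case/andP=> nt _; apply: reg_at_frac.
Qed.

Lemma rcompV f : reg_at f -> rcomp phi f t != 0 ->
  rcomp phi f^-1 t = (rcomp phi f t)^-1.
Proof.
move=> h h0; have f0 : f != 0 by apply: contraNneq h0 => ->; rewrite rcomp0.
by apply: (mulfI h0); rewrite -rcompM ?reg_atV // !divff // rcomp1.
Qed.

(** At a transcendental [t] every rational function has a value, and evaluation
    is a field morphism: this is what makes the substitutions below total. *)
Definition transc := forall p : {poly K}, p != 0 -> ev p != 0.

Lemma transc_reg f : transc -> reg_at f.
Proof. by move=> tr; apply: tr; apply: rden_neq0. Qed.

Definition rat_ev (tr : transc) f : L := rcomp phi f t.

Lemma rat_ev_is_zmod (tr : transc) : zmod_morphism (rat_ev tr).
Proof. by move=> f g; rewrite /rat_ev rcompB //; apply: transc_reg. Qed.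
Lemma rat_ev_is_monoid (tr : transc) : monoid_morphism (rat_ev tr).
Proof.
split; first exact: rcomp1.
by move=> f g; rewrite /rat_ev rcompM //; apply: transc_reg.
Qed.
HB.instance Definition _ (tr : transc) :=
  GRing.isZmodMorphism.Build _ _ (rat_ev tr) (rat_ev_is_zmod tr).
HB.instance Definition _ (tr : transc) :=
  GRing.isMonoidMorphism.Build _ _ (rat_ev tr) (rat_ev_is_monoid tr).

End Evaluation.

Arguments transc {K L}.
Arguments reg_at {K L}.

Section Homs.
Variables K L : fieldType.

Lemma eq_rcomp (phi psi : {rmorphism K -> L}) f t :
  phi =1 psi -> rcomp phi f t = rcomp psi f t.
Proof. by move=> e; rewrite /rcomp !(eq_map_poly e). Qed.

Lemma rmorph_rcomp (M : fieldType) (psi : {rmorphism L -> M})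
    (phi : {rmorphism K -> L}) f t :
  psi (rcomp phi f t) = rcomp (psi \o phi) f (psi t).
Proof. by rewrite /rcomp fmorph_div -!horner_map -!map_poly_comp. Qed.

Lemma transc_hom (M : fieldType) (psi : {rmorphism L -> M})
    (phi : {rmorphism K -> L}) t :
  transc phi t -> transc (psi \o phi) (psi t).
Proof. by move=> h p p0; rewrite map_poly_comp horner_map fmorph_eq0 h. Qed.

Lemma horner_rX (phi : {rmorphism K -> L}) p :
  (map_poly (@rC L \o phi) p).[rX L] = tofrac (map_poly phi p).
Proof.
elim/poly_ind: p => [|p k ih]; first by rewrite !rmorph0 horner0.
rewrite !rmorphD !rmorphM /= hornerD hornerM ih !map_polyX hornerX.
by rewrite !map_polyC hornerC.
Qed.

Lemma transc_rX (phi : {rmorphism K -> L}) : transc (@rC L \o phi) (rX L).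
Proof. by move=> p p0; rewrite horner_rX tofrac_eq0 map_poly_eq0. Qed.

Section Rmap.
Variable phi : {rmorphism K -> L}.

Lemma rmap_is_zmod : zmod_morphism (rmap phi).
Proof. exact: (rat_ev_is_zmod (transc_rX phi)). Qed.
Lemma rmap_is_monoid : monoid_morphism (rmap phi).
Proof. exact: (rat_ev_is_monoid (transc_rX phi)). Qed.
HB.instance Definition _ :=
  GRing.isZmodMorphism.Build _ _ (rmap phi) rmap_is_zmod.
HB.instance Definition _ :=
  GRing.isMonoidMorphism.Build _ _ (rmap phi) rmap_is_monoid.

Lemma rmap_tofrac p : rmap phi (tofrac p) = tofrac (map_poly phi p).
Proof. by rewrite /rmap rcomp_tofrac horner_rX. Qed.
Lemma rmap_frac n d :
  rmap phi (tofrac n / tofrac d) = tofrac (map_poly phi n) / tofrac (map_poly phi d).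
Proof. by rewrite -!rmap_tofrac; apply: (fmorph_div (rmap phi)). Qed.
Lemma rmapC k : rmap phi (rC k) = rC (phi k).
Proof. by rewrite /rmap rcompC. Qed.
Lemma rmapX : rmap phi (rX K) = rX L.
Proof. by rewrite /rmap rcompX. Qed.
End Rmap.

End Homs.

(** * The derivation of rational functions *)

Section FieldIdentities.
Variable F : fieldType.
Implicit Types n d m e : F.

(** The rules of calculus for fractions reduce to identities in an abstract
    field. *)
Lemma quotient_rule_mul n d m e n' d' m' e' : d != 0 -> e != 0 ->
  ((n' * m + n * m') * (d * e) - n * m * (d' * e + d * e')) / (d * e) ^+ 2
  = (n' * d - n * d') / d ^+ 2 * (m / e) + n / d * ((m' * e - m * e') / e ^+ 2).
Proof. by move=> d0 e0; field; rewrite d0 e0. Qed.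

Lemma quotient_rule_add n d m e n' d' m' e' : d != 0 -> e != 0 ->
  ((n' * e + n * e' + (m' * d + m * d')) * (d * e)
     - (n * e + m * d) * (d' * e + d * e')) / (d * e) ^+ 2
  = (n' * d - n * d') / d ^+ 2 + (m' * e - m * e') / e ^+ 2.
Proof. by move=> d0 e0; field; rewrite d0 e0. Qed.

Lemma quotient_rule_chain n d n' d' t : d != 0 ->
  n' * t / d + n * (- (d' * t) / d ^+ 2) = (n' * d - n * d') / d ^+ 2 * t.
Proof. by move=> d0; field. Qed.

Lemma polar_quotient_rule (g g' q : F) (k : nat) : q != 0 ->
  g' / q ^+ k.+1 + g * (- (k.+1%:R * q ^+ k) / q ^+ (k.+1 * 2))
  = (q * g' - k.+1%:R * g) / q ^+ k.+2.
Proof.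
move=> q0; have qk : q ^+ k != 0 by rewrite expf_neq0.
rewrite mulnC exprM exprAC !exprS expr0; move: (q ^+ k) qk => p p0.
by field; rewrite q0 p0.
Qed.

Lemma polar_primitive_rule (c q k : F) (n : nat) : q != 0 -> k != 0 ->
  c / q ^+ n.+2 = - c / k * (- (k * q ^+ n) / (q ^+ n.+1) ^+ 2).
Proof.
move=> q0 k0; have qk : q ^+ n != 0 by rewrite expf_neq0.
rewrite !exprS expr0; move: (q ^+ n) qk => p p0.
by field; rewrite q0 p0 k0.
Qed.

Lemma partial_fraction_rule (q k d s qN : F) : qN != 0 -> s != 0 -> d != 0 ->
  (q * s + k * d) / (qN * s * d) = k / (qN * s) + q / (qN * d).
Proof. by move=> q0 s0 d0; field; rewrite q0 s0 d0. Qed.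

Lemma inv_qminus_infinity_rule (q v : F) : q != 0 -> - v * q + 1 != 0 ->
  (q^-1 - v)^-1 = q / (- v * q + 1).
Proof.
move=> q0 h; have -> : q^-1 - v = (- v * q + 1) / q by field.
by rewrite invf_div.
Qed.

Lemma residue_infinity_rule (c a q : F) : q != 0 -> 1 - a * q != 0 ->
  c / (q^-1 - a) * - (q ^+ 2)^-1 = - c / (1 - a * q) / q.
Proof.
move=> q0 a0; have -> : q^-1 - a = (1 - a * q) / q by field.
by field; rewrite q0 a0.
Qed.

Lemma reg_primitive_rule (q k r f f2 : F) :
  q * (k * r * f + q * r * f2) - k * (q * r * f) = q * (q * r) * f2.
Proof. by ring. Qed.

Variable D : F -> F.
Hypothesis D1 : D 1 = 0.
Hypothesis DM : forall f g, D (f * g) = D f * g + f * D g.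

Lemma derivation_inv f : f != 0 -> D f^-1 = - D f / f ^+ 2.
Proof.
move=> f0; have := DM f f^-1; rewrite divff // D1 => /esym/eqP.
rewrite addr_eq0 => /eqP e; apply: (mulfI f0); rewrite -[LHS]opprK -e.
by field.
Qed.

Lemma derivation_exp f (n : nat) : D (f ^+ n.+1) = n.+1%:R * f ^+ n * D f.
Proof.
elim: n => [|n ih]; first by rewrite expr1 expr0 mulr1 mul1r.
rewrite exprS DM ih -[n.+2]addn1 natrD exprS; ring.
Qed.

End FieldIdentities.

Section Derivation.
Variable K : fieldType.
Implicit Types (f g : ratfun K) (n d p : {poly K}).

Lemma rderiv_frac n d : d != 0 ->
  rderiv (tofrac n / tofrac d)
  = tofrac (n^`() * d - n * d^`()) / tofrac d ^+ 2.
Proof.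
move=> d0; move Ef: (tofrac n / tofrac d) => f.
have [e En Ed] := rfrac_scaled d0 (esym Ef); rewrite /rderiv.
move: d0 (rden_neq0 f); rewrite {1}Ed mulf_eq0 negb_or => /andP[e0 r0] _.
apply/eqP; rewrite eqr_div ?expf_neq0 ?tofrac_eq0 ?Ed ?mulf_neq0 //.
rewrite -!tofracXn -!tofracM tofrac_eq En !derivM; apply/eqP; ring.
Qed.

Lemma rderiv_tofrac p : rderiv (tofrac p) = tofrac p^`().
Proof.
rewrite -[tofrac p]divr1 -tofrac1 rderiv_frac ?oner_eq0 //.
by rewrite derivC mulr0 subr0 mulr1 tofrac1 expr1n divr1.
Qed.

Lemma rderivC k : rderiv (rC k) = 0 :> ratfun K.
Proof. by rewrite rderiv_tofrac derivC tofrac0. Qed.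

Lemma rderivX : rderiv (rX K) = 1.
Proof. by rewrite rderiv_tofrac derivX tofrac1. Qed.

Lemma rderivM f g : rderiv (f * g) = rderiv f * g + f * rderiv g.
Proof.
have [[n d] [/= d0 ->]] := rfracP f; have [[n' d'] [/= d0' ->]] := rfracP g.
rewrite mulf_div -!tofracM !rderiv_frac ?mulf_neq0 // !derivM.
rewrite !(tofracD, tofracN, tofracM).
by apply: quotient_rule_mul; rewrite tofrac_eq0.
Qed.

Lemma rderivD f g : rderiv (f + g) = rderiv f + rderiv g.
Proof.
have [[n d] [/= d0 ->]] := rfracP f; have [[n' d'] [/= d0' ->]] := rfracP g.
rewrite addf_div ?tofrac_eq0 // -!tofracM -tofracD.
rewrite !rderiv_frac ?mulf_neq0 // derivD !derivM.
rewrite !(tofracD, tofracN, tofracM).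
by apply: quotient_rule_add; rewrite tofrac_eq0.
Qed.

Lemma rderiv_is_zmod : zmod_morphism (@rderiv K).
Proof.
move=> f g; rewrite rderivD -mulN1r rderivM -tofrac1 -tofracN.
by rewrite rderiv_tofrac derivN derivC oppr0 tofrac0 mul0r add0r tofracN tofrac1 mulN1r.
Qed.
HB.instance Definition _ :=
  GRing.isZmodMorphism.Build _ _ (@rderiv K) rderiv_is_zmod.

Lemma rderiv1 : rderiv 1 = 0 :> ratfun K.
Proof. by rewrite -(rmorph1 (@rC K)) rderivC. Qed.

Lemma rderivCM k f : rderiv (rC k * f) = rC k * rderiv f.
Proof. by rewrite rderivM rderivC mul0r add0r. Qed.

Lemma rderivXn f (n : nat) : rderiv (f ^+ n.+1) = n.+1%:R * f ^+ n * rderiv f.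
Proof. exact: (derivation_exp rderivM). Qed.

Lemma rderivV f : f != 0 -> rderiv f^-1 = - rderiv f / f ^+ 2.
Proof. exact: (derivation_inv rderiv1 rderivM). Qed.

End Derivation.

Section ChainRule.
Variables (K L : fieldType) (th : {rmorphism ratfun K -> ratfun L}).
Hypothesis th_const : forall k, rderiv (th (rC k)) = 0.

(** The chain rule: both sides are derivations along [th], and they agree on
    constants and on the variable. *)
Lemma rderiv_hom f : rderiv (th f) = th (rderiv f) * rderiv (th (rX K)).
Proof.
have step p : rderiv (th (tofrac p)) = th (tofrac p^`()) * rderiv (th (rX K)).
  elim/poly_ind: p => [|p k ih].
    by rewrite deriv0 !tofrac0 !rmorph0 raddf0 mul0r.
  rewrite derivD derivC addr0 derivM derivX mulr1.
  rewrite !tofracD !tofracM !rmorphD !rmorphM /= raddfD /= th_const addr0.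
  by rewrite rderivM ih mulrAC -mulrDl.
have [[n d] [/= d0 ->]] := rfracP f; rewrite (rderiv_frac n d0).
have thd0 : th (tofrac d) != 0 by rewrite fmorph_eq0 tofrac_eq0.
rewrite (fmorph_div th (tofrac n)) rderivM (rderivV thd0) (step n) (step d) (fmorph_div th).
rewrite !(tofracD, tofracN, tofracM) !(rmorphD, rmorphN, rmorphM, rmorphXn) /=.
exact: quotient_rule_chain.
Qed.

End ChainRule.

Lemma rmap_deriv (K L : fieldType) (phi : {rmorphism K -> L}) f :
  rderiv (rmap phi f) = rmap phi (rderiv f).
Proof.
rewrite rderiv_hom => [|k]; last by rewrite /= rmapC rderivC.
by rewrite /= rmapX rderivX mulr1.
Qed.

Section Substitution.
Variable K : fieldType.
Hypothesis K0 : [pchar K] =i pred0.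
Implicit Types (f g h : ratfun K).

Lemma deriv_eq0_size (p : {poly K}) : p^`() = 0 -> (size p <= 1)%N.
Proof.
move=> dp0; rewrite leqNgt; apply/negP=> s1.
have e : (size p).-2.+1 = (size p).-1 by case: (size p) s1 => [|[|s]].
have p0 : p != 0 by rewrite -size_poly_gt0 (ltn_trans _ s1).
have := congr1 (fun q : {poly K} => q`_(size p).-2) dp0.
rewrite /= coef_deriv coef0 e -lead_coefE => /eqP.
rewrite -mulr_natr mulf_eq0 lead_coef_eq0 (negPf p0) /=.
by rewrite ((pcharf0P K).1 K0) -e.
Qed.

(** In lowest terms n/d, a vanishing derivative means n' d = n d'; as d is prime
    to n it divides d', so d' = 0 by degree, and then n' = 0. *)
Lemma rderiv_eq0 f : rderiv f = 0 -> exists k, f = rC k.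
Proof.
move=> Df; have d0 := rden_neq0 f; have Ef := rfracE f.
have cr : (rnum f)^`() * rden f = rnum f * (rden f)^`().
  apply/eqP; rewrite -subr_eq0 -tofrac_eq0.
  move: Df; rewrite {1}Ef rderiv_frac // => /eqP; rewrite mulf_eq0.
  by rewrite invr_eq0 expf_eq0 /= !tofrac_eq0 (negPf d0) orbF.
have dd0 : (rden f)^`() = 0.
  apply/eqP; apply: contraT => dd0.
  have : rden f %| (rden f)^`().
    rewrite -(@Gauss_dvdpr _ _ (rnum f)) 1?coprimep_sym ?rnum_rden_coprime //.
    by rewrite -cr dvdp_mull.
  by move/(dvdp_leq dd0); rewrite leqNgt lt_size_deriv.
have dn0 : (rnum f)^`() = 0.
  by move/eqP: cr; rewrite dd0 mulr0 mulf_eq0 (negPf d0) orbF => /eqP.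
rewrite Ef (size1_polyC (deriv_eq0_size dd0)) (size1_polyC (deriv_eq0_size dn0)).
by exists ((rnum f)`_0 / (rden f)`_0); rewrite fmorph_div.
Qed.

(** A vanishing polynomial of minimal degree in [g] would, after derivation,
    give one of smaller degree. *)
Lemma transc_deriv g : rderiv g != 0 -> transc (@rC K) g.
Proof.
move=> Dg p; move: {2}(size p) (leqnn (size p)) => n.
elim: n p => [|n ih] p.
  by rewrite leqn0 size_poly_eq0 => /eqP -> /eqP [].
move=> sp p0; apply/negP => /eqP pg0.
have Dp : (map_poly (@rC K) p^`()).[g] = 0.
  apply: (mulIf Dg); rewrite mul0r -[RHS](raddf0 (@rderiv K)) -pg0.
  elim/poly_ind: (p) => [|q k IH].
    by rewrite deriv0 !rmorph0 !horner0 raddf0 mul0r.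
  rewrite derivD derivM derivC derivX addr0 mulr1 !rmorphD !rmorphM /=.
  rewrite map_polyX map_polyC !hornerD !hornerM hornerX hornerC raddfD /=.
  by rewrite rderivC addr0 rderivM -IH mulrDl mulrAC.
have [/eqP|] := boolP (p^`() == 0); last first.
  move=> dp0; have := ih p^`(); rewrite Dp eqxx => /(_ _ dp0)/negP[] //.
  by rewrite -ltnS (leq_trans (lt_size_deriv p0)).
move=> dp0; have sp1 := deriv_eq0_size dp0.
move: pg0; rewrite (size1_polyC sp1) map_polyC hornerC => /eqP.
rewrite fmorph_eq0 => /eqP c0; move: p0; rewrite (size1_polyC sp1) c0.
by rewrite polyC0 eqxx.
Qed.

End Substitution.

(** * Residues and partial fractions *)

Notation reg := (reg_at idfun).

Section LocalTheory.
Variable K : fieldType.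
Hypothesis K0 : [pchar K] =i pred0.
Implicit Types (f g h : ratfun K) (n d p : {poly K}) (t : K).

Lemma natr_neq0 (n : nat) : n.+1%:R != 0 :> K.
Proof. by rewrite ((pcharf0P K).1 K0). Qed.

Lemma ratfun_natr_neq0 (n : nat) : n.+1%:R != 0 :> ratfun K.
Proof. by rewrite -(rmorph_nat (@rC K)) fmorph_eq0 natr_neq0. Qed.

Lemma regE t f : reg t f = ~~ root (rden f) t.
Proof. by rewrite /reg_at map_poly_id. Qed.

Lemma reg_deriv t f : reg t f -> reg t (rderiv f).
Proof.
case/reg_atP=> n d dt d0 ->; rewrite rderiv_frac // -tofracXn.
by apply: reg_at_frac; rewrite rmorphXn horner_exp expf_neq0.
Qed.

Lemma reg_iter_deriv t f (i : nat) : reg t f -> reg t (iter i (@rderiv K) f).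
Proof. by move=> h; elim: i => //= i; apply: reg_deriv. Qed.

Definition qminus t : ratfun K := tofrac ('X - t%:P).

Lemma qminusE t : qminus t = rX K - rC t.
Proof. by rewrite /qminus tofracB. Qed.

Lemma qminus_neq0 t : qminus t != 0.
Proof. by rewrite tofrac_eq0 polyXsubC_eq0. Qed.

Lemma qminusX_neq0 t (k : nat) : qminus t ^+ k != 0.
Proof. by rewrite expf_neq0 // qminus_neq0. Qed.

Lemma reg_qminus t a : reg t (qminus a).
Proof. exact: reg_at_tofrac. Qed.

Lemma reval_qminus t a : reval (qminus a) t = t - a.
Proof. by rewrite qminusE /reval rcompB ?reg_atX ?reg_atC // rcompX rcompC. Qed.

Lemma deriv_qminus t : rderiv (qminus t) = 1.
Proof. by rewrite rderiv_tofrac derivXsubC tofrac1. Qed.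

Lemma reg_div_qminus t g : reg t g ->
  exists2 g1, reg t g1 & g = rC (reval g t) + qminus t * g1.
Proof.
move=> rg; set g' := g - rC (reval g t).
have rg' : reg t g' by rewrite reg_atB ?reg_atC.
have g'0 : reval g' t = 0.
  by rewrite /reval rcompB ?reg_atC // rcompC /reval subrr.
case/reg_atP: rg' g'0 => n d dt d0 Eg'.
rewrite Eg' /reval rcomp_frac // => /eqP.
rewrite mulf_eq0 invr_eq0 (negPf dt) orbF map_poly_id // => /factor_theorem[n1 En].
exists (tofrac n1 / tofrac d); first exact: reg_at_frac.
by rewrite mulrA -tofracM [X in tofrac X]mulrC -En -Eg' addrC subrK.
Qed.

Lemma polar_form t f : exists k : nat, exists2 g, reg t g & f = g / qminus t ^+ k.
Proof.
have [[n d] [/= d0 ->]] := rfracP f.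
have [k [d1 d1t Ed]] := multiplicity_XsubC d t.
rewrite d0 /= in d1t.
exists k, (tofrac n / tofrac d1).
  by apply: reg_at_frac; rewrite map_poly_id.
by rewrite Ed tofracM tofracXn invfM mulrA.
Qed.

Lemma polar_formS t f :
  exists k : nat, exists2 g, reg t g & f = g / qminus t ^+ k.+1.
Proof.
have [k [g rg ->]] := polar_form t f; exists k, (qminus t * g).
  by rewrite reg_atM ?reg_qminus.
by rewrite exprS -mulf_div divff ?qminus_neq0 // mul1r.
Qed.

Lemma iter_derivD (i : nat) f g :
  iter i (@rderiv K) (f + g) = iter i (@rderiv K) f + iter i (@rderiv K) g.
Proof. by elim: i => //= i ->; rewrite raddfD. Qed.

Lemma iter_derivCM (i : nat) c f :
  iter i (@rderiv K) (rC c * f) = rC c * iter i (@rderiv K) f.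
Proof. by elim: i => //= i ->; rewrite rderivCM. Qed.

Lemma iter_deriv_qminus t (i : nat) h :
  iter i.+1 (@rderiv K) (qminus t * h)
  = qminus t * iter i.+1 (@rderiv K) h + rC i.+1%:R * iter i (@rderiv K) h.
Proof.
elim: i => [|i ih].
  have -> : rC 1%:R = 1 :> ratfun K by apply: rmorph1.
  by rewrite iterS rderivM deriv_qminus !mul1r addrC.
have -> : rC i.+2%:R = 1 + rC i.+1%:R :> ratfun K.
  by rewrite -[i.+2]add1n natrD rmorphD rmorph1.
rewrite iterS ih rderivD rderivM deriv_qminus mul1r rderivCM mulrDl mul1r -!iterS.
by rewrite addrA [_ + qminus t * _]addrC.
Qed.

Lemma taylor_shift t (i : nat) h : reg t h ->
  reval (iter i.+1 (@rderiv K) (qminus t * h)) t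
  = i.+1%:R * reval (iter i (@rderiv K) h) t.
Proof.
move=> rh; rewrite iter_deriv_qminus.
move: (reg_iter_deriv i rh) (reg_iter_deriv i.+1 rh).
move: (iter i _ _) (iter i.+1 _ _) => f g rf rg.
rewrite /reval rcompD ?reg_atM ?reg_qminus ?reg_atC //.
rewrite (rcompM (reg_qminus t t) rg) (rcompM (reg_atC _ _ _) rf) rcompC.
by rewrite [rcomp _ (qminus t) _]reval_qminus subrr mul0r add0r.
Qed.

Lemma taylor_shiftX t (i j : nat) h : reg t h ->
  reval (iter (j + i) (@rderiv K) (qminus t ^+ j * h)) t / ((j + i)`!)%:R
  = reval (iter i (@rderiv K) h) t / (i`!)%:R.
Proof.
move=> rh; elim: j => [|j ih]; first by rewrite expr0 mul1r.
rewrite exprS -mulrA addSn taylor_shift; last first.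
  by rewrite reg_atM // reg_atX_n // reg_qminus.
by rewrite factS natrM -mulf_div divff ?natr_neq0 // mul1r ih.
Qed.

Lemma taylor_shift0 t (i : nat) h : reg t h ->
  reval (iter i (@rderiv K) (qminus t ^+ i.+1 * h)) t = 0.
Proof.
move=> rh; have rk (k : nat) : reg t (qminus t ^+ k * h).
  by rewrite reg_atM // reg_atX_n // reg_qminus.
elim: i => [|i ih]; last by rewrite exprS -mulrA taylor_shift // ih mulr0.
rewrite /= expr1 /reval rcompM ?reg_qminus // [X in X * _]reval_qminus.
by rewrite subrr mul0r.
Qed.

(** The residue may be computed from any representation with a pole of order
    at most [k.+1], not only from the one of minimal order; this gives additivity. *)
Lemma residue_polar t (k : nat) g : reg t g ->
  residue (g / qminus t ^+ k.+1) t = reval (iter k (@rderiv K) g) t / (k`!)%:R.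
Proof.
move=> rg; set f := g / _.
have Eg : g = qminus t ^+ k.+1 * f by rewrite mulrC divfK ?qminusX_neq0.
have [i [d1 d1t Ed]] := multiplicity_XsubC (rden f) t.
rewrite rden_neq0 /= in d1t.
have d10 : d1 != 0 by apply: contraNneq d1t => ->; rewrite root0.
have mE : mup t (rden f) = i.
  rewrite Ed mupMr // -[X in 'X - X]/(t%:P) mup_XsubCX eqxx //.
pose g0 := tofrac (rnum f) / tofrac d1.
have rg0 : reg t g0 by apply: reg_at_frac; rewrite map_poly_id.
have Ef : f = g0 / qminus t ^+ i.
  by rewrite {1}[f]rfracE Ed tofracM tofracXn invfM mulrA.
have g0E : qminus t ^+ i * f = g0 by rewrite Ef mulrC divfK ?qminusX_neq0.
have le_ik : (i <= k.+1)%N.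
  rewrite -mE; case/reg_atP: (rg) => n d dt d0 En.
  have dd0 : ('X - t%:P) ^+ k.+1 * d != 0 by rewrite mulf_neq0 ?expf_neq0 ?polyXsubC_eq0.
  have Ef2 : f = tofrac n / tofrac (('X - t%:P) ^+ k.+1 * d).
    by rewrite /f En tofracM tofracXn [in RHS]invfM [in RHS]mulrCA mulrC.
  have [e _ Ede] := rfrac_scaled dd0 Ef2.
  have nd : ~~ root d t by move: dt; rewrite map_poly_id.
  have <- : mup t (('X - t%:P) ^+ k.+1 * d) = k.+1.
    by rewrite mupMl // mup_XsubCX eqxx.
  have : (mup t (rden f) <= mup t (e * rden f))%N.
    have e0 : e != 0 by apply: contraNneq dd0 => e0; rewrite Ede e0 mul0r.
    by rewrite mupM ?rden_neq0 // leq_addl.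
  by rewrite -Ede.
rewrite /residue mE; case: i le_ik {mE Ed} Ef g0E => [|i] le_ik Ef g0E.
  move: Ef; rewrite expr0 divr1 => Ef.
  by rewrite Eg Ef taylor_shift0 // mul0r.
rewrite -qminusE g0E Eg Ef mulrCA.
have -> : qminus t ^+ k.+1 / qminus t ^+ i.+1 = qminus t ^+ (k - i).
  rewrite -{1}(subnK le_ik) subSS exprD mulfK ?qminusX_neq0 //.
rewrite [g0 * _]mulrC -(taylor_shiftX i (k - i) rg0) subnK //.
Qed.

Lemma residue_simple t g : reg t g -> residue (g / qminus t) t = reval g t.
Proof.
by move=> rg; rewrite -[qminus t]expr1 residue_polar // fact0 divr1.
Qed.

Lemma residue_reg t f : reg t f -> residue f t = 0.
Proof.
move=> rf; have -> : f = (qminus t * f) / qminus t.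
  by rewrite mulrC mulKf ?qminus_neq0.
rewrite residue_simple ?reg_atM ?reg_qminus // /reval rcompM ?reg_qminus //.
by rewrite [X in X * _]reval_qminus subrr mul0r.
Qed.

Lemma residueD t f g : residue (f + g) t = residue f t + residue g t.
Proof.
have [i [f1 rf1 Ef]] := polar_formS t f; have [j [g1 rg1 Eg]] := polar_formS t g.
have widen (k l : nat) h : h / qminus t ^+ k.+1
    = (qminus t ^+ l * h) / qminus t ^+ (k + l).+1.
  rewrite -addSn exprD mulrC invfM [_ * h]mulrC mulrACA divff ?qminusX_neq0 //.
  by rewrite mulr1 mulrC.
have rw (k : nat) h : reg t h -> reg t (qminus t ^+ k * h).
  by move=> rh; rewrite reg_atM ?reg_atX_n ?reg_qminus.
rewrite Ef Eg (widen i j f1) (widen j i g1) [(j + i)%N]addnC -mulrDl.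
rewrite !residue_polar ?reg_atD ?rw // iter_derivD /reval.
by rewrite rcompD ?reg_iter_deriv ?rw // mulrDl.
Qed.

Lemma residueN t f : residue (- f) t = - residue f t.
Proof.
apply/eqP; rewrite -addr_eq0 -residueD addNr.
by rewrite residue_reg // -tofrac0 reg_at_tofrac.
Qed.

Lemma residueB t f g : residue (f - g) t = residue f t - residue g t.
Proof. by rewrite residueD residueN. Qed.

Lemma residue0 t : residue 0 t = 0.
Proof. by rewrite residue_reg ?reg_at0. Qed.

Lemma residue_sum t (I : Type) (r : seq I) (P : pred I) (F : I -> ratfun K) :
  residue (\sum_(i <- r | P i) F i) t = \sum_(i <- r | P i) residue (F i) t.
Proof.
by elim/big_rec2: _ => [|i x y _ <-]; rewrite ?residue0 ?residueD.
Qed.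

Lemma residueCM t k f : residue (rC k * f) t = k * residue f t.
Proof.
have [i [g rg ->]] := polar_formS t f; rewrite mulrA.
rewrite !residue_polar ?reg_atM ?reg_atC // iter_derivCM /reval.
by rewrite rcompM ?reg_atC ?reg_iter_deriv // rcompC mulrA.
Qed.

(** With f = g / (q - t)^(k+1), the numerator of the derivative over
    (q - t)^(k+2) has a vanishing Taylor coefficient of order k + 1. *)
Lemma residue_deriv t f : residue (rderiv f) t = 0.
Proof.
have [k [g rg ->]] := polar_formS t f.
have q0 := qminus_neq0 t.
have -> : rderiv (g / qminus t ^+ k.+1)
    = (qminus t * rderiv g - rC k.+1%:R * g) / qminus t ^+ k.+2.
  rewrite rderivM rderivV ?qminusX_neq0 // rderivXn deriv_qminus mulr1.
  rewrite (rmorph_nat (@rC K)) -exprM.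
  exact: polar_quotient_rule.
have rg' := reg_deriv rg.
have rq := reg_atM (reg_qminus t t) rg'.
have rCM g' : reg t g' -> reg t (rC k.+1%:R * g').
  by move=> ?; apply: reg_atM => //; apply: reg_atC.
rewrite residue_polar; last exact: reg_atB rq (rCM _ rg).
rewrite iter_derivD -mulNr -rmorphN iter_derivCM.
set u := iter _ _ (_ * _); set v := iter _ _ _.
have ru : reg t u by apply: reg_iter_deriv.
have rv : reg t v by apply: reg_iter_deriv.
have rCv : reg t (rC (- k.+1%:R) * v) by apply: reg_atM => //; apply: reg_atC.
rewrite /reval (rcompD ru rCv) (rcompM (reg_atC _ _ _) rv) rcompC.
have := taylor_shift k rg'; rewrite -/u /reval => ->.
by rewrite /v iterSr mulNr subrr mul0r.
Qed.

Lemma polar_primitive t c (k : nat) :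
  rC c / qminus t ^+ k.+2
  = rderiv (rC (- c / k.+1%:R) / qminus t ^+ k.+1).
Proof.
rewrite rderivCM (rderivV (qminusX_neq0 t k.+1)) rderivXn deriv_qminus mulr1.
rewrite fmorph_div rmorphN (rmorph_nat (@rC K)).
apply: polar_primitive_rule; first exact: qminus_neq0.
exact: ratfun_natr_neq0.
Qed.

(** All polar terms except the simple one have a primitive: up to an exact and
    a regular term, only the residue remains. *)
Lemma laurent_decomposition t f : exists h r, reg t r /\
  f = rderiv h + rC (residue f t) / qminus t + r.
Proof.
suff [h [c [r [rr Ef]]]] : exists h c r,
    reg t r /\ f = rderiv h + rC c / qminus t + r.
  exists h, r; split=> //; suff -> : residue f t = c by [].
  rewrite Ef !residueD residue_deriv (residue_reg rr) add0r addr0.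
  by rewrite residue_simple ?reg_atC // /reval rcompC.
have [k [g rg ->]] := polar_form t f.
elim: k g rg => [|k ih] g rg.
  exists 0, 0, g; split=> //.
  by rewrite raddf0 /= tofrac0 mul0r !add0r expr0 divr1.
have [g1 rg1 ->] := reg_div_qminus rg; have [h [c [r [rr E]]]] := ih g1 rg1.
have -> : (rC (reval g t) + qminus t * g1) / qminus t ^+ k.+1
    = rC (reval g t) / qminus t ^+ k.+1 + g1 / qminus t ^+ k.
  rewrite mulrDl; congr (_ + _).
  by rewrite exprS invfM mulrACA divff ?qminus_neq0 // mul1r.
rewrite E; case: k {ih E} => [|k].
  exists h, (reval g t + c), r; split=> //.
  by rewrite expr1 addrA addrCA rmorphD mulrDl.
exists (rC (- reval g t / k.+1%:R) / qminus t ^+ k.+1 + h), c, r; split=> //.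
by rewrite polar_primitive rderivD !addrA.
Qed.

Lemma reg_horner t h p : reg t h ->
  reg t (map_poly (@rC K) p).[h] /\
  reval (map_poly (@rC K) p).[h] t = p.[reval h t].
Proof.
move=> rh; elim/poly_ind: p => [|p k [rp vp]].
  by rewrite rmorph0 !horner0 /reval rcomp0 reg_at0.
rewrite rmorphD rmorphM /= map_polyX map_polyC !hornerMXaddC.
have rph := reg_atM rp rh; have rk := reg_atC idfun t k.
split; first exact: reg_atD.
by rewrite /reval (rcompD rph rk) (rcompM rp rh) rcompC -/(reval _ _) vp.
Qed.

Lemma reg_subst t h f : reg t h -> reg (reval h t) f -> reg t (rcomp rC f h).
Proof.
move=> rh; case/reg_atP=> n d; rewrite map_poly_id // => dt d0 ->.
have [rn _] := reg_horner n rh; have [rd vd] := reg_horner d rh.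
have d1 : reval (map_poly (@rC K) d).[h] t != 0 by rewrite vd.
rewrite rcomp_frac; last by apply: contraNneq d1 => ->; rewrite /reval rcomp0.
by apply: reg_atM => //; apply: reg_atV.
Qed.

Section Subst.
Variable h : ratfun K.
Hypothesis Dh : rderiv h != 0.
Let tr := transc_deriv K0 Dh.

Lemma subst_deriv f : rderiv (rcomp rC f h) = rcomp rC (rderiv f) h * rderiv h.
Proof.
rewrite -/(rat_ev tr f) rderiv_hom => [|k]; last by rewrite /= /rat_ev rcompC rderivC.
by rewrite /= /rat_ev rcompX.
Qed.

Lemma pullback_deriv f : pullback h (rderiv f) = rderiv (rcomp rC f h).
Proof. by rewrite /pullback subst_deriv. Qed.

Lemma substD f g : rcomp rC (f + g) h = rcomp rC f h + rcomp rC g h.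
Proof. exact: (rmorphD (rat_ev tr)). Qed.
Lemma substB f g : rcomp rC (f - g) h = rcomp rC f h - rcomp rC g h.
Proof. exact: (rmorphB (rat_ev tr)). Qed.
Lemma substM f g : rcomp rC (f * g) h = rcomp rC f h * rcomp rC g h.
Proof. exact: (rmorphM (rat_ev tr)). Qed.
Lemma substV f : rcomp rC f^-1 h = (rcomp rC f h)^-1.
Proof. exact: (fmorphV (rat_ev tr)). Qed.

Lemma subst_neq0 f : f != 0 -> rcomp rC f h != 0.
Proof.
by move=> f0; rewrite -[rcomp rC f h]/(rat_ev tr f) (fmorph_eq0 (rat_ev tr)).
Qed.

Lemma subst_comp f g : rcomp rC (rcomp rC f g) h = rcomp rC f (rcomp rC g h).
Proof.
rewrite -/(rat_ev tr (rcomp rC f g)) rmorph_rcomp.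
by apply: eq_rcomp => k; rewrite /= /rat_ev rcompC.
Qed.

Lemma pullbackD f g : pullback h (f + g) = pullback h f + pullback h g.
Proof. by rewrite /pullback substD mulrDl. Qed.

Lemma pullback0 : pullback h 0 = 0.
Proof. by rewrite /pullback rcomp0 mul0r. Qed.

Lemma pullback_comp g f :
  rderiv (rcomp rC g h) != 0 -> rderiv g != 0 ->
  pullback h (pullback g f) = pullback (rcomp rC g h) f.
Proof.
by move=> Dgh Dg; rewrite /pullback substM subst_comp subst_deriv mulrA.
Qed.

(** Exact and regular terms stay such after a change of local coordinate, and
    the pullback of dq/(q - h(t)) is the logarithmic derivative of a function
    with a simple zero. *)
Lemma residue_subst t f : reg t h -> reval (rderiv h) t != 0 ->
  residue (pullback h f) t = residue f (reval h t).
Proof.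
move=> rh Dht; set t' := reval h t.
have [g [r [rr Ef]]] := laurent_decomposition t' f; set c := residue f t' in Ef *.
have rDh := reg_deriv rh.
rewrite {1}Ef !pullbackD !residueD pullback_deriv residue_deriv add0r.
rewrite [X in _ + X]residue_reg ?addr0; last first.
  by apply: reg_atM => //; apply: reg_subst.
rewrite /pullback substM substV rcompC -mulrA residueCM.
suff -> : residue ((rcomp rC (qminus t') h)^-1 * rderiv h) t = 1 by rewrite mulr1.
have -> : rcomp rC (qminus t') h = h - rC t'.
  by rewrite qminusE substB rcompX rcompC.
have [u ru Eu] := reg_div_qminus rh; rewrite -/t' in Eu.
rewrite [h in h - _]Eu addrC addKr.
have Du : rderiv h = u + qminus t * rderiv u.
  by rewrite Eu rderivD rderivC add0r rderivM deriv_qminus mul1r.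
have rDu := reg_deriv ru.
have vu : reval u t = reval (rderiv h) t.
  have rq := reg_atM (reg_qminus t t) rDu.
  rewrite Du /reval (rcompD ru rq) (rcompM (reg_qminus t t) rDu).
  by rewrite [rcomp _ (qminus t) t]reval_qminus subrr mul0r addr0.
have u0 : u != 0 by apply: contraNneq Dht => u0; rewrite -vu u0 /reval rcomp0.
have rVu : reg t u^-1 by apply: reg_atV => //; rewrite -/(reval _ _) vu.
have -> : (qminus t * u)^-1 * rderiv h = (u^-1 * rderiv h) / qminus t.
  by rewrite invfM [_^-1 * u^-1]mulrC mulrAC.
rewrite residue_simple; last exact: reg_atM.
rewrite /reval (rcompM rVu rDh) rcompV // -?/(reval _ _) ?vu // mulVf //.
Qed.

End Subst.

Definition polesprod (ps : seq K) : {poly K} := \prod_(a <- ps) ('X - a%:P).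

Lemma polesprod_neq0 ps : polesprod ps != 0.
Proof. by apply/monic_neq0/monic_prod_XsubC. Qed.

Definition poles_in (ps : seq K) f := exists (N : nat) p,
  f = tofrac p / tofrac (polesprod ps) ^+ N.

Lemma frac_polesprod_neq0 ps (N : nat) :
  tofrac (polesprod ps) ^+ N != 0 :> ratfun K.
Proof. by rewrite expf_neq0 // tofrac_eq0 polesprod_neq0. Qed.

Lemma poles_in_poly ps p : poles_in ps (tofrac p).
Proof. by exists 0%N, p; rewrite expr0 divr1. Qed.

Lemma poles_in_dvd ps n d (N : nat) : d %| polesprod ps ^+ N ->
  poles_in ps (tofrac n / tofrac d).
Proof.
move=> /dvdpP[e Ee]; exists N, (e * n).
have := frac_polesprod_neq0 ps N; rewrite -tofracXn Ee tofracM.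
rewrite mulf_eq0 negb_or => /andP[e0 _].
by rewrite tofracM -mulf_div divff // mul1r.
Qed.

Lemma poles_inM ps f g : poles_in ps f -> poles_in ps g -> poles_in ps (f * g).
Proof.
case=> [N [p ->]] [M [q ->]]; exists (N + M)%N, (p * q).
by rewrite mulf_div -tofracM exprD.
Qed.

Lemma poles_inD ps f g : poles_in ps f -> poles_in ps g -> poles_in ps (f + g).
Proof.
case=> [N [p ->]] [M [q ->]].
exists (N + M)%N, (p * polesprod ps ^+ M + q * polesprod ps ^+ N).
rewrite addf_div ?frac_polesprod_neq0 // exprD.
by rewrite [in RHS]tofracD !tofracM !tofracXn.
Qed.

Lemma poles_in0 ps : poles_in ps 0.
Proof. by rewrite -tofrac0; apply: poles_in_poly. Qed.

Lemma poles_in_sum ps (I : Type) (r : seq I) (P : pred I) (F : I -> ratfun K) :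
  (forall i, P i -> poles_in ps (F i)) -> poles_in ps (\sum_(i <- r | P i) F i).
Proof.
by move=> h; elim/big_ind: _ => //; [apply: poles_in0 | apply: poles_inD].
Qed.

Lemma poles_in_qminus ps a c (k : nat) :
  a \in ps -> poles_in ps (rC c / qminus a ^+ k).
Proof.
move=> aps; rewrite -tofracXn; apply: (@poles_in_dvd ps _ _ k).
by apply: dvdp_exp2r; rewrite /polesprod (big_rem a) //= dvdp_mulr.
Qed.

Lemma poles_in_sub ps ps' f : (forall N, polesprod ps ^+ N %| polesprod ps' ^+ N) ->
  poles_in ps f -> poles_in ps' f.
Proof.
by move=> h [N [p ->]]; rewrite -tofracXn; apply: poles_in_dvd (h N).
Qed.

(** One pole is split off at a time, by lowering its order. *)
Lemma partial_fraction_step a d (N : nat) p : ~~ root d a ->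
  exists h c q, (forall ps, a \in ps -> poles_in ps h) /\
  tofrac p / (qminus a ^+ N * tofrac d)
  = rderiv h + rC c / qminus a + tofrac q / tofrac d.
Proof.
move=> da; have d0 : d != 0 by apply: contraNneq da => ->; rewrite root0.
have d0F : tofrac d != 0 :> ratfun K by rewrite tofrac_eq0.
elim: N p => [|N ih] p.
  exists 0, 0, p; split; first by move=> ps _; apply: poles_in0.
  by rewrite raddf0 rmorph0 mul0r !add0r expr0 mul1r.
(* With this choice of k, p - k d vanishes at a. *)
pose k := p.[a] / d.[a].
have /factor_theorem[q Eq] : root (p - k *: d) a.
  by rewrite rootE hornerD hornerN hornerZ mulfVK ?subrr // -rootE.
have [h [c [r [ph E]]]] := ih q.
have Ep : tofrac p / (qminus a ^+ N.+1 * tofrac d)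
    = rC k / qminus a ^+ N.+1 + tofrac q / (qminus a ^+ N * tofrac d).
  have -> : p = q * ('X - a%:P) + k%:P * d.
    by rewrite -Eq mul_polyC subrK.
  rewrite tofracD !tofracM exprSr.
  exact: (partial_fraction_rule (tofrac q) (rC k) (qminusX_neq0 a N)
            (qminus_neq0 a) d0F).
rewrite Ep E; case: N {ih E Ep} => [|N].
  exists h, (k + c), r; split=> //.
  by rewrite expr1 addrA addrCA rmorphD mulrDl.
exists (rC (- k / N.+1%:R) / qminus a ^+ N.+1 + h), c, r; split.
  by move=> ps aps; apply: poles_inD (ph _ aps); apply: poles_in_qminus.
by rewrite polar_primitive rderivD !addrA.
Qed.

Lemma poly_primitive p : exists P, p = P^`().
Proof.
exists (\poly_(i < (size p).+1) (if i is j.+1 then p`_j / j.+1%:R else 0)).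
apply/polyP=> i; rewrite coef_deriv coef_poly ltnS.
case: ltnP => [si|/leq_sizeP/(_ i (leqnn _)) ->]; last by rewrite mul0rn.
by rewrite -[RHS]mulr_natr mulfVK ?natr_neq0.
Qed.

(** The classes of the 1/(q - a) span K(q) dq modulo exact differentials; a
    differential with zero residues thus has a primitive, with poles in the same
    set. *)
Lemma partial_fractions ps f : uniq ps -> poles_in ps f ->
  exists2 h, poles_in ps h &
    f = rderiv h + \sum_(a <- ps) rC (residue f a) / qminus a.
Proof.
move=> ups pf.
suff [h [c ph Ef]] : exists h, exists2 c : K -> K, poles_in ps h &
    f = rderiv h + \sum_(a <- ps) rC (c a) / qminus a.
  exists h => //; rewrite {1}Ef; congr (_ + _); apply: eq_big_seq => a aps.
  congr (rC _ / _); rewrite Ef residueD residue_deriv add0r residue_sum.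
  rewrite (bigD1_seq a) //= residue_simple ?reg_atC // /reval rcompC.
  rewrite big1_seq ?addr0 // => b /andP[ba bps].
  apply: residue_reg; apply: reg_atM; first exact: reg_atC.
  apply: reg_atV; first exact: reg_qminus.
  by rewrite [rcomp _ _ _]reval_qminus subr_eq0 eq_sym.
elim: ps ups f pf => [_ f|a ps ih /= /andP[aps ups] f] [N [p ->]].
  have [P ->] := poly_primitive p.
  rewrite /polesprod big_nil tofrac1 expr1n divr1.
  exists (tofrac P), (fun=> 0); first exact: poles_in_poly.
  by rewrite big_nil addr0 rderiv_tofrac.
have da : ~~ root (polesprod ps ^+ N) a.
  by rewrite rootE horner_exp expf_neq0 // -rootE root_prod_XsubC.
have [h [c [q [ph E]]]] := partial_fraction_step N p da.
have pq : poles_in ps (tofrac q / tofrac (polesprod ps ^+ N)).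
  by exists N, q; rewrite tofracXn.
have [g [c' pg Eg]] := ih ups _ pq.
exists (h + g), (fun b => if b == a then c else c' b).
  apply: poles_inD; first by apply: ph; rewrite mem_head.
  apply: poles_in_sub pg => M; apply: dvdp_exp2r.
  by rewrite /polesprod big_cons dvdp_mull.
rewrite /polesprod big_cons tofracM exprMn -/(polesprod ps).
rewrite -/(qminus a) -[tofrac (polesprod ps) ^+ N]tofracXn E Eg big_cons eqxx rderivD.
have -> : \sum_(b <- ps) rC (if b == a then c else c' b) / qminus b
    = \sum_(b <- ps) rC (c' b) / qminus b.
  by apply: eq_big_seq => b bps; rewrite ifN //; apply: contraNneq aps => <-.
by rewrite addrACA -!addrA; congr (_ + _); rewrite addrCA.
Qed.

(** The last summand is the residue at infinity, in the coordinate 1/q. By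
    partial fractions it is enough to treat dq/(q - a). *)
Lemma residue_theorem ps f : uniq ps -> poles_in ps f ->
  \sum_(a <- ps) residue f a + residue (pullback (rX K)^-1 f) 0 = 0.
Proof.
move=> ups pf; have [h _ Ef] := partial_fractions ups pf.
have X0 : rX K != 0 by rewrite tofrac_eq0 polyX_eq0.
have DV : rderiv (rX K)^-1 = - (rX K ^+ 2)^-1.
  by rewrite rderivV // rderivX mulN1r.
have DV0 : rderiv (rX K)^-1 != 0.
  by rewrite DV oppr_eq0 invr_eq0 expf_neq0.
have pb0 : pullback (rX K)^-1 0 = 0 by apply: pullback0.
rewrite {2}Ef (pullbackD DV0) (pullback_deriv DV0) residueD residue_deriv add0r.
rewrite (big_morph _ (pullbackD DV0) pb0) residue_sum -big_split big1 //= => a _.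
set c := residue f a.
have raX := reg_atM (reg_atC idfun 0 a) (reg_atX idfun 0).
have r1 : reg 0 (1 - rC a * rX K) := reg_atB (reg_at1 _ _) raX.
have v1 : reval (1 - rC a * rX K) 0 = 1.
  rewrite /reval (rcompB (reg_at1 _ _) raX).
  rewrite (rcompM (reg_atC idfun 0 a) (reg_atX idfun 0)).
  by rewrite rcomp1 rcompX mulr0 subr0.
have aX1 : 1 - rC a * rX K != 0.
  by apply/eqP => e; move/eqP: v1; rewrite e /reval rcomp0 eq_sym oner_eq0.
have -> : pullback (rX K)^-1 (rC c / qminus a)
    = (rC (- c) / (1 - rC a * rX K)) / qminus 0.
  rewrite /pullback (substM DV0) (substV DV0) rcompC qminusE (substB DV0).
  rewrite rcompX rcompC DV qminusE rmorph0 subr0 rmorphN.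
  exact: (residue_infinity_rule (rC c) X0 aX1).
have rV1 : reg 0 (1 - rC a * rX K)^-1.
  by apply: reg_atV => //; rewrite -/(reval _ _) v1 oner_neq0.
rewrite residue_simple; last by apply: reg_atM => //; apply: reg_atC.
rewrite /reval rcompM ?reg_atC // rcompC rcompV // -?/(reval _ _) ?v1 ?oner_neq0 //.
by rewrite invr1 mulr1 subrr.
Qed.

End LocalTheory.

(** * Nilpotent shifts of a coordinate and Lagrange inversion *)

Section Convolution.
Variable R : comNzRingType.

Lemma sum_antidiagonal (N : nat) (G : nat -> nat -> R) :
  (forall i j, (N <= i + j)%N -> G i j = 0) ->
  \sum_(i < N) \sum_(j < N) G i j = \sum_(n < N) \sum_(i < n.+1) G i (n - i)%N.
Proof.
move=> G0; transitivity (\sum_(n < N) \sum_(i < N) \sum_(j < N)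
    if nat_of_ord n == (i + j)%N then G i j else 0).
  rewrite [RHS]exchange_big /=; apply: eq_bigr => i _.
  rewrite [RHS]exchange_big /=; apply: eq_bigr => j _; rewrite -big_mkcond.
  have [h|h] := ltnP (i + j) N.
    by rewrite (@big_pred1 _ _ _ _ (Ordinal h)) // => n; rewrite -val_eqE.
  rewrite big_pred0 ?G0 // => n; apply/negbTE.
  by apply: contraTneq h => <-; rewrite -ltnNge.
apply: eq_bigr => n _; rewrite (big_ord_widen N (fun i => G i (n - i)%N)) //.
rewrite [RHS]big_mkcond; apply: eq_bigr => i _; rewrite -big_mkcond ltnS.
have [h|h] := leqP i n; last first.
  rewrite big_pred0 // => j; apply/negbTE.
  by apply: contraTneq h => ->; rewrite -leqNgt leq_addr.
have hj : (n - i < N)%N by rewrite (leq_ltn_trans (leq_subr _ _)).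
rewrite (big_pred1 (Ordinal hj)) // => j /=.
by rewrite -val_eqE -[RHS](eqn_add2l i) /= subnKC // eq_sym.
Qed.

(** The recursion behind the binomial formula, in a form that applies to
    divided powers. *)
Lemma convolution_rec (n : nat) (f g : nat -> R) :
  n.+1%:R * (\sum_(i < n.+2) f i * g (n.+1 - i)%N)
  = \sum_(i < n.+1) (i.+1%:R * f i.+1 * g (n - i)%N
                     + f i * ((n - i).+1%:R * g (n - i).+1)).
Proof.
rewrite big_split /=.
have e1 : \sum_(i < n.+1) i.+1%:R * f i.+1 * g (n - i)%N
    = \sum_(i < n.+2) i%:R * (f i * g (n.+1 - i)%N).
  rewrite [RHS]big_ord_recl mul0r add0r; apply: eq_bigr => i _.
  by rewrite mulrA.
have e2 : \sum_(i < n.+1) f i * ((n - i).+1%:R * g (n - i).+1)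
    = \sum_(i < n.+2) (n.+1 - i)%:R * (f i * g (n.+1 - i)%N).
  rewrite [RHS]big_ord_recr /= subnn mul0r addr0; apply: eq_bigr => i _.
  by rewrite subSn 1?mulrCA // -ltnS.
rewrite e1 e2 -big_split mulr_sumr; apply: eq_bigr => i _ /=.
by rewrite -mulrDl -natrD subnKC // -ltnS.
Qed.
End Convolution.

Section TaylorShift.
Variables (R : comNzRingType) (d : {additive R -> R}).
Hypothesis dM : forall f g, d (f * g) = d f * g + f * d g.
Variable e : nat -> R.
Hypothesis e0 : e 0 = 1.
Hypothesis eS : forall n, n.+1%:R * e n.+1 = e n.
Hypothesis de : forall n, d (e n) = 0.
Variables (delta : R) (N : nat).
Hypothesis delta_nilp : delta ^+ N = 0.
Implicit Types f g h c : R.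

Local Notation dn i := (iter i d).

Lemma delta_vanish (n : nat) : (N <= n)%N -> delta ^+ n = 0.
Proof. by move=> h; rewrite -(subnK h) exprD delta_nilp mulr0. Qed.

Lemma e_fact (n : nat) : n`!%:R * e n = 1.
Proof.
elim: n => [|n ih]; first by rewrite fact0 e0 mul1r.
by rewrite factS mulnC natrM -mulrA eS.
Qed.

Lemma natrI (n : nat) f g : n.+1%:R * f = n.+1%:R * g -> f = g.
Proof.
move=> h; have inv : (n`!%:R * e n.+1) * n.+1%:R = 1.
  by rewrite mulrAC -natrM mulnC -factS e_fact.
by rewrite -[f]mul1r -[g]mul1r -inv -!mulrA h.
Qed.

Lemma d1 : d 1 = 0.
Proof.
have := dM 1 1; rewrite !mulr1 mul1r => /eqP.
by rewrite -subr_eq subrr => /eqP <-.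
Qed.

Lemma deM (n : nat) f : d (e n * f) = e n * d f.
Proof. by rewrite dM de mul0r add0r. Qed.

Lemma d_exp f (n : nat) : d (f ^+ n.+1) = n.+1%:R * (f ^+ n * d f).
Proof.
elim: n => [|n ih]; first by rewrite expr1 expr0 !mul1r.
by rewrite exprS dM ih -[n.+2]add1n natrD exprS; ring.
Qed.

Lemma dnS (n : nat) f : dn n (d f) = d (dn n f).
Proof. by elim: n => //= n ->. Qed.

Lemma dnD (n : nat) f g : dn n (f + g) = dn n f + dn n g.
Proof. by elim: n => //= n ->; rewrite raddfD. Qed.

Lemma dn0 (n : nat) : dn n 0 = 0.
Proof. by elim: n => //= n ->; rewrite raddf0. Qed.

Lemma dnN (n : nat) f : dn n (- f) = - dn n f.
Proof. by elim: n => //= n ->; rewrite raddfN. Qed.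

(** With e_i = 1/i!, [taylor f] is f(y + delta) for the coordinate y such that
    [d] = d/dy; [taylor_diff h] is the coefficient of the pullback of h dy under
    this shift. *)
Definition taylor f : R := \sum_(i < N) e i * delta ^+ i * dn i f.
Definition taylor_diff h : R := taylor h * (1 + d delta).

(** The transpose of [taylor] for the residue pairing: by integration by parts,
    f * transposed_shift c and taylor f * c differ by an exact term. *)
Definition transposed_shift c : R :=
  \sum_(n < N) (-1) ^+ n * e n * dn n (delta ^+ n * c).

Lemma taylorS f : taylor f = \sum_(i < N.+1) e i * delta ^+ i * dn i f.
Proof. by rewrite big_ord_recr /= delta_nilp mulr0 mul0r addr0. Qed.

Lemma divided_leibniz (n : nat) f g : e n * dn n (f * g)
  = \sum_(i < n.+1) (e i * dn i f) * (e (n - i)%N * dn (n - i)%N g).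
Proof.
elim: n => [|n ih]; first by rewrite big_ord_recl big_ord0 e0 /= !mul1r addr0.
apply: (@natrI n); rewrite mulrA eS iterS -deM ih raddf_sum.
rewrite (convolution_rec n (fun i => e i * dn i f) (fun i => e i * dn i g)).
apply: eq_bigr => i _; rewrite dM !deM; congr (_ * _ + _ * _).
  by rewrite mulrA eS.
by rewrite mulrA eS.
Qed.

(** Substituting y + delta is multiplicative: this is the Leibniz formula for
    divided powers of [d], summed over the order of derivation. *)
Lemma taylorM f g : taylor (f * g) = taylor f * taylor g.
Proof.
rewrite /taylor mulr_suml; under [RHS]eq_bigr do rewrite mulr_sumr.
rewrite (@sum_antidiagonal _ N (fun i j =>
  (e i * delta ^+ i * dn i f) * (e j * delta ^+ j * dn j g))); last first.
  move=> i j h; have := delta_vanish h; rewrite exprD => hd.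
  by rewrite [LHS](_ : _ = (delta ^+ i * delta ^+ j) * (e i * dn i f * (e j * dn j g)));
    [rewrite hd mul0r | ring].
apply: eq_bigr => n _; rewrite mulrAC divided_leibniz mulr_suml.
apply: eq_bigr => i _; rewrite -[in delta ^+ n](subnKC (_ : i <= n)%N) ?exprD; last first.
  by rewrite -ltnS.
by ring.
Qed.

Lemma d_divided (i : nat) f : d (e i.+1 * delta ^+ i.+1 * f)
  = e i * delta ^+ i * f * d delta + e i.+1 * delta ^+ i.+1 * d f.
Proof. by rewrite -mulrA deM dM d_exp -(eS i); ring. Qed.

Lemma d_taylor f : d (taylor f) = taylor_diff (d f).
Proof.
rewrite taylorS raddf_sum big_ord_recl /=.
rewrite e0 expr0 !mul1r.
under eq_bigr do rewrite /= /bump /= !add1n d_divided.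
rewrite big_split /= -mulr_suml /taylor_diff mulrDr mulr1 addrCA addrC.
congr (_ + _); last first.
  by congr (_ * _); apply: eq_bigr => i _; rewrite dnS.
rewrite taylorS big_ord_recl /= e0 expr0 !mul1r; congr (_ + _).
by apply: eq_bigr => i _; rewrite /= /bump /= !add1n dnS.
Qed.

(** The homotopy formula: a differential and its image under the shift are
    cohomologous. *)
Lemma taylor_diff_exact h : exists g, taylor_diff h - h = d g.
Proof.
exists (\sum_(i < N) e i.+1 * delta ^+ i.+1 * dn i h).
rewrite raddf_sum; under eq_bigr do rewrite d_divided.
rewrite big_split /= -mulr_suml -/(taylor h).
rewrite /taylor_diff mulrDr mulr1 {1}taylorS big_ord_recl /= e0 expr0 !mul1r.
by rewrite addrAC [h + _]addrC addrK addrC; congr (_ + _).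
Qed.

(** At k = 0 this is [transposed_shift]; each increment of [k] accounts for one
    term of the double series that proves Lagrange inversion. *)
Definition transposed_shift_from (k : nat) c : R :=
  \sum_(n < N) (-1) ^+ n * dn n (e (n + k)%N * delta ^+ (n + k) * c).

Lemma dn_e (n k : nat) f : dn n (e k * f) = e k * dn n f.
Proof. by elim: n => //= n ->; rewrite deM. Qed.

Lemma transposed_shiftE c : transposed_shift c = transposed_shift_from 0 c.
Proof. by apply: eq_bigr => n _; rewrite addn0 -[in RHS]mulrA dn_e mulrA. Qed.

(** An integration by parts, whose boundary terms telescope. *)
Lemma transposed_shift_from_step (k : nat) h : transposed_shift_from k (taylor_diff h)
  = e k * delta ^+ k * taylor h - transposed_shift_from k.+1 (taylor_diff (d h)).
Proof.
pose B n := dn n (e (n + k)%N * delta ^+ (n + k) * taylor h).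
have step (n : nat) :
    (-1) ^+ n * dn n (e (n + k)%N * delta ^+ (n + k) * taylor_diff h)
    = ((-1) ^+ n * B n - (-1) ^+ n.+1 * B n.+1)
      - (-1) ^+ n * dn n (e (n + k.+1)%N * delta ^+ (n + k.+1) * taylor_diff (d h)).
  have -> : e (n + k)%N * delta ^+ (n + k) * taylor_diff h
      = e (n + k)%N * delta ^+ (n + k) * taylor h
        + d (e (n + k).+1 * delta ^+ (n + k).+1 * taylor h)
        - e (n + k).+1 * delta ^+ (n + k).+1 * taylor_diff (d h).
    by rewrite d_divided d_taylor /taylor_diff; ring.
  rewrite !dnD dnN dnS addnS [(-1) ^+ n.+1]exprS /B iterS addSn.
  by ring.
rewrite /transposed_shift_from; under eq_bigr do rewrite step.
rewrite big_split /= sumrN; congr (_ - _).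
rewrite -(big_mkord xpredT (fun n => (-1) ^+ n * B n - (-1) ^+ n.+1 * B n.+1)).
rewrite -[LHS]opprK -sumrN; under eq_bigr do rewrite opprB.
rewrite telescope_sumr // opprB expr0 mul1r /B /= add0n.
by rewrite (@delta_vanish (N + k)) ?leq_addr // mulr0 mul0r dn0 mulr0 subr0.
Qed.

Lemma alternating_e (n : nat) :
  \sum_(k < n.+1) ((-1) ^+ k * e k) * e (n - k)%N = (n == 0)%:R.
Proof.
case: n => [|n].
  by rewrite big_ord_recl big_ord0 expr0 e0 !mul1r addr0.
apply: (@natrI n); rewrite (convolution_rec n (fun k => (-1) ^+ k * e k) e).
rewrite mulr0 big1 // => i _; rewrite (eS (n - i)) exprS -[in X in _ + X](eS i).
by ring.
Qed.

(** Lagrange inversion: Res f transposed_shift(c) dy = Res f(y + delta) c dy, so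
    that substituting the shift in a differential and applying
    [transposed_shift] cancel. *)
Lemma taylor_diffK h : transposed_shift (taylor_diff h) = h.
Proof.
rewrite transposed_shiftE.
have unroll (k : nat) : transposed_shift_from 0 (taylor_diff h)
    = \sum_(i < k) (-1) ^+ i * (e i * delta ^+ i * taylor (dn i h))
      + (-1) ^+ k * transposed_shift_from k (taylor_diff (dn k h)).
  elim: k => [|k ih]; first by rewrite big_ord0 expr0 mul1r add0r.
  rewrite big_ord_recr /= ih transposed_shift_from_step exprS.
  by ring.
rewrite (unroll N) /transposed_shift_from [X in _ + _ * X]big1 ?mulr0 ?addr0; last first.
  by move=> n _; rewrite delta_vanish ?leq_addl // mulr0 mul0r dn0 mulr0.
under eq_bigr do rewrite /taylor !mulr_sumr.
rewrite (@sum_antidiagonal _ N (fun k i =>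
  (-1) ^+ k * (e k * delta ^+ k * (e i * delta ^+ i * dn i (dn k h))))); last first.
  move=> i j hN; have := delta_vanish hN; rewrite exprD => hd.
  rewrite [LHS](_ : _ = (delta ^+ i * delta ^+ j)
      * ((-1) ^+ i * e i * (e j * dn j (dn i h)))); last by ring.
  by rewrite hd mul0r.
transitivity (\sum_(n < N) (nat_of_ord n == 0)%:R * (delta ^+ n * dn n h)).
  apply: eq_bigr => n _; rewrite -alternating_e mulr_suml; apply: eq_bigr => i _.
  have le_in : (i <= n)%N by rewrite -ltnS.
  rewrite -iterD subnK // -[in delta ^+ n](subnKC le_in) exprD.
  by ring.
have := delta_nilp; case: (N) => [/eqP|M _]; first by rewrite expr0 oner_eq0.
by rewrite big_ord_recl big1 ?addr0 ?mul1r // => i _; rewrite mul0r.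
Qed.

Lemma transposed_shiftB f g : transposed_shift (f - g) = transposed_shift f - transposed_shift g.
Proof.
rewrite /transposed_shift -sumrB; apply: eq_bigr => n _.
by rewrite mulrBr dnD dnN mulrBr.
Qed.

Hypothesis transposed_shift_inj : forall c, transposed_shift c = 0 -> c = 0.

Lemma transposed_shiftK c : taylor_diff (transposed_shift c) = c.
Proof.
apply/eqP; rewrite -subr_eq0; apply/eqP/transposed_shift_inj.
by rewrite transposed_shiftB taylor_diffK subrr.
Qed.

Lemma transposed_shift_exact c : exists g, transposed_shift c - c = d g.
Proof.
have [g Eg] := taylor_diff_exact (transposed_shift c); exists (- g).
by rewrite raddfN -Eg transposed_shiftK opprB.
Qed.

(** Up to sign, da' and db' are the images of da and db under the inverse of the
    shift y -> y + delta. As a shift is multiplicative, a' db' is the image of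
    a db up to an exact term; and a differential is cohomologous to its image
    under a shift. *)
Lemma exchanged_product_exact a b a' b' :
  d a' = - transposed_shift (d a) -> d b' = - transposed_shift (d b) ->
  exists g, a' * d b' - a * d b = d g.
Proof.
move=> ha hb.
have taylor_diffN f : taylor_diff (- f) = - taylor_diff f.
  rewrite /taylor_diff -mulNr /taylor -sumrN; congr (_ * _).
  by apply: eq_bigr => i _; rewrite dnN mulrN.
have ta : taylor_diff (d a') = - d a by rewrite ha taylor_diffN transposed_shiftK.
have tb : taylor_diff (d b') = - d b by rewrite hb taylor_diffN transposed_shiftK.
(* The image of a' under the shift is k - a, where k is a constant. *)
pose k := taylor a' + a.
have dk : d k = 0 by rewrite raddfD /= d_taylor ta addNr.
have [g Eg] := taylor_diff_exact (a' * d b').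
exists (- (g + k * b)).
have -> : a' * d b' = taylor_diff (a' * d b') - d g by rewrite -Eg opprB addrC subrK.
have -> : taylor_diff (a' * d b') = (k - a) * (- d b).
  by rewrite -tb /k addrK {1}/taylor_diff taylorM -mulrA.
by rewrite raddfN raddfD /= dM dk mul0r add0r; ring.
Qed.
End TaylorShift.

(** * Multilinear power series *)

(** Power series in parameters eps_i with eps_i^2 = 0: the value at [S] is the
    coefficient of the product of the eps_i, i in S. *)
Definition mlseries (I : finType) (E : comNzRingType) := {ffun {set I} -> E}.

Section MultilinearSeries.
Variables (I : finType) (E : comNzRingType).
Local Notation ser := (mlseries I E).
Implicit Types (f g h : ser) (A B S : {set I}).

HB.instance Definition _ := GRing.Zmodule.copy ser {ffun {set I} -> E}.

Definition ser_mul f g : ser :=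
  [ffun S : {set I} => \sum_(A : {set I} | A \subset S) f A * g (S :\: A)].
Definition ser_mono A : ser := [ffun S : {set I} => (S == A)%:R].

Lemma ser_mulC : commutative ser_mul.
Proof.
move=> f g; apply/ffunP=> S; rewrite !ffunE.
rewrite (reindex_onto (fun A => S :\: A) (fun A => S :\: A)); last first.
  by move=> A sA; rewrite setDDr setDv set0U; apply/setIidPr.
apply: eq_big => A.
  rewrite subsetDl setDDr setDv set0U; apply/eqP/idP => [<-|sA].
    exact: subsetIl.
  exact/setIidPr.
case/andP=> _ /eqP e; rewrite mulrC; congr (_ * _).
by rewrite e.
Qed.

Lemma ser_mulA : associative ser_mul.
Proof.
move=> f g h; apply/ffunP=> S; rewrite !ffunE.
under eq_bigr do rewrite ffunE mulr_sumr.
under [RHS]eq_bigr do rewrite ffunE mulr_suml.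
rewrite [RHS](exchange_big_dep (fun B => B \subset S)) /=; last first.
  by move=> A B sA sB; apply: subset_trans sB sA.
apply: eq_bigr => B sB.
rewrite [RHS](reindex_onto (fun C => B :|: C) (fun A => A :\: B)); last first.
  by move=> A /andP[_ sBA]; rewrite setDE setUIr setUCr setIT; apply/setUidPr.
apply: eq_big => C.
  rewrite subUset sB subsetUl andbT /=.
  have -> : (B :|: C) :\: B = C :\: B by rewrite setDUl setDv set0U.
  rewrite subsetD; case: (C \subset S) => //=.
  by apply/idP/eqP=> [/setDidPl //|/setDidPl].
move=> sC; rewrite mulrA; congr (_ * g _ * h _); last by rewrite setDDl.
move: sC; rewrite subsetD => /andP[_ dC].
rewrite setDUl setDv set0U; apply/esym/setDidPl; exact: dC.
Qed.

Lemma ser_mul1 : left_id (ser_mono set0) ser_mul.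
Proof.
move=> f; apply/ffunP=> S; rewrite ffunE (bigD1 set0) ?sub0set //= ffunE eqxx mul1r.
by rewrite setD0 big1 ?addr0 // => A /andP[_ /negPf h]; rewrite ffunE h mul0r.
Qed.

Lemma ser_mulDl : left_distributive ser_mul +%R.
Proof.
move=> f g h; apply/ffunP=> S; rewrite !ffunE -big_split.
by apply: eq_bigr => A _; rewrite ffunE mulrDl.
Qed.

Lemma ser_1neq0 : ser_mono set0 != 0.
Proof.
apply/eqP=> /(congr1 (fun f : ser => f set0)); rewrite !ffunE eqxx => /eqP.
by rewrite oner_eq0.
Qed.

HB.instance Definition _ := GRing.Zmodule_isComNzRing.Build ser
  ser_mulA ser_mulC ser_mul1 ser_mulDl ser_1neq0.

Lemma ser_mulE f g S :
  (f * g) S = \sum_(A : {set I} | A \subset S) f A * g (S :\: A).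
Proof. by rewrite ffunE. Qed.

Lemma ser_addE f g S : (f + g) S = f S + g S.
Proof. by rewrite ffunE. Qed.
Lemma ser_oppE f S : (- f) S = - f S.
Proof. by rewrite ffunE. Qed.
Lemma ser_0E S : (0 : ser) S = 0.
Proof. by rewrite ffunE. Qed.
Lemma ser_1E S : (1 : ser) S = (S == set0)%:R.
Proof. by rewrite ffunE. Qed.

Lemma ser_sumE (T : Type) (r : seq T) (P : pred T) (F : T -> ser) S :
  (\sum_(i <- r | P i) F i) S = \sum_(i <- r | P i) F i S.
Proof. by elim/big_rec2: _ => [|i x y _ <-]; rewrite ffunE. Qed.

Definition ser_const (x : E) : ser := [ffun S : {set I} => if S == set0 then x else 0].

Lemma ser_constM x f S : (ser_const x * f) S = x * f S.
Proof.
rewrite ser_mulE (bigD1 set0) ?sub0set //= ffunE eqxx setD0 big1 ?addr0 //.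
by move=> A /andP[_ /negPf h]; rewrite ffunE h mul0r.
Qed.

Lemma ser_signM (n : nat) f S : ((-1) ^+ n * f) S = (-1) ^+ n * f S.
Proof.
elim: n => [|n ih]; first by rewrite !expr0 !mul1r.
by rewrite !exprS -!mulrA !mulN1r ser_oppE ih.
Qed.

Lemma ser_const1 : ser_const 1 = 1.
Proof. by apply/ffunP=> S; rewrite !ffunE; case: eqP. Qed.

Lemma ser_constMM x y : ser_const (x * y) = ser_const x * ser_const y.
Proof.
apply/ffunP=> S; rewrite ser_constM !ffunE.
by case: eqP; rewrite ?mulr0.
Qed.

Lemma ser_constMn x (n : nat) : ser_const (n%:R * x) = n%:R * ser_const x.
Proof.
rewrite !mulr_natl; elim: n => [|n ih]; last rewrite !mulrS -ih.
  by apply/ffunP=> S; rewrite !ffunE; case: eqP.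
by apply/ffunP=> S; rewrite !ffunE; case: eqP => // _; rewrite addr0.
Qed.

Lemma ser_monoM A f S :
  (ser_mono A * f) S = if A \subset S then f (S :\: A) else 0.
Proof.
rewrite ser_mulE; case: ifP => sA; last first.
  rewrite big1 // => B sB; rewrite ffunE; case: eqP => [e|_]; last by rewrite mul0r.
  by rewrite -e sB in sA.
rewrite (bigD1 A) //= ffunE eqxx mul1r big1 ?addr0 //.
by move=> B /andP[_ /negPf h]; rewrite ffunE h mul0r.
Qed.

Lemma ser_monoMM A B : ser_mono A * ser_mono B
  = if [disjoint A & B] then ser_mono (A :|: B) else 0.
Proof.
apply/ffunP=> S; rewrite ser_monoM ffunE.
have [dAB|dAB] := boolP [disjoint A & B]; rewrite !ffunE; last first.
  case: ifP => // sA; case: eqP => // e; case/negP: dAB.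
  by rewrite -e -setI_eq0 setIC setDE -setIA [~: A :&: A]setIC setICr setI0.
case: ifP => sA; last first.
  by case: eqP => // e; rewrite e subsetUl in sA.
congr (_%:R); congr nat_of_bool; apply/eqP/eqP=> [<-|->].
  by rewrite setDE setUIr setUCr setIT; apply/esym/setUidPr.
by rewrite setDUl setDv set0U; apply/setDidPl; rewrite disjoint_sym.
Qed.

Lemma ser_decomposition f : f = \sum_A ser_const (f A) * ser_mono A.
Proof.
apply/ffunP=> S; rewrite ser_sumE (bigD1 S) //= ser_constM ffunE eqxx mulr1.
rewrite big1 ?addr0 // => A /negPf h; rewrite ser_constM ffunE.
by rewrite eq_sym h mulr0.
Qed.

Lemma ser_mono_prod (T : eqType) (r : seq T) (P : T -> {set I}) :
  \prod_(j <- r) ser_mono (P j)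
  = if pairwise (fun j k => [disjoint P j & P k]) r
    then ser_mono (\bigcup_(j <- r) P j) else 0.
Proof.
elim: r => [|i r ih]; first by rewrite !big_nil.
rewrite !big_cons ih /=.
have -> : all (fun k => [disjoint P i & P k]) r = [disjoint P i & \bigcup_(j <- r) P j].
  elim: (r) => [|j s IH]; first by rewrite big_nil -setI_eq0 setI0 eqxx.
  rewrite big_cons /= IH -!setI_eq0 setIUr setU_eq0 //.
by case: (pairwise _ r); rewrite ?andbF ?mulr0 // andbT ser_monoMM.
Qed.

(** Products of monomials with a common parameter vanish, so that a power
    expands over tuples of disjoint sets. *)
Lemma ser_expE (s : nat) f S : (f ^+ s) S
  = \sum_(P : {ffun 'I_s -> {set I}}
        | [forall j, forall k, (j != k) ==> [disjoint P j & P k]]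
          && (\bigcup_j P j == S)) \prod_j f (P j).
Proof.
have -> : f ^+ s = \prod_(j < s) \sum_A ser_const (f A) * ser_mono A.
  by rewrite -ser_decomposition prodr_const card_ord.
rewrite bigA_distr_bigA ser_sumE [RHS]big_mkcond; apply: eq_bigr => P _ /=.
rewrite big_split /=.
have -> : \prod_(j < s) ser_const (f (P j)) = ser_const (\prod_(j < s) f (P j)).
  by elim/big_rec2: _ => [|j x y _ ->]; rewrite ?ser_const1 ?ser_constMM.
rewrite ser_constM ser_mono_prod.
have -> : pairwise (fun j k : 'I_s => [disjoint P j & P k]) (index_enum 'I_s)
   = [forall j, forall k, (j != k) ==> [disjoint P j & P k]].
  pose r (j k : 'I_s) := (j == k) || [disjoint P j & P k].
  have rr : reflexive r by move=> j; rewrite /r eqxx.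
  have rs : ssrbool.symmetric r by move=> j k; rewrite /r eq_sym disjoint_sym.
  have -> : pairwise (fun j k : 'I_s => [disjoint P j & P k]) (index_enum 'I_s)
      = pairwise r (index_enum 'I_s).
    have u := index_enum_uniq 'I_s; rewrite uniq_pairwise in u.
    rewrite -[LHS]andTb -[RHS]andTb -u -!pairwise_relI; apply: eq_pairwise => j k /=.
    by rewrite /r; case: (j == k).
  rewrite pairwise_all2rel //; apply/allrelP/forallP => [h j|h j k _ _].
    apply/forallP=> k; apply/implyP=> /negPf jk.
    by have := h j k (mem_index_enum _) (mem_index_enum _); rewrite /r jk.
  by have /forallP/(_ k) := h j; rewrite /r; case: (j == k).
case: ifP => _ /=; rewrite ffunE ?mulr0 // eq_sym.
by case: eqP; rewrite ?mulr1 ?mulr0.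
Qed.

Lemma ser_exp_vanish f (n : nat) S : f set0 = 0 -> (#|S| < n)%N -> (f ^+ n) S = 0.
Proof.
move=> f0; elim: n S => // n ih S hS; rewrite exprS ser_mulE big1 // => A sA.
have [->|A0] := eqVneq A set0; first by rewrite f0 mul0r.
rewrite ih ?mulr0 //; apply: leq_trans (_ : #|S| <= n)%N; last by rewrite -ltnS.
rewrite cardsD (setIidPr sA) ltn_subrL card_gt0 A0.
by rewrite (leq_trans _ (subset_leq_card sA)) // card_gt0.
Qed.

Lemma ser_exp_nilpotent f : f set0 = 0 -> f ^+ #|I|.+1 = 0.
Proof.
by move=> f0; apply/ffunP=> S; rewrite ser_0E ser_exp_vanish // ltnS max_card.
Qed.

Definition free_of k f := forall S, k \in S -> f S = 0.

Lemma free_ofM k f g : free_of k f -> free_of k g -> free_of k (f * g).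
Proof.
move=> hf hg S kS; rewrite ser_mulE big1 // => A sA.
have [kA|kA] := boolP (k \in A); first by rewrite hf // mul0r.
by rewrite hg ?mulr0 // inE kA.
Qed.

Lemma free_ofX k f (n : nat) : free_of k f -> free_of k (f ^+ n).
Proof.
move=> h; elim: n => [|n ih]; last by rewrite exprS; apply: free_ofM.
move=> S kS; rewrite expr0 ser_1E; case: eqP => // S0.
by rewrite S0 inE in kS.
Qed.

Lemma ser_mono_sqr k : ser_mono [set k] ^+ 2 = 0.
Proof. by rewrite expr2 ser_monoMM disjoints1 inE eqxx. Qed.

(** The binomial formula stops at the first order since eps_k^2 = 0. *)
Lemma ser_exp_first_order k f g (s : nat) S : free_of k f -> k \notin S ->
  ((f + ser_mono [set k] * g) ^+ s.+1) (k |: S) = s.+1%:R * (f ^+ s * g) S.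
Proof.
move=> hf kS; set t := ser_mono [set k].
have -> : (f + t * g) ^+ s.+1 = f ^+ s.+1 + t * (s.+1%:R * (f ^+ s * g)).
  have t2 : t * t = 0 by rewrite -expr2 ser_mono_sqr.
  elim: s => [|s ih]; first by rewrite !expr1 expr0 !mul1r.
  rewrite exprS ih.
  have -> : (f + t * g) * (f ^+ s.+1 + t * (s.+1%:R * (f ^+ s * g)))
    = f * f ^+ s.+1 + t * (s.+1%:R * (f * f ^+ s * g) + f ^+ s.+1 * g)
      + (t * t) * (g * (s.+1%:R * (f ^+ s * g))) by ring.
  by rewrite t2 mul0r addr0 -!exprS -[s.+2]addn1 natrD mulrDl mul1r.
rewrite ser_addE (free_ofX _ hf) ?setU11 // add0r ser_monoM subsetUl.
rewrite (_ : (k |: S) :\: [set k] = S) ?mulr_natl; last first.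
  by rewrite setDUl setDv set0U; apply/setDidPl; rewrite disjoint_sym disjoints1.
by elim: s.+1 => [|n ih]; rewrite ?mulr0n ?ser_0E // !mulrS ser_addE ih.
Qed.

Section Derivation.
Variable D : {additive E -> E}.

Definition ser_deriv f : ser := [ffun S : {set I} => D (f S)].

Lemma ser_deriv_is_zmod : zmod_morphism ser_deriv.
Proof. by move=> f g; apply/ffunP=> S; rewrite !ffunE raddfB. Qed.
HB.instance Definition _ :=
  GRing.isZmodMorphism.Build ser ser ser_deriv ser_deriv_is_zmod.

Lemma ser_derivM : (forall x y, D (x * y) = D x * y + x * D y) ->
  forall f g, ser_deriv (f * g) = ser_deriv f * g + f * ser_deriv g.
Proof.
move=> DM f g; apply/ffunP=> S; rewrite ser_addE ffunE !ser_mulE raddf_sum.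
by rewrite -big_split; apply: eq_bigr => A _; rewrite /= DM !ffunE.
Qed.

Lemma iter_ser_deriv (n : nat) f S : iter n ser_deriv f S = iter n D (f S).
Proof. by elim: n => //= n ih; rewrite ffunE ih. Qed.

Lemma ser_deriv_const x : D x = 0 -> ser_deriv (ser_const x) = 0.
Proof. by move=> Dx; apply/ffunP=> S; rewrite !ffunE; case: eqP; rewrite ?raddf0. Qed.

Variable e : nat -> E.

Lemma transposed_shift_coef (delta : ser) (N : nat) f S :
  transposed_shift ser_deriv (fun n => ser_const (e n)) delta N f S
  = \sum_(n < N) (-1) ^+ n * e n * iter n D ((delta ^+ n * f) S).
Proof.
rewrite ser_sumE; apply: eq_bigr => n _.
by rewrite -mulrA ser_signM ser_constM iter_ser_deriv mulrA.
Qed.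

(** [transposed_shift] is unipotent for the filtration by the degree in the
    parameters, [delta] having no constant term. *)
Lemma transposed_shift_ser_inj (delta : ser) (N : nat) f : e 0 = 1 -> delta set0 = 0 ->
  transposed_shift ser_deriv (fun n => ser_const (e n)) delta N.+1 f = 0 -> f = 0.
Proof.
move=> e0 d0 L0; apply/ffunP=> S; rewrite ser_0E.
have Dz j : iter j D 0 = 0 by elim: j => //= j ->; rewrite raddf0.
have [n] := ubnP #|S|; elim: n S => // n ih S; rewrite ltnS => hS.
have := congr1 (fun h : ser => h S) L0.
rewrite transposed_shift_coef ser_0E big_ord_recl /= e0 !expr0 !mul1r big1 ?addr0 // => i _.
rewrite (_ : (delta ^+ _ * f) S = 0).
  by rewrite -iterS Dz mulr0.
rewrite ser_mulE big1 // => A sA.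
have [->|A0] := eqVneq A set0; first by rewrite ser_exp_vanish ?mul0r ?cards0.
rewrite ih ?mulr0 //; apply: leq_trans hS.
rewrite cardsD (setIidPr sA) ltn_subrL card_gt0 A0.
by rewrite (leq_trans _ (subset_leq_card sA)) // card_gt0.
Qed.

End Derivation.

End MultilinearSeries.

Section Restriction.
Variables (I J : finType) (E : comNzRingType) (i : J -> I).
Hypothesis i_inj : injective i.
Implicit Types f g : mlseries I E.

Definition ser_restrict f : mlseries J E := [ffun T : {set J} => f (i @: T)].

Lemma ser_restrictM f g : ser_restrict (f * g) = ser_restrict f * ser_restrict g.
Proof.
apply/ffunP=> T; rewrite ffunE !ser_mulE.
rewrite (reindex_onto (fun A : {set J} => i @: A) (fun A => i @^-1: A)) /=; last first.
  move=> A sA; apply/setP=> x; apply/imsetP/idP => [[y]|xA].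
    by rewrite inE => h ->.
  by have /imsetP[y yT e] := subsetP sA _ xA; exists y; rewrite // inE -e.
have pre (A : {set J}) : i @^-1: (i @: A) = A.
  by apply/setP=> y; rewrite inE mem_imset.
apply: eq_big => A.
  rewrite pre eqxx andbT; apply/subsetP/subsetP => h x.
    by rewrite -!(mem_imset _ _ i_inj); apply: h.
  by case/imsetP=> y yA ->; rewrite mem_imset // h.
move=> _; rewrite !ffunE; congr (_ * g _); apply/setP=> x; rewrite inE.
apply/andP/imsetP => [[xA /imsetP[y yT e]]|[y]].
  by exists y; rewrite // inE yT andbT -(mem_imset _ _ i_inj) -e.
by rewrite inE => /andP[yA yT] ->; rewrite !mem_imset.
Qed.

Lemma ser_restrictX f (n : nat) : ser_restrict f ^+ n = ser_restrict (f ^+ n).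
Proof.
elim: n => [|n ih]; last by rewrite !exprS ih ser_restrictM.
apply/ffunP=> T; rewrite [RHS]ffunE !expr0 !ser_1E; congr (_%:R).
congr nat_of_bool; apply/eqP/eqP=> [->|]; first by rewrite imset0.
by move/eqP; rewrite imset_eq0 => /eqP.
Qed.
End Restriction.

(** The sums over ordered set partitions of the involution identity are
    coefficients of powers of a generating series. *)
Lemma ser_exp_partition (m : nat) (E : comNzRingType) (f : mlseries 'I_m E) (s : nat) :
  f set0 = 0 -> (f ^+ s) [set: 'I_m]
  = \sum_(P : {ffun 'I_s -> {set 'I_m}} | ordered_partition P) \prod_j f (P j).
Proof.
move=> f0; rewrite ser_expE big_mkcond [RHS]big_mkcond /=.
apply: eq_bigr => P _; rewrite /ordered_partition.
have [h|] := boolP [forall j, P j != set0] => //=.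
rewrite negb_forall => /existsP[j]; rewrite negbK => /eqP e.
by case: ifP => // _; rewrite (bigD1 j) //= e f0 mul0r.
Qed.

(** * Evaluation at algebraically independent elements *)

Section PolynomialMorphisms.
Variables (n : nat) (K : comNzRingType).

Lemma rmorph_mmap (R S : comNzRingType) (psi : {rmorphism R -> S})
    (phi : {rmorphism K -> R}) (v : 'I_n -> R) (P : {mpoly K[n]}) :
  psi (mmap phi v P) = mmap (psi \o phi) (psi \o v) P.
Proof.
rewrite /mmap rmorph_sum; apply: eq_bigr => m _.
rewrite rmorphM /= /mmap1 rmorph_prod; congr (_ * _).
by apply: eq_bigr => i _; rewrite rmorphXn.
Qed.

Lemma eq_mmap (R : comNzRingType) (phi psi : K -> R) (v w : 'I_n -> R)
    (P : {mpoly K[n]}) :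
  phi =1 psi -> v =1 w -> mmap phi v P = mmap psi w P.
Proof.
move=> e1 e2; rewrite /mmap; apply: eq_bigr => m _; rewrite e1; congr (_ * _).
exact: mmap1_eq.
Qed.

Lemma mmap_id (P : {mpoly K[n]}) :
  mmap (@mpolyC n K) (fun i => 'X_i : {mpoly K[n]}) P = P.
Proof.
rewrite /mmap [RHS]mpolyE; apply: eq_bigr => m _.
by rewrite mmap1_id mul_mpolyC.
Qed.

Lemma rmorph_mpoly (R : comNzRingType) (psi : {rmorphism {mpoly K[n]} -> R}) P :
  psi P = mmap (psi \o @mpolyC n K) (fun i => psi 'X_i) P.
Proof. by rewrite -{1}[P]mmap_id rmorph_mmap. Qed.

End PolynomialMorphisms.

Section AlgebraicIndependence.
Variable K : fieldType.

Section Evaluation.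
Variables (n : nat) (L : fieldType) (phi : {rmorphism K -> L}) (v : 'I_n -> L).

(** Evaluation at algebraically independent elements is a morphism on all
    rational functions. *)
Definition algindep := forall P : {mpoly K[n]}, P != 0 -> mmap phi v P != 0.

Hypothesis vi : algindep.

Lemma mcomp_frac (P Q : {mpoly K[n]}) : Q != 0 ->
  mcomp phi v (tofrac P / tofrac Q) = mmap phi v P / mmap phi v Q.
Proof.
move=> Q0; rewrite /mcomp; move Ef: (tofrac P / tofrac Q) => f.
have d0 := denom_ratioP (repr f).
have : (frac (repr f)).1 * Q = P * (frac (repr f)).2.
  apply/eqP; rewrite -tofrac_eq !tofracM.
  by rewrite -eqr_div ?tofrac_eq0 // -fraction_repr Ef.
move/(congr1 (mmap phi v)); rewrite !rmorphM /= => e.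
by apply/eqP; rewrite eqr_div ?vi // e.
Qed.

Lemma mcomp_tofrac P : mcomp phi v (tofrac P) = mmap phi v P.
Proof.
rewrite -[tofrac P]divr1 -tofrac1 mcomp_frac ?oner_neq0 //.
by rewrite rmorph1 divr1.
Qed.

Lemma mcompC k : mcomp phi v (mC n k) = phi k.
Proof. by rewrite mcomp_tofrac mmapC. Qed.

Lemma mcompX i : mcomp phi v (mX i) = v i.
Proof. by rewrite mcomp_tofrac mmapX mmap1U. Qed.

Lemma mfracP (f : mratfun K n) : exists P Q : {mpoly K[n]},
  Q != 0 /\ f = tofrac P / tofrac Q.
Proof.
exists (frac (repr f)).1, (frac (repr f)).2; split; first exact: denom_ratioP.
exact: fraction_repr.
Qed.

Lemma mcomp_is_zmod : zmod_morphism (mcomp phi v).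
Proof.
move=> f g; have [P [Q [Q0 ->]]] := mfracP f; have [P' [Q' [Q0' ->]]] := mfracP g.
rewrite -mulNr -tofracN addf_div ?tofrac_eq0 // -!tofracM -tofracD.
rewrite !mcomp_frac ?mulf_neq0 // rmorphD !rmorphM rmorphN /=.
by rewrite -[in RHS]mulNr addf_div ?vi.
Qed.

Lemma mcomp_is_monoid : monoid_morphism (mcomp phi v).
Proof.
split; first by rewrite -tofrac1 mcomp_tofrac rmorph1.
move=> f g; have [P [Q [Q0 ->]]] := mfracP f; have [P' [Q' [Q0' ->]]] := mfracP g.
rewrite mulf_div -!tofracM !mcomp_frac ?mulf_neq0 // !rmorphM /=.
by rewrite mulf_div.
Qed.

End Evaluation.

Definition mrat_ev n L phi v (vi : @algindep n L phi v) f : L := mcomp phi v f.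

HB.instance Definition _ n L phi v (vi : @algindep n L phi v) :=
  GRing.isZmodMorphism.Build _ _ (mrat_ev vi) (mcomp_is_zmod vi).
HB.instance Definition _ n L phi v (vi : @algindep n L phi v) :=
  GRing.isMonoidMorphism.Build _ _ (mrat_ev vi) (mcomp_is_monoid vi).

Lemma rmorph_mcomp n (L M : fieldType) (psi : {rmorphism L -> M})
    (phi : {rmorphism K -> L}) (v : 'I_n -> L) f :
  psi (mcomp phi v f) = mcomp (psi \o phi) (psi \o v) f.
Proof. by rewrite /mcomp fmorph_div !rmorph_mmap. Qed.

Lemma eq_mcomp n (L : fieldType) (phi psi : {rmorphism K -> L})
    (v w : 'I_n -> L) f :
  phi =1 psi -> v =1 w -> mcomp phi v f = mcomp psi w f.
Proof. by move=> e1 e2; rewrite /mcomp !(eq_mmap _ e1 e2). Qed.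

Lemma hom_mcomp n (L : fieldType) (th : {rmorphism mratfun K n -> L}) f :
  th f = mcomp (th \o @mC K n) (fun i => th (mX i)) f.
Proof.
have e P : th (tofrac P) = mmap (th \o @mC K n) (fun i => th (mX i)) P.
  exact: (rmorph_mpoly (th \o @tofrac {mpoly K[n]})).
by rewrite /mcomp -!e -(fmorph_div th) -fraction_repr.
Qed.

Lemma algindep_hom n (L M : fieldType) (psi : {rmorphism L -> M})
    (phi : {rmorphism K -> L}) (v : 'I_n -> L) :
  algindep phi v -> algindep (psi \o phi) (psi \o v).
Proof. by move=> h P P0; rewrite -rmorph_mmap fmorph_eq0 h. Qed.

Lemma eq_algindep n (L : fieldType) (phi psi : {rmorphism K -> L})
    (v w : 'I_n -> L) : phi =1 psi -> v =1 w ->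
  algindep phi v -> algindep psi w.
Proof. by move=> e1 e2 h P P0; rewrite -(eq_mmap _ e1 e2) h. Qed.

Lemma mmap_mX n P : mmap (@mC K n) (fun i => mX i) P = tofrac P.
Proof. by rewrite (rmorph_mpoly (@tofrac {mpoly K[n]})). Qed.

Lemma algindep_mX n : algindep (@mC K n) (fun i => mX i).
Proof. by move=> P P0; rewrite mmap_mX tofrac_eq0. Qed.

(** An injective renaming of variables has a retraction, which recovers a
    polynomial from its renamed copy. *)
Lemma algindep_inj n N (L : fieldType) (phi : {rmorphism K -> L})
    (v : 'I_N -> L) (si : 'I_n -> 'I_N) : injective si ->
  algindep phi v -> algindep phi (fun i => v (si i)).
Proof.
move=> si_inj vi P P0; pose P' := mmap (@mpolyC N K) (fun i => 'X_(si i)) P.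
have -> : mmap phi (fun i => v (si i)) P = mmap phi v P'.
  rewrite rmorph_mmap; apply: eq_mmap => i /=; first by rewrite mmapC.
  by rewrite mmapX mmap1U.
apply: vi; apply: contraNneq P0 => P'0.
pose w (j : 'I_N) : {mpoly K[n]} := if [pick i | si i == j] is Some i then 'X_i else 0.
have := rmorph0 (mmap (@mpolyC n K) w); rewrite -P'0 rmorph_mmap.
rewrite (@eq_mmap _ _ _ _ (@mpolyC n K) _ (fun i => 'X_i)) ?mmap_id => [->//|k|i] /=.
  by rewrite mmapC.
rewrite mmapX mmap1U /w; case: pickP => [j /eqP/si_inj -> //|/(_ i)].
by rewrite eqxx.
Qed.

Lemma vcons0 (T : Type) m z (u : 'I_m -> T) : vcons z u ord0 = z.
Proof. by rewrite /vcons unlift_none. Qed.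

Lemma vconsS (T : Type) m z (u : 'I_m -> T) k : vcons z u (lift ord0 k) = u k.
Proof. by rewrite /vcons liftK. Qed.

Lemma vcons_comp (T U : Type) (g : T -> U) m z (u : 'I_m -> T) :
  g \o vcons z u =1 vcons (g z) (g \o u).
Proof. by move=> i; rewrite /vcons /=; case: unlift. Qed.

Lemma vcons_ext (T : Type) m z z' (u u' : 'I_m -> T) :
  z = z' -> u =1 u' -> vcons z u =1 vcons z' u'.
Proof. by move=> e e' i; rewrite /vcons; case: unlift. Qed.

Lemma vcons_eta (T : Type) m (w : 'I_m.+1 -> T) :
  vcons (w ord0) (fun k => w (lift ord0 k)) =1 w.
Proof. by move=> i; rewrite /vcons; case: unliftP => [j ->|->]. Qed.

(** The variable q of L(q) is independent of the elements of L. *)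
Lemma algindep_vcons m (L : fieldType) (phi : {rmorphism K -> L}) (v : 'I_m -> L) :
  algindep phi v ->
  algindep (@rC L \o phi) (vcons (rX L) (fun k => rC (v k))).
Proof.
move=> vi P P0.
pose T := {poly {mpoly K[m]}}.
pose rho := mmap (@polyC {mpoly K[m]} \o @mpolyC m K)
  (vcons ('X : T) (fun k => ('X_k)%:P)).
pose kappa : {rmorphism T -> {mpoly K[m.+1]}} := horner_eval ('X_ord0 : {mpoly K[m.+1]})
  \o map_poly (mmap (@mpolyC m.+1 K) (fun k : 'I_m => 'X_(lift ord0 k))).
have kr Q : kappa (rho Q) = Q.
  rewrite /rho (rmorph_mmap kappa) -[RHS]mmap_id; apply: eq_mmap => i /=.
    by rewrite map_polyC /horner_eval hornerC /= mmapC.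
  rewrite /vcons /=; case: unliftP => [j ->|->].
    by rewrite map_polyC /horner_eval hornerC /= mmapX mmap1U.
  by rewrite map_polyX /horner_eval hornerX.
have -> : mmap (@rC L \o phi) (vcons (rX L) (fun k => rC (v k))) P
    = tofrac (map_poly (mmap phi v) (rho P)).
  pose psi : {rmorphism T -> ratfun L} := @tofrac {poly L} \o map_poly (mmap phi v).
  rewrite -[RHS]/(psi (rho P)) /rho (rmorph_mmap psi).
  apply: eq_mmap => i /=; first by rewrite map_polyC /= mmapC.
  rewrite /vcons /=; case: unliftP => [j _|_].
    by rewrite map_polyC /= mmapX mmap1U.
  by rewrite map_polyX.
rewrite tofrac_eq0; apply: contraNneq P0 => h0.
rewrite -(kr P); suff -> : rho P = 0 by rewrite rmorph0.
apply/polyP=> i; rewrite coef0; apply/eqP; apply: contraTT isT => ci.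
have := vi _ ci; have := congr1 (fun p : {poly L} => p`_i) h0.
by rewrite coef_map coef0 => ->; rewrite eqxx.
Qed.

End AlgebraicIndependence.

(** * Differentials at the points of the projective line *)

Section MoebiusIdentities.
Variable F : fieldType.
Implicit Types a b c d q : F.

Lemma moebius_deriv_rule a b c d q : c * q + d != 0 ->
  a / (c * q + d) + (a * q + b) * (- c / (c * q + d) ^+ 2)
  = (a * d - b * c) / (c * q + d) ^+ 2.
Proof. by move=> h; field. Qed.

Lemma moebius_invq_rule a b c q : q != 0 -> c - a * q != 0 ->
  (a * q^-1 + b) / (c * q^-1 - a) = (b * q + a) / (- a * q + c).
Proof.
move=> q0 h; have h' : - a * q + c != 0 by rewrite mulNr addrC.
have -> : c * q^-1 - a = (- a * q + c) / q by field.
by field; rewrite h' q0.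
Qed.

Lemma moebius_invq_rule0 a b q : q != 0 -> a != 0 ->
  (a * q^-1 + b) / (0 * q^-1 - a) = ((- a * q + 0) / (b * q + a))^-1.
Proof.
by move=> q0 a0; rewrite invf_div mul0r sub0r addr0; field; rewrite ?q0 ?oppr_eq0 ?a0 //=.
Qed.

Lemma invol_den_rule a b c t : c * t - a != 0 ->
  c * ((a * t + b) / (c * t - a)) - a = (a ^+ 2 + b * c) / (c * t - a).
Proof. by move=> h; field. Qed.

Lemma invol_invol_rule a b c t : c * t - a != 0 -> a ^+ 2 + b * c != 0 ->
  (a * ((a * t + b) / (c * t - a)) + b) / ((a ^+ 2 + b * c) / (c * t - a)) = t.
Proof. by move=> h h'; field; rewrite h h'. Qed.
End MoebiusIdentities.

Section Moebius.
Variable L : fieldType.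
Hypothesis L0 : [pchar L] =i pred0.
Implicit Types (a b c d t : L).

Definition lin a b : ratfun L := rC a * rX L + rC b.

Lemma linE a b : lin a b = tofrac (a%:P * 'X + b%:P).
Proof. by rewrite /lin tofracD tofracM. Qed.

Lemma reg_lin t a b : reg t (lin a b).
Proof. by rewrite linE; apply: reg_at_tofrac. Qed.

Lemma reval_lin t a b : reval (lin a b) t = a * t + b.
Proof.
rewrite linE /reval rcomp_tofrac map_poly_id // hornerD hornerM !hornerC.
by rewrite hornerX.
Qed.

Lemma lin_neq0 t a b : a * t + b != 0 -> lin a b != 0.
Proof. by apply: contraNneq => h; rewrite -reval_lin h /reval rcomp0. Qed.

Lemma deriv_lin a b : rderiv (lin a b) = rC a.
Proof. by rewrite /lin rderivD rderivCM rderivC addr0 rderivX mulr1. Qed.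

Definition moebius a b c d : ratfun L := lin a b / lin c d.

Variables (a b c d t : L).
Hypothesis dt0 : c * t + d != 0.
Hypothesis det0 : a * d - b * c != 0.

Let rV : reg t (lin c d)^-1.
Proof. by apply: reg_atV; [exact: reg_lin | rewrite -/(reval _ _) reval_lin]. Qed.

Lemma reg_moebius : reg t (moebius a b c d).
Proof. by apply: reg_atM => //; apply: reg_lin. Qed.

Lemma reval_moebius : reval (moebius a b c d) t = (a * t + b) / (c * t + d).
Proof.
rewrite /reval (rcompM (reg_lin _ _ _) rV) (rcompV (reg_lin _ _ _)).
  by rewrite -!/(reval _ _) !reval_lin.
by rewrite -/(reval _ _) reval_lin.
Qed.

Lemma deriv_moebius :
  rderiv (moebius a b c d) = rC (a * d - b * c) / lin c d ^+ 2.
Proof.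
have l0 := lin_neq0 dt0.
rewrite /moebius rderivM (rderivV l0) !deriv_lin rmorphB !rmorphM.
exact: (moebius_deriv_rule (rC a) (rC b) l0).
Qed.

Lemma deriv_moebius_neq0 : rderiv (moebius a b c d) != 0.
Proof.
have l0 := lin_neq0 dt0.
rewrite deriv_moebius; apply: mulf_neq0; first by rewrite fmorph_eq0.
by rewrite invr_eq0 expf_neq0.
Qed.

Lemma reval_deriv_moebius : reval (rderiv (moebius a b c d)) t != 0.
Proof.
have rV2 : reg t (lin c d ^+ 2)^-1.
  rewrite -exprVn; exact: reg_atX_n.
rewrite deriv_moebius /reval (rcompM (reg_atC _ _ _) rV2) rcompC.
apply: mulf_neq0 => //; rewrite -exprVn (rcompX_n _ rV); apply: expf_neq0.
rewrite (rcompV (reg_lin _ _ _)) -/(reval _ _) reval_lin //.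
by rewrite invr_eq0.
Qed.
End Moebius.

Section Places.
Variable L : fieldType.
Hypothesis L0 : [pchar L] =i pred0.
Implicit Types (f g h : ratfun L) (p : P1 L) (t : L).

(** A parametrization of a neighbourhood of [p], and the parameter of [p]: the
    coordinate is q at the finite points and 1/q at infinity. *)
Definition chart p : ratfun L := if p is Some _ then rX L else (rX L)^-1.
Definition cpt p : L := if p is Some t then t else 0.

Lemma rX_neq0 : rX L != 0.
Proof. by rewrite tofrac_eq0 polyX_eq0. Qed.

Lemma deriv_invX_neq0 : rderiv (rX L)^-1 != 0.
Proof.
rewrite (rderivV rX_neq0) rderivX mulN1r oppr_eq0 invr_eq0.
by rewrite expf_neq0 // rX_neq0.
Qed.

Lemma deriv_chart_neq0 p : rderiv (chart p) != 0.
Proof.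
case: p => [t|]; last exact: deriv_invX_neq0.
by rewrite /= rderivX oner_neq0.
Qed.

Definition reg_diff p f := reg (cpt p) (pullback (chart p) f).
Definition reg_fun p f := reg (cpt p) (rcomp rC f (chart p)).
(** For f != 0, the differential [f dq] has no zero at [p], but may have a pole
    there. *)
Definition unit_diff p f := reg (cpt p) (pullback (chart p) f)^-1.
Definition Res p f := residue (pullback (chart p) f) (cpt p).

Lemma rcomp_rX f : rcomp rC f (rX L) = f.
Proof.
have : rmap idfun f = f; last by move=> {2}<-; apply: eq_rcomp.
have [[n d] [/= d0 ->]] := rfracP f.
by rewrite rmap_frac !map_poly_id.
Qed.

Lemma pullback_rX f : pullback (rX L) f = f.
Proof. by rewrite /pullback rcomp_rX rderivX mulr1. Qed.

Lemma reg_diff_fin t f : reg_diff (Some t) f = reg t f.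
Proof. by rewrite /reg_diff /= pullback_rX. Qed.
Lemma reg_fun_fin t f : reg_fun (Some t) f = reg t f.
Proof. by rewrite /reg_fun /= rcomp_rX. Qed.
Lemma unit_diff_fin t f : unit_diff (Some t) f = reg t f^-1.
Proof. by rewrite /unit_diff /= pullback_rX. Qed.
Lemma Res_fin t f : Res (Some t) f = residue f t.
Proof. by rewrite /Res /= pullback_rX. Qed.

Lemma diff_poleE p f : diff_pole f p = ~~ reg_diff p f.
Proof.
case: p => [t|]; first by rewrite reg_diff_fin regE negbK.
by rewrite /reg_diff /= regE negbK.
Qed.

Let Dc p := deriv_chart_neq0 p.

Lemma reg_diff0 p : reg_diff p 0.
Proof. by rewrite /reg_diff pullback0 reg_at0. Qed.

Lemma reg_diffD p f g : reg_diff p f -> reg_diff p g -> reg_diff p (f + g).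
Proof. by rewrite /reg_diff (pullbackD L0) //; apply: reg_atD. Qed.

Lemma pullback_chartN p f : pullback (chart p) (- f) = - pullback (chart p) f.
Proof.
by rewrite /pullback -[- f]sub0r (substB L0 (Dc p)) rcomp0 sub0r mulNr.
Qed.

Lemma unit_diffN p f : unit_diff p f -> unit_diff p (- f).
Proof. by rewrite /unit_diff pullback_chartN invrN; apply: reg_atN. Qed.

Lemma reg_diff_sum p (I : Type) (r : seq I) (P : pred I) (F : I -> ratfun L) :
  (forall i, P i -> reg_diff p (F i)) -> reg_diff p (\sum_(i <- r | P i) F i).
Proof. by move=> h; elim/big_ind: _ => [|f g|i]; [exact: reg_diff0|exact: reg_diffD|exact: h]. Qed.

Lemma reg_diff_deriv p f : reg_fun p f -> reg_diff p (rderiv f).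
Proof.
by move=> rf; rewrite /reg_diff (pullback_deriv L0) //; apply: reg_deriv.
Qed.

Lemma reg_funC p k : reg_fun p (rC k).
Proof. by rewrite /reg_fun rcompC; apply: reg_atC. Qed.

Lemma reg_funM p f g : reg_fun p f -> reg_fun p g -> reg_fun p (f * g).
Proof. by rewrite /reg_fun (substM L0) //; apply: reg_atM. Qed.

Lemma reg_fun1 p : reg_fun p 1.
Proof. by rewrite -(rmorph1 (@rC L)); apply: reg_funC. Qed.

Lemma reg_fun_prod p (I : Type) (r : seq I) (P : pred I) (F : I -> ratfun L) :
  (forall i, P i -> reg_fun p (F i)) -> reg_fun p (\prod_(i <- r | P i) F i).
Proof. by move=> h; elim/big_ind: _ => [|f g|i]; [exact: reg_fun1|exact: reg_funM|exact: h]. Qed.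

Lemma reg_fun_diffM p f g : reg_fun p f -> reg_diff p g -> reg_diff p (f * g).
Proof.
move=> rf rg; rewrite /reg_diff /pullback (substM L0) // -mulrA.
exact: reg_atM.
Qed.

Lemma reg_fun_div p f g : reg_diff p f -> unit_diff p g -> reg_fun p (f / g).
Proof.
rewrite /reg_diff /unit_diff /pullback => rf rg.
rewrite /reg_fun (substM L0) // (substV L0) //.
have := reg_atM rf rg; rewrite invfM.
by rewrite mulrACA divff ?Dc // mulr1.
Qed.

(** In characteristic 0 the derivative of a pole of order k > 0 is a pole of
    order k + 1. *)
Lemma reg_at_primitive t f : reg t (rderiv f) -> reg t f.
Proof.
have [k [g rg]] := polar_form t f.
elim: k g rg => [|k ih] g rg; first by rewrite expr0 divr1 => ->.
have [g1 rg1 Eg] := reg_div_qminus rg.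
have q0 := qminus_neq0 t.
have [v0|v0] := eqVneq (reval g t) 0.
  rewrite v0 rmorph0 add0r in Eg.
  rewrite Eg exprS invfM mulrACA divff // mul1r; exact: ih.
move=> Ef rD; exfalso; move/negP: v0; apply; apply/eqP.
have rg' := reg_deriv rg.
have Eg0 : g = qminus t ^+ k.+1 * f by rewrite Ef mulrC divfK ?qminusX_neq0.
have : qminus t * rderiv g - rC k.+1%:R * g = qminus t ^+ k.+2 * rderiv f.
  rewrite Eg0 rderivM rderivXn deriv_qminus mulr1 rmorph_nat.
  rewrite [qminus t ^+ k.+2]exprS [qminus t ^+ k.+1]exprS.
  exact: (reg_primitive_rule (qminus t) k.+1%:R (qminus t ^+ k)
            f (rderiv f)).
move/(congr1 (fun u : ratfun L => reval u t)); rewrite /reval.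
have r1 := reg_atM (reg_qminus t t) rg'.
have rk := reg_atM (reg_atC idfun t k.+1%:R) rg.
rewrite (rcompB r1 rk) (rcompM (reg_qminus t t) rg').
rewrite (rcompM (reg_atC idfun t _) rg) rcompC.
rewrite (rcompM (reg_atX_n k.+2 (reg_qminus t t)) rD) (rcompX_n _ (reg_qminus t t)).
rewrite -![rcomp _ (qminus t) t]/(reval _ _) reval_qminus subrr exprS !mul0r.
move/eqP; rewrite sub0r oppr_eq0 mulf_eq0 (negPf (natr_neq0 L0 k)) /=.
by move/eqP.
Qed.

Lemma reg_fun_primitive p f : reg_diff p (rderiv f) -> reg_fun p f.
Proof. by rewrite /reg_diff (pullback_deriv L0) //; apply: reg_at_primitive. Qed.

Lemma ResD p f g : Res p (f + g) = Res p f + Res p g.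
Proof. by rewrite /Res (pullbackD L0) // residueD. Qed.

Lemma Res0 p : Res p 0 = 0.
Proof. by rewrite /Res pullback0 // residue0. Qed.

Lemma ResN p f : Res p (- f) = - Res p f.
Proof. by apply/eqP; rewrite -addr_eq0 -ResD addNr Res0. Qed.

Lemma ResB p f g : Res p (f - g) = Res p f - Res p g.
Proof. by rewrite ResD ResN. Qed.

Lemma Res_deriv p f : Res p (rderiv f) = 0.
Proof. by rewrite /Res (pullback_deriv L0) // residue_deriv. Qed.

Lemma Res_reg p f : reg_diff p f -> Res p f = 0.
Proof. exact: residue_reg. Qed.

End Places.

Section Extension.
Variables (K L : fieldType) (phi : {rmorphism K -> L}).
Hypothesis K0 : [pchar K] =i pred0.

Lemma rmapV f : rmap phi f^-1 = (rmap phi f)^-1.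
Proof. exact: (fmorphV (rmap phi)). Qed.
Lemma rmapM f g : rmap phi (f * g) = rmap phi f * rmap phi g.
Proof. exact: (rmorphM (rmap phi)). Qed.

Lemma reg_rmap t f : reg t f -> reg (phi t) (rmap phi f).
Proof.
case/reg_atP=> n d; rewrite map_poly_id // => dt d0 ->.
rewrite rmap_frac; apply: reg_at_frac.
by rewrite map_poly_id // horner_map fmorph_eq0.
Qed.

Lemma rcomp_rmap (M : fieldType) (psi : {rmorphism L -> M}) f t :
  reg_at (psi \o phi) t f -> rcomp psi (rmap phi f) t = rcomp (psi \o phi) f t.
Proof.
case/reg_atP=> n d dt d0 ->.
rewrite rmap_frac !rcomp_frac //.
  by rewrite -!map_poly_comp.
by rewrite -map_poly_comp.
Qed.

Lemma rmap_subst f g : rderiv g != 0 ->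
  rmap phi (rcomp rC f g) = rcomp rC (rmap phi f) (rmap phi g).
Proof.
move=> Dg; rewrite (rmorph_rcomp (rmap phi)).
have e : rmap phi \o @rC K =1 @rC L \o phi by move=> k; rewrite /= rmapC.
have tr := transc_hom (rmap phi) (transc_deriv K0 Dg).
rewrite rcomp_rmap; first exact: eq_rcomp.
by rewrite /reg_at -(eq_map_poly e); apply: tr; apply: rden_neq0.
Qed.

Lemma rmap_pullback f g : rderiv g != 0 ->
  rmap phi (pullback g f) = pullback (rmap phi g) (rmap phi f).
Proof.
by move=> Dg; rewrite /pullback rmapM rmap_subst // rmap_deriv.
Qed.

Lemma rmap_chart p : rmap phi (chart p) = chart (omap phi p).
Proof. by case: p => [t|] /=; rewrite ?rmapV rmapX. Qed.

Lemma phi_cpt p : phi (cpt p) = cpt (omap phi p).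
Proof. by case: p => [t|] //=; rewrite rmorph0. Qed.

Lemma reg_diff_rmap p f : reg_diff p f -> reg_diff (omap phi p) (rmap phi f).
Proof.
rewrite /reg_diff => /reg_rmap.
by rewrite rmap_pullback ?deriv_chart_neq0 // rmap_chart phi_cpt.
Qed.

Lemma unit_diff_rmap p f : unit_diff p f -> unit_diff (omap phi p) (rmap phi f).
Proof.
rewrite /unit_diff => /reg_rmap; rewrite rmapV.
by rewrite rmap_pullback ?deriv_chart_neq0 // rmap_chart phi_cpt.
Qed.

End Extension.

Section InvolutionPlaces.
Variable L : fieldType.
Hypothesis L0 : [pchar L] =i pred0.
Variables a b c : L.
Hypothesis nondeg : a ^+ 2 + b * c != 0.
Implicit Types (f g h : ratfun L) (p : P1 L) (t : L).

Definition invol_q : ratfun L := invol (rC a) (rC b) (rC c) (rX L).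

Lemma invol_qE : invol_q = moebius a b c (- a).
Proof. by rewrite /invol_q /invol /moebius /lin rmorphN. Qed.

Lemma invol_q_det : a * - a - b * c != 0.
Proof. by rewrite mulrN -opprD oppr_eq0 -expr2. Qed.

Lemma invol_q_den_neq0 : exists t, c * t - a != 0.
Proof.
have [c0|c0] := eqVneq c 0.
  exists 0; rewrite mulr0 sub0r oppr_eq0; apply: contraNneq nondeg => ->.
  by rewrite c0 expr0n mulr0 addr0.
exists ((a + 1) / c); rewrite mulrC divfK // addrC addKr oner_neq0 //.
Qed.

Lemma deriv_invol_q_neq0 : rderiv invol_q != 0.
Proof.
have [t ht] := invol_q_den_neq0.
by rewrite invol_qE; apply: (deriv_moebius_neq0 (t := t) ht invol_q_det).
Qed.

Lemma deriv_invol_q : rderiv invol_q = dinvol (rC a) (rC b) (rC c) (rX L).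
Proof.
have [t ht] := invol_q_den_neq0.
rewrite invol_qE (deriv_moebius _ _ (t := t) ht) /dinvol /lin rmorphN.
by rewrite mulrN -opprD rmorphN rmorphD !rmorphM expr2.
Qed.

Lemma involP_num t : c * t - a = 0 -> a * t + b != 0.
Proof.
move/eqP; rewrite subr_eq0 => /eqP e; apply: contraNneq nondeg => h.
by rewrite expr2 -{1}e [b * c]mulrC -mulrA -mulrDr [t * a]mulrC h mulr0.
Qed.

Lemma involPK : involutive (involP a b c).
Proof.
case=> [t|] /=; last first.
  have [//|c0] := eqVneq c 0; first by rewrite /= => ->; rewrite eqxx.
  by rewrite /= mulrC divfK // subrr eqxx.
have [h|h] := eqVneq (c * t - a) 0.
  move/eqP: (h); rewrite subr_eq0 => /eqP e /=.
  have [c0|c0] := eqVneq c 0.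
    move: nondeg; rewrite c0 mulr0 addr0 expf_eq0 /=.
    by rewrite -e c0 mul0r eqxx.
  by rewrite -e mulrC mulKf.
rewrite /= /invol.
have hd : c * ((a * t + b) / (c * t - a)) - a = (a ^+ 2 + b * c) / (c * t - a).
  exact: invol_den_rule.
rewrite hd mulf_eq0 invr_eq0 (negPf h) (negPf nondeg) /=; congr Some.
exact: invol_invol_rule.
Qed.

(** In local coordinates [invol_q] is a regular change of variable at every point
    of the projective line, the point at infinity included. *)
Lemma invol_q_local p : exists h,
  [/\ reg (cpt p) h, reval h (cpt p) = cpt (involP a b c p),
      reval (rderiv h) (cpt p) != 0, rderiv h != 0
    & rcomp rC invol_q (chart p) = rcomp rC (chart (involP a b c p)) h].
Proof.
have X0 := rX_neq0 L.
have pack a' b' c' d' t : c' * t + d' != 0 -> a' * d' - b' * c' != 0 ->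
    let h := moebius a' b' c' d' in
    [/\ reg t h, reval h t = (a' * t + b') / (c' * t + d'),
        reval (rderiv h) t != 0 & rderiv h != 0].
  move=> dt det; split.
  - exact: reg_moebius.
  - exact: reval_moebius.
  - exact: reval_deriv_moebius.
  - exact: (deriv_moebius_neq0 dt).
have inv_chart h : rderiv h != 0 -> rcomp rC (rX L)^-1 h = h^-1.
  by move=> Dh; rewrite (substV L0) // rcompX.
case: p => [t|] /=.
  rewrite rcomp_rX; have [h|h] := eqVneq (c * t - a) 0.
    have det : c * b - - a * a != 0.
      by rewrite mulNr opprK -expr2 addrC [c * b]mulrC.
    have [r v Dv D0] := pack c (- a) a b t (involP_num h) det.
    exists (moebius c (- a) a b); split=> //; first by rewrite v h mul0r.
    by rewrite /= inv_chart // invol_qE /moebius invf_div.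
  have [r v Dv D0] := pack a b c (- a) t h invol_q_det.
  by exists (moebius a b c (- a)); split; rewrite //= rcompX invol_qE.
have Einv : rcomp rC invol_q (rX L)^-1
    = (rC a * (rX L)^-1 + rC b) / (rC c * (rX L)^-1 - rC a).
  have D0 := deriv_invX_neq0 L.
  rewrite invol_qE /moebius (substM L0) // (substV L0) // /lin !(substD L0) //.
  by rewrite !(substM L0) // !rcompC rcompX rmorphN.
rewrite Einv; have [c0|c0] := eqVneq c 0.
  have a0 : a != 0.
    by apply: contraNneq nondeg => ->; rewrite c0 expr0n mulr0 addr0.
  have dt : b * 0 + a != 0 by rewrite mulr0 add0r.
  have det : - a * a - 0 * b != 0 by rewrite mul0r subr0 mulNr oppr_eq0 mulf_neq0.
  have [r v Dv D0] := pack (- a) 0 b a 0 dt det.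
  exists (moebius (- a) 0 b a); split=> //; first by rewrite v mulr0 addr0 mul0r.
  rewrite /= inv_chart // c0 rmorph0 /moebius /lin rmorph0 rmorphN.
  have ra0 : rC a != 0 :> ratfun L by rewrite fmorph_eq0.
  exact: (moebius_invq_rule0 (rC b) X0 ra0).
have dt : - a * 0 + c != 0 by rewrite mulr0 add0r.
have det : b * c - a * - a != 0 by rewrite mulrN opprK addrC -expr2.
have [r v Dv D0] := pack b a (- a) c 0 dt det.
exists (moebius b a (- a) c); split=> //=.
  by rewrite v !mulr0 !add0r.
rewrite rcompX /moebius /lin rmorphN.
have h : rC c - rC a * rX L != 0.
  by have := lin_neq0 dt; rewrite /lin rmorphN mulNr addrC.
exact: (moebius_invq_rule (rC b) X0 h).
Qed.

Lemma pullback_invol_q_local p f : exists h,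
  [/\ reg (cpt p) h, reval h (cpt p) = cpt (involP a b c p),
      reval (rderiv h) (cpt p) != 0, rderiv h != 0
    & pullback (chart p) (pullback invol_q f)
      = pullback h (pullback (chart (involP a b c p)) f)].
Proof.
have [h [r v Dv D0 E]] := invol_q_local p; exists h; split=> //.
have Dc := deriv_chart_neq0 p; have Dc' := deriv_chart_neq0 (involP a b c p).
have Di := deriv_invol_q_neq0.
have e0 : rderiv (rcomp rC invol_q (chart p)) != 0.
  by rewrite (subst_deriv L0 Dc); apply: mulf_neq0 (subst_neq0 L0 Dc Di) Dc.
have e0' := e0; rewrite E in e0'.
by rewrite !(pullback_comp L0) // E.
Qed.

Lemma unit_diff_invol p f :
  unit_diff (involP a b c p) f -> unit_diff p (pullback invol_q f).
Proof.
have [h [r v Dv D0 E]] := pullback_invol_q_local p f.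
rewrite /unit_diff E -v => rf; rewrite {1}/pullback invfM -(substV L0) //.
apply: reg_atM; first exact: reg_subst.
by apply: reg_atV => //; apply: reg_deriv.
Qed.

Lemma Res_invol p f : Res p (pullback invol_q f) = Res (involP a b c p) f.
Proof.
have [h [r v Dv D0 E]] := pullback_invol_q_local p f.
by rewrite /Res E -v; apply: residue_subst.
Qed.

End InvolutionPlaces.

(** * Residues at a generic point *)

Section IntegrandIdentities.
Variable F : fieldType.

Lemma leibniz_quotient_rule (f g f' g' y : F) :
  (f' * g + f * g') / y = f' / y * g + f * (g' / y).
Proof. by rewrite mulrDl mulrAC mulrA. Qed.

Lemma integrand_step_rule (H dH E y n : F) (s : nat) : E != 0 -> n != 0 ->
  H * y / E ^+ s.+2 =
  n^-1 * (dH / E ^+ s.+1 + H * (- (n * E ^+ s * - y) / (E ^+ s.+1) ^+ 2))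
  - n^-1 * (dH / E ^+ s.+1).
Proof.
move=> E0 n0; have p0 : E ^+ s != 0 by rewrite expf_neq0.
rewrite !exprS expr0; move: (E ^+ s) p0 => p p0.
by field; rewrite n0 E0 p0.
Qed.
End IntegrandIdentities.

Definition dby (L : fieldType) (y f : ratfun L) : ratfun L := rderiv f / rderiv y.

Section DerivationByY.
Variables (L : fieldType) (y : ratfun L).

Lemma dby_is_zmod : zmod_morphism (dby y).
Proof. by move=> f g; rewrite /dby raddfB mulrBl. Qed.
HB.instance Definition _ := GRing.isZmodMorphism.Build _ _ (dby y) dby_is_zmod.

Lemma dbyM f g : dby y (f * g) = dby y f * g + f * dby y g.
Proof. by rewrite /dby rderivM; apply: leibniz_quotient_rule. Qed.

Lemma dbyC k : dby y (rC k) = 0.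
Proof. by rewrite /dby rderivC mul0r. Qed.

Lemma iter_dbyD (n : nat) f g :
  iter n (dby y) (f + g) = iter n (dby y) f + iter n (dby y) g.
Proof. by elim: n => //= n ->; rewrite raddfD. Qed.

Lemma iter_dby0 (n : nat) : iter n (dby y) 0 = 0.
Proof. by elim: n => //= n ->; rewrite raddf0. Qed.

Lemma iter_dbyCM (n : nat) k f :
  iter n (dby y) (rC k * f) = rC k * iter n (dby y) f.
Proof. by elim: n => //= n ->; rewrite dbyM dbyC mul0r add0r. Qed.
End DerivationByY.

Section GenericResidue.
Variables (K F : fieldType) (io : {rmorphism K -> F}) (z : F).
Hypothesis F0 : [pchar F] =i pred0.
Hypothesis tz : transc io z.
Implicit Types g y : ratfun K.

Lemma reg_generic g : reg z (rmap io g).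
Proof.
have [[n d] [/= d0 ->]] := rfracP g; rewrite rmap_frac; apply: reg_at_frac.
by rewrite map_poly_id //; apply: tz.
Qed.

Lemma reval_generic g : reval (rmap io g) z = rcomp io g z.
Proof.
have tz' : transc (idfun \o io) z.
  by move=> p p0; rewrite (eq_map_poly (g := io)) // tz.
rewrite /reval rcomp_rmap; first exact: eq_rcomp.
exact: transc_reg.
Qed.

Lemma rcomp_generic_neq0 g : g != 0 -> rcomp io g z != 0.
Proof. by move=> g0; rewrite -[rcomp _ _ _]/(rat_ev tz g) (fmorph_eq0 (rat_ev tz)). Qed.

(** The residue at a generic point z of g(q)dq/(y(z) - y(q))^(s+1), by s
    integrations by parts: y(q) - y(z) is a local coordinate at z. *)
Lemma residue_generic (s : nat) g y : rderiv y != 0 ->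
  residue (rmap io g / (rC (rcomp io y z) - rmap io y) ^+ s.+1) z
  = rcomp io (rC ((-1) ^+ s.+1 / s`!%:R) * iter s (dby y) (g / rderiv y)) z.
Proof.
move=> Dy; set E := rC _ - rmap io y.
have Dy' : rderiv (rmap io y) != 0.
  by rewrite rmap_deriv -[rmap io _]/(rmap io (rderiv y)) (fmorph_eq0 (rmap io)).
have DE : rderiv E = - rderiv (rmap io y).
  by rewrite /E raddfB /= rderivC sub0r.
have E0 : E != 0.
  by apply: contraNneq Dy' => h; rewrite -oppr_eq0 -DE h raddf0.
have evC k : rcomp io (rC k) z = io k by apply: rcompC.
have evM f h : rcomp io (f * h) z = rcomp io f z * rcomp io h z.
  exact: (rmorphM (rat_ev tz)).
have ev_sign (n : nat) : io ((-1) ^+ n.+1 / n`!%:R) = (-1) ^+ n.+1 / n`!%:R.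
  by rewrite fmorph_div rmorphXn rmorphN rmorph1 rmorph_nat.
elim: s g => [|s ih] g.
  have [u ru Eu] := reg_div_qminus (reg_generic y).
  rewrite reval_generic in Eu.
  have EE : E = - (qminus z * u) by rewrite /E Eu opprD addrA subrr sub0r.
  have Du : rderiv (rmap io y) = u + qminus z * rderiv u.
    by rewrite Eu rderivD rderivC add0r rderivM deriv_qminus mul1r.
  have vu : reval u z = rcomp io (rderiv y) z.
    rewrite -reval_generic -rmap_deriv Du /reval.
    rewrite (rcompD ru (reg_atM (reg_qminus z z) (reg_deriv ru))).
    rewrite (rcompM (reg_qminus z z) (reg_deriv ru)).
    by rewrite [rcomp _ (qminus z) z]reval_qminus subrr mul0r addr0.
  have vu0 : reval u z != 0 by rewrite vu rcomp_generic_neq0.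
  have rVu : reg z u^-1 by apply: reg_atV.
  have rN : reg z (- (rmap io g / u)).
    by apply: reg_atN; apply: reg_atM => //; apply: reg_generic.
  have -> : rmap io g / E ^+ 1 = - (rmap io g / u) / qminus z.
    by rewrite expr1 EE invrN mulrN invfM mulrA mulrAC -mulNr.
  rewrite (residue_simple F0 rN) /reval (rcompN (reg_atM (reg_generic g) rVu)).
  rewrite (rcompM (reg_generic g) rVu) (rcompV ru vu0).
  rewrite -!/(reval _ _) reval_generic vu (evM (rC _)) evC ev_sign fact0 divr1 expr1 mulN1r.
  congr (- _); rewrite (evM g); congr (_ * _).
  exact/esym/(fmorphV (rat_ev tz)).
pose H := g / rderiv y.
have EH : rmap io g = rmap io H * rderiv (rmap io y).
  by rewrite /H rmap_deriv -rmapM divfK.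
have n0 : s.+1%:R != 0 :> ratfun F by apply: ratfun_natr_neq0.
have Es0 := expf_neq0 s.+1 E0.
have step : rmap io g / E ^+ s.+2
   = rC (s.+1%:R^-1) * rderiv (rmap io H / E ^+ s.+1)
     - rC (s.+1%:R^-1) * (rmap io (rderiv H) / E ^+ s.+1).
  rewrite rderivM (rderivV Es0) rderivXn DE EH -[rmap io (rderiv H)]rmap_deriv.
  rewrite fmorphV (rmorph_nat (@rC F)).
  exact: (integrand_step_rule (rmap io H) (rderiv (rmap io H))
            (rderiv (rmap io y)) s E0 n0).
rewrite step (residueB F0) !(residueCM F0) (residue_deriv F0) mulr0 sub0r.
rewrite ih !(evM (rC _)) !evC !ev_sign iterSr -/H -[dby y H]/(rderiv H / rderiv y).
rewrite -mulNr mulrA; congr (_ * _).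
rewrite [(-1) ^+ s.+2]exprS mulN1r factS natrM invfM.
by rewrite !mulNr mulrCA.
Qed.

End GenericResidue.

(** * The involution identity at independent points *)

Lemma dipole_primitive_rule (F : fieldType) (a b c u q : F) :
  c * u - a != 0 -> c * q - a != 0 -> a ^+ 2 + b * c != 0 -> q - u != 0 ->
  (c * u - a) * q - (a * u + b) != 0 ->
  - ((a * q + b) / (c * q - a) - u)^-1
    + - (a ^+ 2 + b * c) / (c * u - a) ^+ 2
      / ((a * q + b) / (c * q - a) - (a * u + b) / (c * u - a))
  = c / (c * u - a) *+ 2
    - (- (q - u)^-1 + - (a ^+ 2 + b * c) / (c * u - a) ^+ 2
                      / (q - (a * u + b) / (c * u - a))).
Proof.
move=> h1 h2 h3 h4 h5.
have -> : (a * q + b) / (c * q - a) - u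
    = - ((c * u - a) * q - (a * u + b)) / (c * q - a) by field.
have -> : (a * q + b) / (c * q - a) - (a * u + b) / (c * u - a)
    = - (a ^+ 2 + b * c) * (q - u) / ((c * q - a) * (c * u - a)).
  by field; rewrite h1 h2.
have -> : q - (a * u + b) / (c * u - a)
    = ((c * u - a) * q - (a * u + b)) / (c * u - a) by field.
by field; rewrite !oppr_eq0 h1 h2 h3 h4 h5.
Qed.

Lemma integrand_factor_rule (F : fieldType) (u v e w : F) :
  u * v / e * w = u * (v * w / e).
Proof. by rewrite -!mulrA [e^-1 * w]mulrC. Qed.

Section RmapMore.
Variables (K L : fieldType) (phi : {rmorphism K -> L}).

Lemma rmap_comp (M : fieldType) (psi : {rmorphism L -> M}) f :
  rmap psi (rmap phi f) = rmap (psi \o phi) f.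
Proof.
rewrite {1}/rmap rcomp_rmap //.
by apply: transc_reg; apply: (transc_rX (psi \o phi)).
Qed.

Lemma eq_rmap (psi : {rmorphism K -> L}) f : phi =1 psi -> rmap phi f = rmap psi f.
Proof. by move=> e; apply: eq_rcomp => k; rewrite /= e. Qed.

Lemma rmap_dby (n : nat) y f :
  rmap phi (iter n (dby y) f) = iter n (dby (rmap phi y)) (rmap phi f).
Proof.
elim: n => //= n ih; rewrite /dby rmapM rmapV -!rmap_deriv; congr (_ / _).
by rewrite rmap_deriv -ih -rmap_deriv.
Qed.

Lemma rmap_prod (I : Type) (r : seq I) (P : pred I) (G : I -> ratfun K) :
  rmap phi (\prod_(i <- r | P i) G i) = \prod_(i <- r | P i) rmap phi (G i).
Proof. exact: (rmorph_prod (rmap phi)). Qed.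

Lemma pchar_hom : [pchar K] =i pred0 -> [pchar L] =i pred0.
Proof. by move=> K0 p; rewrite (fmorph_pchar phi) K0. Qed.

Lemma rmap_invol_q a b c : rmap phi (invol_q a b c) = invol_q (phi a) (phi b) (phi c).
Proof.
rewrite /invol_q /invol rmapM rmapV.
rewrite -[rmap phi (_ - _)]/((rmap phi : {rmorphism _ -> _}) (_ - _)).
rewrite rmorphB rmorphD !rmorphM /= rmapX !rmapC //.
Qed.

Lemma omap_involP a b c p :
  omap phi (involP a b c p) = involP (phi a) (phi b) (phi c) (omap phi p).
Proof.
case: p => [t|] /=.
  rewrite -rmorphM -rmorphB fmorph_eq0; case: eqP => //= _.
  by rewrite /invol fmorph_div rmorphB rmorphD !rmorphM.
by rewrite fmorph_eq0; case: eqP => //= _; rewrite fmorph_div.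
Qed.
End RmapMore.

Section Correlators.
Variables (K : fieldType) (K0 : [pchar K] =i pred0).
Variables (a b c : K) (x : ratfun K) (omega : forall n, mratfun K n).
Hypothesis nondeg : a ^+ 2 + b * c != 0.

Local Notation y := (yfun a b c x).

Section Points.
Variables (L : fieldType) (phi : {rmorphism K -> L}).

Definition indep (s : seq L) := algindep phi (fun i : 'I_(size s) => s`_i).

(** The differential omega(q, s) in q, the other arguments being the points [s]:
    it is only meaningful for independent points. *)
Definition correlator (s : seq L) : ratfun L :=
  mcomp (@rC L \o phi) (vcons (rX L) (fun i : 'I_(size s) => rC s`_i))
    (omega (size s).+1).

Lemma correlatorE n (u : 'I_n -> L) (s : seq L) (e : n = size s) :
  (forall i : 'I_n, u i = s`_i) ->
  mcomp (@rC L \o phi) (vcons (rX L) (fun i => rC (u i))) (omega n.+1) = correlator s.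
Proof.
move=> h; move: u h; rewrite e => u h; apply: eq_mcomp => //.
by apply: vcons_ext => // i; rewrite h.
Qed.

Definition subseq_of (s : seq L) (J : {set 'I_(size s)}) : seq L :=
  [seq s`_i | i : 'I_(size s) <- enum J].

(** The term of a partition in the involution identity, with its residue
    computed by [residue_generic]. *)
Definition exchange_term (s : seq L) (k : nat)
    (P : {ffun 'I_k -> {set 'I_(size s)}}) : ratfun L :=
  let xd := rderiv (rmap phi x) in let yL := rmap phi y in
  rC k%:R^-1 * (rderiv yL * (rC ((-1) ^+ k / (k.-1)`!%:R) *
    iter k.-1 (dby yL)
      (xd * \prod_(j < k) (correlator (subseq_of (P j)) / xd) / rderiv yL))).

End Points.

Lemma uvar_indep m : algindep (@mC K m.+1) (@uvar K m).
Proof.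
exact: (algindep_inj (si := lift ord0) (@lift_inj _ _) (@algindep_mX K m.+1)).
Qed.

(** The inclusion of K(u_1, ..., u_m) in K(z, u_1, ..., u_m), under which z is
    transcendental. *)
Definition shift_vars m : {rmorphism mratfun K m -> mratfun K m.+1} :=
  mrat_ev (@uvar_indep m).

Lemma shift_varsC m k : shift_vars m (mC m k) = mC m.+1 k.
Proof. exact: mcompC (@uvar_indep m) k. Qed.

Lemma shift_varsX m i : shift_vars m (mX i) = uvar K i :> mratfun K m.+1.
Proof. exact: mcompX (@uvar_indep m) i. Qed.

Section Specialization.
Variables (L : fieldType) (phi : {rmorphism K -> L}) (m : nat) (u : 'I_m -> L).
Hypothesis ui : algindep phi u.

(** Specialization of (z, u_1, ..., u_m) at the point (q, u) of the field L(q). *)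
Definition at_q : {rmorphism mratfun K m.+1 -> ratfun L} :=
  mrat_ev (algindep_vcons ui).
Definition at_u : {rmorphism mratfun K m -> L} := mrat_ev ui.

Lemma at_qC k : at_q (mC m.+1 k) = rC (phi k).
Proof. exact: mcompC (algindep_vcons ui) k. Qed.
Lemma at_qz : at_q (zvar K m) = rX L.
Proof. exact: etrans (mcompX (algindep_vcons ui) ord0) (vcons0 _ _). Qed.
Lemma at_qu i : at_q (uvar K i) = rC (u i).
Proof.
exact: etrans (mcompX (algindep_vcons ui) (lift ord0 i)) (vconsS _ _ _).
Qed.
Lemma at_uC k : at_u (mC m k) = phi k.
Proof. exact: mcompC ui k. Qed.
Lemma at_uX i : at_u (mX i) = u i.
Proof. exact: mcompX ui i. Qed.

Lemma at_q_shift f : at_q (shift_vars m f) = rC (at_u f).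
Proof.
rewrite -[LHS]/((at_q \o @shift_vars m) f) -[RHS]/((@rC L \o at_u) f).
rewrite (hom_mcomp (at_q \o @shift_vars m)) (hom_mcomp (@rC L \o at_u)).
apply: eq_mcomp => [k|i] /=.
  by rewrite shift_varsC at_qC at_uC.
by rewrite shift_varsX at_qu at_uX.
Qed.

Lemma at_q_rcomp f : at_q (rcomp (@shift_vars m) f (zvar K m)) = rmap at_u f.
Proof.
rewrite (rmorph_rcomp at_q) at_qz /rmap.
by apply: eq_rcomp => k; rewrite /= at_q_shift.
Qed.

Lemma rmap_at_u f : rmap at_u (as_fun_of_z f)
  = mcomp (@rC L \o phi) (vcons (rX L) (fun i => rC (u i))) f.
Proof.
rewrite /as_fun_of_z (rmorph_mcomp (rmap at_u)); apply: eq_mcomp => [k|i].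
  by rewrite /= rmapC at_uC.
rewrite vcons_comp; apply: vcons_ext => [|j]; first exact: rmapX.
by rewrite /= rmapC at_uX.
Qed.

End Specialization.

Lemma transc_zvar m : transc (@shift_vars m) (zvar K m).
Proof.
move=> p p0; have ui := @algindep_mX K m.
rewrite -(fmorph_eq0 (at_q ui)) -horner_map -map_poly_comp at_qz.
have e : at_q ui \o @shift_vars m =1 @rC _ \o idfun.
  move=> f; rewrite /= at_q_shift; apply: congr1.
  rewrite (hom_mcomp (at_u ui)) [RHS](hom_mcomp idfun).
  by apply: eq_mcomp => [k|i]; [exact: at_uC | exact: at_uX].
by rewrite (eq_map_poly e) horner_rX map_poly_id // tofrac_eq0.
Qed.

Section BlocksOverParameters.
Variable m : nat.
Local Notation F' := (mratfun K m).
Local Notation F := (mratfun K m.+1).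

Definition block (J : {set 'I_m}) : ratfun F' :=
  mcomp (@rC F' \o @mC K m) (vcons (rX F') (fun k : 'I_#|J| => rC (mX (enum_val k))))
    (omega #|J|.+1).

Lemma omega_blockE (J : {set 'I_m}) :
  omega_block omega J = rmap (@shift_vars m) (block J).
Proof.
rewrite /block (rmorph_mcomp (rmap (@shift_vars m))); apply: eq_mcomp => [k|i].
  by rewrite /= rmapC shift_varsC.
rewrite vcons_comp; apply: vcons_ext => [|j]; first exact/esym/rmapX.
by rewrite /= rmapC shift_varsX.
Qed.

Lemma rmap_mC f : rmap (@mC K m.+1) f = rmap (@shift_vars m) (rmap (@mC K m) f).
Proof. by rewrite rmap_comp; apply: eq_rmap => k; rewrite /= shift_varsC. Qed.

Lemma rcomp_mC f :
  rcomp (@mC K m.+1) f (zvar K m) = rcomp (@shift_vars m) (rmap (@mC K m) f) (zvar K m).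
Proof.
have tz := @transc_zvar m.
have e : @shift_vars m \o @mC K m =1 @mC K m.+1 by move=> k; rewrite /= shift_varsC.
rewrite rcomp_rmap; first by apply: eq_rcomp => k; rewrite /= shift_varsC.
apply: transc_reg => p p0; rewrite map_poly_comp; apply: tz.
by rewrite map_poly_eq0.
Qed.

Lemma integrandE k (P : {ffun 'I_k -> {set 'I_m}}) :
  let xd := rderiv (rmap (@mC K m) x) in let y' := rmap (@mC K m) y in
  integrand a b c x omega P
  = rC (rcomp (@shift_vars m) (rderiv y') (zvar K m)) *
    (rmap (@shift_vars m) (xd * \prod_(j < k) (block (P j) / xd))
     / (rC (rcomp (@shift_vars m) y' (zvar K m)) - rmap (@shift_vars m) y') ^+ k).
Proof.
move=> xd y'.
transitivity (rC (rcomp (@mC K m.+1) (rderiv y) (zvar K m))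
    * rmap (@mC K m.+1) (rderiv x)
    / (rC (rcomp (@mC K m.+1) y (zvar K m)) - rmap (@mC K m.+1) y) ^+ k
    * \prod_(j < k) (omega_block omega (P j) / rmap (@mC K m.+1) (rderiv x))).
  by rewrite /integrand /rmap; reflexivity.
have -> : rmap (@mC K m.+1) (rderiv x) = rmap (shift_vars m) xd.
  by rewrite rmap_mC /xd (rmap_deriv (@mC K m) x).
rewrite (rcomp_mC y) (rcomp_mC (rderiv y)) (rmap_mC y) -(rmap_deriv (@mC K m) y).
rewrite -/y'; clearbody xd y'.
have -> : rmap (shift_vars m) (xd * \prod_(j < k) (block (P j) / xd))
    = rmap (shift_vars m) xd
      * \prod_(j < k) (omega_block omega (P j) / rmap (shift_vars m) xd).
  rewrite (rmapM (shift_vars m) xd) rmap_prod; apply: congr1.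
  by apply: eq_bigr => j _; rewrite rmapM rmapV omega_blockE.
exact: integrand_factor_rule.
Qed.

End BlocksOverParameters.

Hypothesis x_deriv : rderiv x != 0.

Section Target.
Variables (L : fieldType) (phi : {rmorphism K -> L}).
Let L0 : [pchar L] =i pred0 := pchar_hom phi K0.
Local Notation inv_q := (invol_q (phi a) (phi b) (phi c)).

Lemma nondeg_hom : phi a ^+ 2 + phi b * phi c != 0.
Proof. by rewrite -rmorphXn -rmorphM -rmorphD fmorph_eq0. Qed.

Lemma deriv_x_neq0 : rderiv (rmap phi x) != 0.
Proof. by rewrite rmap_deriv (fmorph_eq0 (rmap phi)). Qed.

Lemma rmap_y : rmap phi y = - rcomp rC (rmap phi x) inv_q.
Proof.
rewrite /yfun -/(invol_q a b c) -[rmap phi (- _)]/((rmap phi : {rmorphism _ -> _}) (- _)).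
rewrite rmorphN /=; congr (- _).
by rewrite (rmap_subst phi K0 _ (deriv_invol_q_neq0 nondeg)) rmap_invol_q.
Qed.

Lemma deriv_y : rderiv (rmap phi y) = - pullback inv_q (rderiv (rmap phi x)).
Proof.
have Di := deriv_invol_q_neq0 nondeg_hom.
by rewrite rmap_y raddfN /= (pullback_deriv L0 Di).
Qed.

Lemma deriv_y_neq0 : rderiv (rmap phi y) != 0.
Proof.
have Di := deriv_invol_q_neq0 nondeg_hom.
rewrite deriv_y oppr_eq0.
exact: (mulf_neq0 (subst_neq0 L0 Di deriv_x_neq0) Di).
Qed.

End Target.

Section Identity.
Variables (L : fieldType) (phi : {rmorphism K -> L}) (s : seq L).
Hypothesis si : indep phi s.
Let L0 : [pchar L] =i pred0 := pchar_hom phi K0.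
Local Notation inv_q := (invol_q (phi a) (phi b) (phi c)).
Local Notation m := (size s).

Lemma rmap_block (J : {set 'I_m}) : rmap (at_u si) (block J) = correlator phi (subseq_of J).
Proof.
rewrite /block (rmorph_mcomp (rmap (at_u si))).
have e : #|J| = size (subseq_of J) by rewrite size_map -cardE.
rewrite -(@correlatorE L phi #|J| (fun k => s`_(enum_val k)) _ e) => [|i]; last first.
  rewrite (nth_map (enum_val i)) -?cardE //.
  by rewrite -enum_val_nth.
apply: eq_mcomp => [k|i]; first by rewrite /= rmapC at_uC.
rewrite vcons_comp; apply: vcons_ext => [|j]; first exact: rmapX.
by rewrite /= rmapC at_uX.
Qed.

Lemma at_u_comp f : rmap (at_u si) (rmap (@mC K m) f) = rmap phi f.
Proof. by rewrite rmap_comp; apply: eq_rmap => k; rewrite /= at_uC. Qed.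

Lemma at_q_residue (k : nat) (P : {ffun 'I_k.+1 -> {set 'I_m}}) :
  at_q si (k.+1%:R^-1 * residue (integrand a b c x omega P) (zvar K m))
  = exchange_term phi P.
Proof.
have F0 := pchar_hom (@mC K m.+1) K0.
have F0' := pchar_hom (@mC K m) K0.
have Dy := deriv_y_neq0 (@mC K m).
rewrite integrandE (residueCM F0) (residue_generic F0 (@transc_zvar m)) //.
rewrite (rmorphM (at_q si)) (rmorphM (at_q si) (rcomp _ _ _)) !at_q_rcomp.
rewrite (fmorphV (at_q si)) (rmorph_nat (at_q si)).
rewrite /exchange_term fmorphV (rmorph_nat (@rC L)); congr (_ * _).
rewrite -!rmap_deriv at_u_comp; congr (_ * _).
have sg : at_u si ((-1) ^+ k.+1 / k`!%:R) = (-1) ^+ k.+1 / k`!%:R.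
  by rewrite fmorph_div rmorphXn rmorphN rmorph1 rmorph_nat.
rewrite (rmapM _ (rC _)) rmapC sg; congr (_ * _).
rewrite rmap_dby at_u_comp rmapM rmapV -!rmap_deriv at_u_comp; congr (iter _ _ (_ / _)).
rewrite rmapM rmap_prod -!rmap_deriv at_u_comp; congr (_ * _).
apply: eq_bigr => j _.
by rewrite rmapM rmapV -!rmap_deriv at_u_comp rmap_block.
Qed.

Hypothesis omega_identity : forall m : nat, (2 <= m)%N ->
  involution_identity a b c x omega m.

Lemma at_q_rhs : at_q si (identity_rhs a b c x omega m)
  = \sum_(2 <= k < m.+1)
      \sum_(P : {ffun 'I_k -> {set 'I_m}} | ordered_partition P) exchange_term phi P.
Proof.
rewrite /identity_rhs rmorph_sum; apply: eq_big_nat => k /andP[k2 _].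
rewrite rmorph_sum; apply: eq_bigr => P _.
by case: k k2 P => // k _ P; apply: at_q_residue.
Qed.

Lemma at_q_invol : at_q si (invol (mC m.+1 a) (mC m.+1 b) (mC m.+1 c) (zvar K m)) = inv_q.
Proof.
rewrite /invol_q /invol (rmorphM (at_q si)) (fmorphV (at_q si)).
rewrite (rmorphB (at_q si)) (rmorphD (at_q si)) !(rmorphM (at_q si) (mC _ _)).
by rewrite !at_qC !at_qz.
Qed.

Lemma at_q_dinvol : at_q si (dinvol (mC m.+1 a) (mC m.+1 b) (mC m.+1 c) (zvar K m))
  = rderiv inv_q.
Proof.
rewrite (deriv_invol_q (nondeg_hom phi)) /dinvol (rmorphM (at_q si)).
rewrite (fmorphV (at_q si)) (rmorphXn (at_q si)).
rewrite (rmorphN (at_q si)) (rmorphB (at_q si)) (rmorphD (at_q si)).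
rewrite (rmorphXn (at_q si)) !(rmorphM (at_q si) (mC _ _)).
by rewrite !at_qC !at_qz.
Qed.

Lemma at_q_omega : at_q si (omega m.+1) = correlator phi s.
Proof. by []. Qed.

(** The involution identity is between rational functions of independent
    variables: it may be specialized to the independent elements q, s of L(q). *)
Lemma correlator_identity : (2 <= m)%N ->
  correlator phi s + pullback inv_q (correlator phi s)
  = \sum_(2 <= k < m.+1)
      \sum_(P : {ffun 'I_k -> {set 'I_m}} | ordered_partition P) exchange_term phi P.
Proof.
move=> m2; have := congr1 (at_q si) (omega_identity m2).
rewrite at_q_rhs /identity_lhs => <-.
rewrite (rmorphD (at_q si)) (rmorphM (at_q si)) at_q_dinvol at_q_omega.
congr (_ + _); rewrite /pullback; congr (_ * _).
have tr := transc_deriv L0 (deriv_invol_q_neq0 (nondeg_hom phi)).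
rewrite -[LHS]/(rat_ev tr (correlator phi s)) /correlator (rmorph_mcomp (rat_ev tr)).
rewrite (rmorph_mcomp (at_q si)); apply: eq_mcomp => [k|i].
  by rewrite /= at_qC /rat_ev rcompC.
rewrite !vcons_comp; apply: vcons_ext => [|j].
  exact: etrans (rcompX _ _) (esym at_q_invol).
exact: etrans (rcompC _ _ _) (esym (at_qu _ _)).
Qed.

End Identity.

End Correlators.

(** * Ramification points and two-point correlators *)

Section GenericPoints.
Variables (K : fieldType) (K0 : [pchar K] =i pred0).
Variables (L : fieldType) (phi : {rmorphism K -> L}).

Lemma mmap_var n (v : 'I_n -> L) i : mmap phi v ('X_i : {mpoly K[n]}) = v i.
Proof. by rewrite mmapX mmap1U. Qed.

(** Independent elements only satisfy the zero relation, which holds at all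
    points of K: a relation is excluded by one point where it fails. *)
Lemma indep_relation n (v : 'I_n -> L) (P : {mpoly K[n]}) :
  algindep phi v -> mmap phi v P = 0 -> forall w : 'I_n -> K, mmap idfun w P = 0.
Proof.
move=> vi h w; have [->|P0] := eqVneq P 0; first by rewrite mmap0.
by have := vi P P0; rewrite h eqxx.
Qed.

Lemma mmap_var_K n (w : 'I_n -> K) i : mmap idfun w ('X_i : {mpoly K[n]}) = w i.
Proof. by rewrite mmapX mmap1U. Qed.

Variables (s : seq L) (si : indep phi s).

Lemma indep_transc u r : u \in s -> u != phi r.
Proof.
move=> us; have iu : (index u s < size s)%N by rewrite index_mem.
apply/eqP => e; pose i := Ordinal iu.
have h : mmap phi (fun i : 'I_(size s) => s`_i) ('X_i - r%:MP : {mpoly K[_]}) = 0.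
  by rewrite mmapB mmap_var mmapC /= nth_index // e subrr.
have := indep_relation si h (fun=> r + 1).
rewrite mmapB mmap_var_K mmapC /= addrC addKr => /eqP.
by rewrite oner_eq0.
Qed.

Lemma indep_uniq : uniq s.
Proof.
apply/(uniqP 0) => i j; rewrite !inE => hi hj e.
apply/eqP; apply: contraT => ij.
pose i' := Ordinal hi; pose j' := Ordinal hj.
have h : mmap phi (fun i : 'I_(size s) => s`_i) ('X_i' - 'X_j' : {mpoly K[_]}) = 0.
  by rewrite mmapB !mmap_var /= e subrr.
have := indep_relation si h (fun k => (k == i')%:R).
rewrite mmapB !mmap_var_K eqxx -val_eqE /= eq_sym (negPf ij) subr0 => /eqP.
by rewrite oner_eq0.
Qed.

Variables a b c : K.
Hypothesis nondeg : a ^+ 2 + b * c != 0.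

Lemma indep_den u : u \in s -> phi c * u - phi a != 0.
Proof.
move=> us; have [c0|c0] := eqVneq c 0.
  rewrite c0 rmorph0 mul0r sub0r oppr_eq0 fmorph_eq0.
  by apply: contraNneq nondeg => ->; rewrite c0 expr0n mulr0 addr0.
rewrite subr_eq0; apply: contraNneq (indep_transc (a / c) us) => e.
by rewrite fmorph_div -e mulrAC divff ?mul1r // fmorph_eq0.
Qed.

(** No point is the image of another one, or of itself, under the involution:
    the corresponding relation fails at some points of K. *)
Lemma indep_invol u v : u \in s -> v \in s ->
  (phi c * u - phi a) * v - (phi a * u + phi b) != 0.
Proof.
move=> us vs; apply/eqP => e.
have iu : (index u s < size s)%N by rewrite index_mem.
have iv : (index v s < size s)%N by rewrite index_mem.
pose i := Ordinal iu; pose j := Ordinal iv.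
have h : mmap phi (fun i : 'I_(size s) => s`_i)
   ((c%:MP * 'X_i - a%:MP) * 'X_j - (a%:MP * 'X_i + b%:MP) : {mpoly K[_]}) = 0.
  rewrite !(mmapB, mmapD) !rmorphM /= !(mmapB, mmapD) !rmorphM /=.
  by rewrite !mmap_var !mmapC /= !nth_index.
have ev (w : 'I_(size s) -> K) : (c * w i - a) * w j - (a * w i + b) = 0.
  have := indep_relation si h w.
  rewrite !(mmapB, mmapD) !rmorphM /= !(mmapB, mmapD) !rmorphM /=.
  by rewrite !mmap_var_K !mmapC.
have b0 : b = 0.
  by apply: oppr_inj; rewrite oppr0 -(ev (fun=> 0)); ring.
suff a0 : a = 0 by move: nondeg; rewrite a0 b0 expr0n mul0r addr0 eqxx.
have n2 : 2%:R != 0 :> K by apply: (natr_neq0 K0 1).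
(* The relations at the points 1 and -1 of the diagonal differ by 4 a. *)
have e1 := ev (fun=> 1); have e2 := ev (fun=> -1).
have : 2%:R * a = 0.
  have two_a : 2%:R * (2%:R * a) = 0.
    have -> : 2%:R * (2%:R * a) = ((c * -1 - a) * -1 - (a * -1 + b))
                      - ((c * 1 - a) * 1 - (a * 1 + b)) by ring.
    by rewrite e1 e2 subrr.
  by move/eqP: two_a; rewrite mulf_eq0 (negPf n2) => /eqP.
by move/eqP; rewrite mulf_eq0 (negPf n2) => /eqP.
Qed.

Lemma involP_point u : u \in s ->
  involP (phi a) (phi b) (phi c) (Some u) = Some (invol (phi a) (phi b) (phi c) u).
Proof. by move=> us; rewrite /= (negPf (indep_den us)). Qed.

Lemma involP_neq u v : u \in s -> v \in s ->
  involP (phi a) (phi b) (phi c) (Some u) != Some v.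
Proof.
move=> us vs; rewrite involP_point //; apply: contraNneq (indep_invol us vs) => -[<-].
by rewrite /invol mulrC divfK ?subrr // indep_den.
Qed.

End GenericPoints.

Section RegularityAtPlaces.
Variables (K : fieldType) (K0 : [pchar K] =i pred0).
Hypothesis K_closed : forall p : {poly K}, size p != 1 -> exists t, root p t.

Lemma root_descends (L : fieldType) (phi : {rmorphism K -> L}) (n : {poly K}) t :
  n != 0 -> root (map_poly phi n) t -> exists2 r, t = phi r & root n r.
Proof.
have [k] := ubnP (size n); elim: k n => // k ih n; rewrite ltnS => hk n0 rt.
have s1 : size n != 1.
  apply: contraTneq rt => /eqP/size_poly1P[k0 k00 ->].
  by rewrite map_polyC rootC fmorph_eq0.
have [r rr] := K_closed s1; have /factor_theorem[q Eq] := rr.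
have q0 : q != 0 by apply: contraNneq n0 => q0; rewrite Eq q0 mul0r.
move: rt; rewrite Eq rmorphM rootM /= map_polyXsubC root_XsubC.
case/orP=> [rt|/eqP ->]; last by exists r; rewrite // rootM root_XsubC eqxx orbT.
have [|r' Er rr'] := ih q _ q0 rt.
  by rewrite (leq_trans _ hk) // Eq size_Mmonic ?monicXsubC // size_XsubC addn2.
by exists r'; rewrite // rootM rr'.
Qed.

Lemma zero_order_gt0 (f : ratfun K) t : f != 0 -> ~~ reg t f^-1 ->
  (0 < mup t (rnum f))%N.
Proof.
move=> f0; apply: contraR; rewrite -XsubC_dvd; last first.
  by apply: contraNneq f0 => e; rewrite [f]rfracE e tofrac0 mul0r.
rewrite dvdp_XsubCl => nr; rewrite [f]rfracE invf_div.
by apply: reg_at_frac; rewrite map_poly_id.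
Qed.

Lemma ramified_K (x : ratfun K) p : rderiv x != 0 ->
  ~~ unit_diff p (rderiv x) -> ramified x p.
Proof.
move=> Dx; case: p => [t|]; rewrite /ramified /diff_zero_order.
  by rewrite unit_diff_fin; apply: zero_order_gt0.
apply: zero_order_gt0; have D0 := deriv_invX_neq0 K.
exact: (mulf_neq0 (subst_neq0 K0 D0 Dx) D0).
Qed.

(** The zeros of dx are roots of a polynomial over the algebraically closed
    field K, hence have no new instances over an extension. *)
Lemma ramification_descends (L : fieldType) (phi : {rmorphism K -> L})
    (x : ratfun K) p : rderiv x != 0 ->
  ~~ unit_diff p (rderiv (rmap phi x)) ->
  exists2 r : P1 K, p = omap phi r & ramified x r.
Proof.
move=> Dx; rewrite rmap_deriv; case: p => [t|] np; last first.
  exists None => //; apply: ramified_K => //.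
  by apply: contra np => /(unit_diff_rmap phi K0).
have n0 : rnum (rderiv x) != 0.
  by apply: contraNneq Dx => e; rewrite [rderiv x]rfracE e tofrac0 mul0r.
have [|r Er rr] := root_descends (phi := phi) (t := t) n0.
  apply: contraR np => nr; rewrite unit_diff_fin {1}[rderiv x]rfracE rmap_frac.
  by rewrite invf_div; apply: reg_at_frac; rewrite map_poly_id.
exists (Some r); first by rewrite Er.
apply: ramified_K => //; rewrite unit_diff_fin.
have d0 := rden_neq0 (rderiv x).
apply/negP=> rg; have Eu : (rderiv x)^-1 * rderiv x = 1 by rewrite mulVf.
case/reg_atP: rg Eu => n d; rewrite map_poly_id // => dr dn0 -> /eqP.
rewrite {1}[rderiv x]rfracE mulf_div -!tofracM -[1]divr1 -tofrac1.
rewrite eqr_div ?tofrac_eq0 ?mulf_neq0 ?oner_neq0 // -!tofracM tofrac_eq.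
rewrite mulr1 mul1r => /eqP E.
have : root (n * rnum (rderiv x)) r by rewrite rootM rr orbT.
rewrite E rootM rootE (negPf dr) /= => dr0.
have := coprimep_root (rnum_rden_coprime (rderiv x)) rr.
by rewrite -rootE dr0.
Qed.

End RegularityAtPlaces.

Section Correlators.
Variables (K : fieldType) (K0 : [pchar K] =i pred0).
Hypothesis K_closed : forall p : {poly K}, size p != 1 -> exists t, root p t.
Variables (a b c : K) (x : ratfun K) (omega : forall n, mratfun K n).
Hypothesis nondeg : a ^+ 2 + b * c != 0.
Hypothesis x_deriv : rderiv x != 0.
Hypothesis omega_2 : omega 2%N = omega2 a b c.

Section Dipole.
Variables (L : fieldType) (phi : {rmorphism K -> L}) (u : L).
Let L0 : [pchar L] =i pred0 := pchar_hom phi K0.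
Hypothesis ui : indep phi [:: u].
Let nd := nondeg_hom nondeg phi.
Local Notation A := (phi a).
Local Notation B := (phi b).
Local Notation C := (phi c).
Local Notation inv_q := (invol_q A B C).

(** A primitive in q of B(q, u) - B(q, iota u), where iota is the involution. *)
Definition dipole_primitive : ratfun L :=
  - (qminus u)^-1 + rC (dinvol A B C u) / qminus (invol A B C u).

Lemma deriv_inv_qminus v : rderiv (qminus v)^-1 = - (qminus v ^+ 2)^-1 :> ratfun L.
Proof. by rewrite (rderivV (qminus_neq0 v)) deriv_qminus mulN1r. Qed.

Lemma dinvol_rC f : rC (dinvol A B C f) = dinvol (rC A) (rC B) (rC C) (rC f) :> ratfun L.
Proof.
by rewrite /dinvol fmorph_div rmorphN rmorphD !rmorphXn rmorphB !rmorphM.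
Qed.

Lemma invol_rC f : rC (invol A B C f) = invol (rC A) (rC B) (rC C) (rC f) :> ratfun L.
Proof. by rewrite /invol fmorph_div rmorphB rmorphD !rmorphM. Qed.

Lemma dipoleE : correlator omega phi [:: u] = rderiv dipole_primitive.
Proof.
have -> : correlator omega phi [:: u] = at_q ui (omega 2) by [].
have z : at_q ui (mX ord_max) = rC u.
  have -> : ord_max = lift ord0 ord0 :> 'I_2 by apply: val_inj.
  exact: (at_qu ui ord0).
have w : at_q ui (mX ord0) = rX L := at_qz ui.
rewrite omega_2 /omega2 (rmorphB (at_q ui)) (fmorphV (at_q ui)) (rmorphXn (at_q ui)).
rewrite (rmorphB (at_q ui)) w z (rmorphM (at_q ui)) (fmorphV (at_q ui)).
rewrite (rmorphXn (at_q ui)) (rmorphB (at_q ui)) w.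
have -> : at_q ui (invol (mC 2 a) (mC 2 b) (mC 2 c) (mX ord_max))
    = rC (invol A B C u).
  rewrite invol_rC /invol (rmorphM (at_q ui)) (fmorphV (at_q ui)).
  rewrite (rmorphB (at_q ui)) (rmorphD (at_q ui)) !(rmorphM (at_q ui) (mC _ _)).
  by rewrite !at_qC z.
have -> : at_q ui (dinvol (mC 2 a) (mC 2 b) (mC 2 c) (mX ord_max))
    = rC (dinvol A B C u).
  rewrite dinvol_rC /dinvol (rmorphM (at_q ui)) (fmorphV (at_q ui)).
  rewrite (rmorphXn (at_q ui)).
  rewrite (rmorphN (at_q ui)) (rmorphB (at_q ui)) (rmorphD (at_q ui)).
  rewrite (rmorphXn (at_q ui)) !(rmorphM (at_q ui) (mC _ _)).
  by rewrite !at_qC z.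
rewrite -!qminusE /dipole_primitive rderivD raddfN /= rderivCM !deriv_inv_qminus.
by rewrite opprK mulrN.
Qed.

Lemma reg_fun_inv_qminus (p : P1 L) (v : L) : p != Some v -> reg_fun p (qminus v)^-1.
Proof.
case: p => [t tv|_].
  rewrite reg_fun_fin; apply: reg_atV; first exact: reg_qminus.
  by rewrite [rcomp _ _ _]reval_qminus subr_eq0; apply: contraNneq tv => ->.
have D0 := deriv_invX_neq0 L; have X0 := rX_neq0 L.
have l0 : - v * 0 + 1 != 0 by rewrite mulr0 add0r oner_neq0.
rewrite /reg_fun /= (substV L0 D0) qminusE (substB L0 D0) rcompX rcompC.
have -> : ((rX L)^-1 - rC v)^-1 = moebius 1 0 (- v) 1.
  rewrite /moebius /lin rmorph1 rmorph0 rmorphN addr0 mul1r.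
  have := lin_neq0 l0; rewrite /lin rmorph1 rmorphN => h.
  exact: (inv_qminus_infinity_rule X0 h).
exact: reg_moebius.
Qed.

Lemma dipole_regular p : p != Some u -> involP A B C p != Some u ->
  reg_diff p (correlator omega phi [:: u]).
Proof.
have uu : u \in [:: u] by rewrite mem_head.
move=> pu ipu; rewrite dipoleE; apply: (reg_diff_deriv L0).
have pv : p != Some (invol A B C u).
  apply: contraNneq ipu => ->.
  by rewrite -(involP_point ui nondeg uu) (involPK nd).
have r1 := reg_fun_inv_qminus pu; have r2 := reg_fun_inv_qminus pv.
rewrite /dipole_primitive /reg_fun (substD L0 (deriv_chart_neq0 p)).
apply: reg_atD; last exact: (reg_funM L0 (reg_funC _ _) r2).
rewrite -mulN1r -(rmorph1 (@rC L)) -rmorphN.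
exact: (reg_funM L0 (reg_funC _ _) r1).
Qed.

(** B is invariant under the simultaneous action of the involution on both
    arguments: omega_2 is odd in each of them. *)
Lemma dipole_invol : correlator omega phi [:: u] + pullback inv_q (correlator omega phi [:: u]) = 0.
Proof.
have uu : u \in [:: u] by rewrite mem_head.
have Di := deriv_invol_q_neq0 nd.
have h1 := indep_den ui nondeg uu.
have h5 := indep_invol K0 ui nondeg uu.
rewrite dipoleE (pullback_deriv L0 Di).
have -> : rcomp rC dipole_primitive inv_q
   = rC ((C / (C * u - A)) *+ 2) - dipole_primitive.
  rewrite /dipole_primitive -[- (qminus u)^-1]sub0r (substD L0 Di) (substB L0 Di).
  rewrite rcomp0 !sub0r (substM L0 Di) rcompC !(substV L0 Di).
  rewrite !qminusE !(substB L0 Di) !rcompC !rcompX dinvol_rC invol_rC.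
  rewrite rmorphMn fmorph_div rmorphB rmorphM.
  apply: dipole_primitive_rule.
  - by rewrite -rmorphM -rmorphB fmorph_eq0.
  - have [t ht] := invol_q_den_neq0 nd.
    have := lin_neq0 (t := t) (a := C) (b := - A) ht.
    by rewrite /lin rmorphN.
  - by rewrite -rmorphXn -rmorphM -rmorphD fmorph_eq0.
  - by rewrite -qminusE qminus_neq0.
  - have := lin_neq0 (t := u) (a := C * u - A) (b := - (A * u + B)) (h5 _ uu).
    by rewrite /lin rmorphN rmorphB rmorphD !rmorphM.
by rewrite raddfB /= rderivC sub0r addrN.
Qed.

End Dipole.
End Correlators.

(** * Poles over extensions of the field of coefficients *)

Section SplittingCriterion.
Variable F : fieldType.
Implicit Types d p q : {poly F}.

Lemma irreducible_factor d : (1 < size d)%N -> exists2 p, irreducible_poly p & p %| d.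
Proof.
have [n] := ubnP (size d); elim: n d => // n ih d; rewrite ltnS => hn d1.
have [irr|nirr] := boolp.EM (irreducible_poly d); first by exists d.
have [q [q1 qd nqd]] : exists q, [/\ size q != 1, q %| d & ~~ (q %= d)].
  apply: boolp.contrapT => h; apply: nirr; split=> // q q1 qd.
  by apply: boolp.contrapT => /negP nqd; apply: h; exists q.
have d0 : d != 0 by rewrite -size_poly_gt0 (ltn_trans _ d1).
have q0 : q != 0 by apply: contraNneq d0 => q0; move: qd; rewrite q0 dvd0p.
have sq : (size q < size d)%N.
  rewrite ltn_neqAle (dvdp_leq d0 qd) andbT.
  by apply: contra nqd => e; rewrite -(dvdp_size_eqp qd).
have q2 : (1 < size q)%N by rewrite ltn_neqAle eq_sym q1 size_poly_gt0.
have [p irr pq] := ih q (leq_trans sq hn) q2.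
by exists p => //; apply: dvdp_trans pq qd.
Qed.

Lemma root_in_extension d : (1 < size d)%N ->
  exists (M : fieldType) (psi : {rmorphism F -> M}) (t : M), root (map_poly psi d) t.
Proof.
move=> d1; have [p irr pd] := irreducible_factor d1.
have [M _ [z rz _]] := irredp_FAdjoin irr.
exists M, (in_alg M), z; move/dvdpP: pd => [q ->].
by rewrite rmorphM rootM rz orbT.
Qed.

(** Roots are split off one by one, each found in an extension generated by a
    root of an irreducible factor. *)
Lemma dvdp_polesprod (ps : seq F) d : d != 0 ->
  (forall (M : fieldType) (psi : {rmorphism F -> M}) t,
     root (map_poly psi d) t -> exists2 a, a \in ps & t = psi a) ->
  d %| polesprod ps ^+ size d.
Proof.
have [n] := ubnP (size d); elim: n d => // n ih d; rewrite ltnS => hn d0 h.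
have [d1|d1] := leqP (size d) 1.
  apply: dvdp_trans (dvd1p _).
  by rewrite dvdp1 eqn_leq d1 size_poly_gt0.
have [M [psi [t rt]]] := root_in_extension d1.
have [a aps Et] := h M psi t rt.
have : root d a by move: rt; rewrite Et fmorph_root.
case/factor_theorem=> q Eq.
have q0 : q != 0 by apply: contraNneq d0 => e; rewrite Eq e mul0r.
have sd : size d = (size q).+1.
  by rewrite Eq size_Mmonic ?monicXsubC // size_XsubC addn2.
have hq : q %| polesprod ps ^+ size q.
  apply: ih => // [|M' psi' t' rt']; first by rewrite -ltnS -sd.
  by apply: (h M' psi'); rewrite Eq rmorphM rootM rt'.
rewrite sd exprSr {1}Eq; apply: dvdp_mul => //.
by rewrite /polesprod (big_rem a) //= dvdp_mulr.
Qed.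

(** Poles may lie in an extension of F; if all those of f, over all extensions,
    come from [ps], then the denominator of f divides a power of [polesprod ps]. *)
Lemma poles_in_criterion (ps : seq F) (f : ratfun F) :
  (forall (M : fieldType) (psi : {rmorphism F -> M}) t,
     t \notin map psi ps -> reg t (rmap psi f)) -> poles_in ps f.
Proof.
move=> h; rewrite [f]rfracE; apply: poles_in_dvd.
apply: dvdp_polesprod; first exact: rden_neq0.
move=> M psi t rt; have [/mapP[a aps ->]|nt] := boolP (t \in map psi ps).
  by exists a.
exfalso; have /reg_atP[n d dt d0] := h M psi t nt.
rewrite map_poly_id // in dt.
rewrite [f]rfracE rmap_frac => /eqP.
rewrite eqr_div ?tofrac_eq0 ?map_poly_eq0 ?rden_neq0 // -!tofracM tofrac_eq => /eqP E.
have : root (map_poly psi (rnum f) * d) t by rewrite E rootM rt orbT.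
rewrite rootM [root d t]rootE (negPf dt) orbF => rn.
have cop : coprimep (map_poly psi (rden f)) (map_poly psi (rnum f)).
  by rewrite coprimep_map coprimep_sym rnum_rden_coprime.
by have := coprimep_root cop rt; rewrite -rootE rn.
Qed.

End SplittingCriterion.

Lemma finite_roots (K : fieldType) (n : {poly K}) : n != 0 ->
  exists rs : seq K, forall r, root n r -> r \in rs.
Proof.
have [k] := ubnP (size n); elim: k n => // k ih n; rewrite ltnS => hk n0.
have [[r /factor_theorem[q Eq]]|nr] := boolp.EM (exists r, root n r); last first.
  by exists [::] => r rr; case: nr; exists r.
have q0 : q != 0 by apply: contraNneq n0 => e; rewrite Eq e mul0r.
have [|rs hrs] := ih q _ q0.
  by rewrite (leq_trans _ hk) // Eq size_Mmonic ?monicXsubC // size_XsubC addn2.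
exists (r :: rs) => r'; rewrite Eq rootM root_XsubC inE => /orP[/hrs ->|->] //.
by rewrite orbT.
Qed.

(** * Permutations of the variables *)

Lemma indep_of (K L : fieldType) (phi : {rmorphism K -> L}) n (u : 'I_n -> L)
    (s : seq L) (e : n = size s) :
  (forall i : 'I_n, u i = s`_i) -> algindep phi u -> indep phi s.
Proof.
move=> h ui; rewrite /indep; move: u h ui; rewrite e => u h ui.
exact: eq_algindep ui.
Qed.

Section Evaluation.
Variables (K L : fieldType) (phi : {rmorphism K -> L}) (m : nat).

(** Substituting for q an element algebraically independent of the parameters is
    compatible with the specialization of all the variables. *)
Lemma reval_at_q (z : L) (u : 'I_m -> L) f : algindep phi (vcons z u) ->
  reval (mcomp (@rC L \o phi) (vcons (rX L) (fun i => rC (u i))) f) z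
  = mcomp phi (vcons z u) f.
Proof.
move=> vi; have ui : algindep phi u.
  have := algindep_inj (@lift_inj _ ord0) vi; apply: eq_algindep => // i.
  exact: vconsS.
have e : mrat_ev vi \o @shift_vars K m =1 at_u ui.
  move=> g; rewrite (hom_mcomp (mrat_ev vi \o @shift_vars K m)) (hom_mcomp (at_u ui)).
  apply: eq_mcomp => [k|i] /=; first by rewrite shift_varsC at_uC /mrat_ev mcompC.
  by rewrite shift_varsX at_uX /mrat_ev mcompX // vconsS.
have tz : transc (at_u ui) z.
  move=> p p0; have := transc_hom (mrat_ev vi) (@transc_zvar K m) p0.
  rewrite (eq_map_poly e) /= /zvar /mrat_ev mcompX // vcons0; exact.
rewrite -(rmap_at_u ui) (reval_generic tz) -[LHS]/(rat_ev tz _).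
rewrite /as_fun_of_z (rmorph_mcomp (rat_ev tz)); apply: eq_mcomp => [k|i].
  by rewrite /= /rat_ev rcompC at_uC.
rewrite vcons_comp; apply: vcons_ext => [|j]; first exact: rcompX.
by rewrite /= /rat_ev rcompC at_uX.
Qed.
End Evaluation.

Section Symmetry.
Variables (K : fieldType) (n : nat).
Implicit Types (s t : 'S_n) (f : mratfun K n).

Lemma permuted_vars_algindep s : algindep (@mC K n) (fun i => mX (s i)).
Proof. exact: (algindep_inj (@perm_inj _ s) (@algindep_mX K n)). Qed.

Lemma permute_varsM s t f : permute_vars (t * s)%g f = permute_vars s (permute_vars t f).
Proof.
have ps := permuted_vars_algindep s.
rewrite -[RHS]/(mrat_ev ps _) [in RHS]/permute_vars (rmorph_mcomp (mrat_ev ps)).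
apply: eq_mcomp => [k|i] /=; first by rewrite /mrat_ev mcompC.
by rewrite /mrat_ev mcompX // permM.
Qed.

Lemma mcomp_mX f : mcomp (mC n) mX f = f.
Proof. by rewrite [RHS](hom_mcomp idfun); exact: eq_mcomp. Qed.

Lemma permute_vars1 f : permute_vars 1%g f = f.
Proof. by rewrite -[RHS]mcomp_mX; apply: eq_mcomp => // i; rewrite perm1. Qed.
End Symmetry.

(** The transpositions of the first variable with another one generate the
    symmetric group. *)
Lemma permute_vars_transpositions (K : fieldType) m (f : mratfun K m.+1) :
  (forall k : 'I_m, permute_vars (tperm ord0 (lift ord0 k)) f = f) ->
  forall s : 'S_m.+1, permute_vars s f = f.
Proof.
move=> h; have h0 i : permute_vars (tperm ord0 i) f = f.
  by case: (unliftP ord0 i) => [k ->|->]; rewrite ?h // tperm1 permute_vars1.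
have hM s t : permute_vars s f = f -> permute_vars t f = f -> permute_vars (s * t)%g f = f.
  by move=> hs ht; rewrite permute_varsM hs.
have h2 i j : permute_vars (tperm i j) f = f.
  have [->|i0] := eqVneq i ord0; first exact: h0.
  have [->|ij] := eqVneq i j; first by rewrite tperm1 permute_vars1.
  have [->|j0] := eqVneq j ord0; first by rewrite tpermC h0.
  have -> : tperm i j = (tperm ord0 j * (tperm ord0 i * tperm ord0 j))%g.
    have -> : tperm i j = (tperm ord0 i ^ tperm ord0 j)%g.
      by rewrite tpermJ tpermL (tpermD (z := i)) 1?eq_sym // tpermC.
    by rewrite /conjg tpermV.
  exact: (hM _ _ (h0 j) (hM _ _ (h0 i) (h0 j))).
move=> s; have [ts -> _] := prod_tpermP s.
by elim/big_ind: _ => //; rewrite permute_vars1.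
Qed.

(** * Sums over subsets and rational identities *)

Section SeriesIdentities.
Variable F : fieldType.
Implicit Types x y n s e z w : F.

Lemma first_order_rule x n y z : x != 0 -> y != 0 ->
  x * (n * (y / x * z)) / y = n * z.
Proof. by move=> x0 y0; field; rewrite x0 y0. Qed.

Lemma exchange_sign_rule n y s e w : n != 0 ->
  n^-1 * (y * (- (s * e) * (n * w))) = - (y * (s * e * w)).
Proof. by move=> n0; field. Qed.

Lemma quotient_additive_rule x y z w : x * (z + w) / y = x * z / y + x * w / y.
Proof. by rewrite mulrDr mulrDl. Qed.

Lemma quotient_zero_rule x y : x * 0 / y = 0.
Proof. by rewrite mulr0 mul0r. Qed.

Lemma scaled_additive_rule n y e z w :
  n * (y * (e * (z + w))) = n * (y * (e * z)) + n * (y * (e * w)).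
Proof. by rewrite !mulrDr. Qed.

Lemma scaled_zero_rule n y e : n * (y * (e * 0)) = 0.
Proof. by rewrite !mulr0. Qed.
End SeriesIdentities.

Section EnumImage.

Lemma enum_sorted m (A : {set 'I_m}) : sorted (relpre (@nat_of_ord m) ltn) (enum A).
Proof.
rewrite /enum_mem; apply: sorted_filter; first by move=> i j k; apply: ltn_trans.
by rewrite -sorted_map -enumT val_enum_ord iota_ltn_sorted.
Qed.

(** Blocks are listed in increasing order, which is kept by an increasing
    renaming. *)
Lemma enum_imset m n (i : 'I_n -> 'I_m) (T : {set 'I_n}) :
  {homo i : s t / (s < t)%N} -> enum (i @: T) = map i (enum T).
Proof.
move=> hi; have irr : irreflexive (relpre (@nat_of_ord m) ltn).
  by move=> j; rewrite /= ltnn.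
have tr : transitive (relpre (@nat_of_ord m) ltn).
  by move=> j k l; apply: ltn_trans.
apply: (irr_sorted_eq tr irr).
- exact: enum_sorted.
- have hs := @homo_sorted _ _ i (relpre (@nat_of_ord n) ltn) (relpre (@nat_of_ord m) ltn).
  by apply: hs (enum_sorted T) => s t; apply: hi.
- move=> j; rewrite mem_enum; apply/imsetP/mapP => -[t tT ->]; exists t => //.
    by rewrite mem_enum.
  by rewrite -mem_enum.
Qed.
End EnumImage.

Section ContourIdentities.
Variable F : fieldType.
Implicit Types x y z w : F.

Lemma opp_quotient_expand x y z : (- x^-1 + z) * y = - (y / x) + z * y.
Proof. by rewrite mulrDl mulNr [x^-1 * y]mulrC. Qed.

Lemma quotient_eq_opp x y z : y != 0 -> x / y = - z -> x = - (z * y).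
Proof. by move=> y0 h; rewrite -mulNr -h divfK. Qed.

Lemma pulled_product_rule x z t y : (x * z) * t / y = x * (z * t / y).
Proof. by rewrite !mulrA. Qed.

Lemma common_quotient_rule x z t y : y != 0 -> x / y - z / y = t / y -> x - z = t.
Proof. by move=> y0; rewrite -mulrBl => /(divIf y0). Qed.
End ContourIdentities.

(** * Poles of the correlators *)

Lemma exchange_factor_rule (F : fieldType) (x w p y : F) : x != 0 ->
  x * (w / x * p) / y = w / y * p.
Proof. by move=> x0; rewrite mulrA [x * _]mulrC divfK // mulrAC. Qed.

Section Correlators.
Variables (K : fieldType) (K0 : [pchar K] =i pred0).
Hypothesis K_closed : forall p : {poly K}, size p != 1 -> exists t, root p t.
Variables (a b c : K) (x : ratfun K) (omega : forall n, mratfun K n).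
Hypothesis nondeg : a ^+ 2 + b * c != 0.
Hypothesis x_deriv : rderiv x != 0.
Hypothesis invol_ram : forall p : P1 K, ramified x p -> ~~ ramified x (involP a b c p).
Hypothesis omega_2 : omega 2%N = omega2 a b c.
Hypothesis omega_identity : forall m : nat, (2 <= m)%N ->
  involution_identity a b c x omega m.
Hypothesis omega_poles : forall m : nat, (2 <= m)%N -> poles_from_rhs a b c x omega m.
Hypothesis omega_holo_u : forall m : nat, (2 <= m)%N -> holomorphic_at_u omega m.
Hypothesis omega_holo_ram : forall m : nat, (2 <= m)%N ->
  holomorphic_at_invol_ram a b c x omega m.

Section Regularity.
Variables (L : fieldType) (phi : {rmorphism K -> L}).
Let L0 : [pchar L] =i pred0 := pchar_hom phi K0.
Let nd := nondeg_hom nondeg phi.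
Local Notation inv_p := (involP (phi a) (phi b) (phi c)).
Local Notation inv_q := (invol_q (phi a) (phi b) (phi c)).
Local Notation xd := (rderiv (rmap phi x)).
Local Notation y := (rmap phi (yfun a b c x)).
Local Notation correlator := (correlator omega phi).

Lemma subseq_of_indep (s : seq L) (J : {set 'I_(size s)}) :
  indep phi s -> indep phi (subseq_of J).
Proof.
move=> si; rewrite /indep.
have e : size (subseq_of J) = #|J| by rewrite size_map -cardE.
apply: (@eq_algindep _ _ _ phi phi
  (fun i : 'I_(size (subseq_of J)) => s`_(enum_val (cast_ord e i)))) => // [i|].
  rewrite /subseq_of (nth_map (enum_val (cast_ord e i))); last by rewrite -cardE -e ltn_ord.
  by rewrite {1}(enum_val_nth (enum_val (cast_ord e i)) (cast_ord e i)).
apply: (algindep_inj (si := fun i => enum_val (cast_ord e i))) si.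
by move=> i j /enum_val_inj/cast_ord_inj.
Qed.

Lemma mem_subseq_of (s : seq L) (J : {set 'I_(size s)}) u :
  u \in subseq_of J -> u \in s.
Proof. by case/mapP=> i _ ->; rewrite mem_nth. Qed.

Lemma size_subseq_of (s : seq L) (J : {set 'I_(size s)}) : size (subseq_of J) = #|J|.
Proof. by rewrite size_map -cardE. Qed.

Lemma partition_size m (k : nat) (P : {ffun 'I_k -> {set 'I_m}}) j :
  (2 <= k)%N -> ordered_partition P -> (0 < #|P j| < m)%N.
Proof.
move=> k2 /and3P[/forallP ne /forallP dis _].
rewrite card_gt0 ne /=.
have [i ij] : exists i, i != j.
  case: k k2 {ne dis} P j => [//|[//|k]] _ P j.
  have [->|j0] := eqVneq j ord0; first by exists ord_max.
  by exists ord0; rewrite eq_sym.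
have /forallP/(_ j) := dis i; rewrite ij /= -setI_eq0 => /eqP d0.
have /set0Pn[v vi] := ne i.
rewrite -[m in (_ < m)%N]card_ord -cardsT; apply: proper_card.
apply/properP; split; first exact: subsetT.
exists v; first by rewrite inE.
by apply/negP=> vj; have := in_set0 v; rewrite -d0 inE vi vj.
Qed.

(** Where dx and dy do not vanish, d/dy and division by dx preserve
    regularity. *)
Lemma exchange_term_regular (s : seq L) (k : nat)
    (P : {ffun 'I_k -> {set 'I_(size s)}}) p : (2 <= k)%N ->
  unit_diff p xd -> unit_diff (inv_p p) xd ->
  (forall j, reg_diff p (correlator (subseq_of (P j)))) ->
  reg_diff p (exchange_term a b c x omega phi P).
Proof.
move=> k2 ux uix rP.
have uy : unit_diff p (rderiv y).
  rewrite (deriv_y K0 x nondeg phi); apply: (unit_diffN L0).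
  exact: (unit_diff_invol L0 nd uix).
have x0 := deriv_x_neq0 x_deriv phi; have y0 := deriv_y_neq0 K0 nondeg x_deriv phi.
case: k k2 P rP => [//|[//|k]] _ P rP; rewrite /exchange_term.
set G := _ / rderiv y.
have rG : reg_fun p G.
  rewrite /G big_ord_recl (exchange_factor_rule _ _ _ x0).
  apply: (reg_funM L0); first exact: (reg_fun_div L0).
  by apply: (reg_fun_prod L0) => j _; apply: (reg_fun_div L0).
have ri : reg_fun p (iter k (dby y) G).
  elim: (k) => [|j ih] //=; rewrite /dby; apply: (reg_fun_div L0) => //.
  exact: (reg_diff_deriv L0).
apply: (reg_fun_diffM L0); first exact: reg_funC.
rewrite [rderiv y * _]mulrCA; apply: (reg_fun_diffM L0); first exact: reg_funC.
rewrite [k.+2.-1]/= iterS {1}/dby mulrC divfK //.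
exact: (reg_diff_deriv L0).
Qed.

(** By induction on the number of points: outside of the diagonal, the zeros of
    dx and those of dy, the right-hand side of the involution identity is regular by
    induction, hence also the correlator; on the diagonal, and at the zeros of dy,
    which are the images of those of dx, regularity is one of the
    properties that define the correlators. *)
Lemma correlator_regular (s : seq L) p : indep phi s -> (0 < size s)%N ->
  unit_diff p xd -> (forall u, u \in s -> inv_p p != Some u) ->
  (size s = 1 -> forall u, u \in s -> p != Some u) -> reg_diff p (correlator s).
Proof.
move=> si s0 ux; have [k hk] := ubnP (size s); elim: k s hk si s0 => // k ih s.
rewrite ltnS => hk si s0 ips p1.
have [s2|s1] := ltnP 1 (size s); last first.
  case: s s0 s1 si ips p1 {hk} => [//|u [|//]] _ _ si ips p1.
  by apply: (dipole_regular K0 nondeg omega_2 si);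
    [apply: p1; rewrite ?mem_head | apply: ips; rewrite mem_head].
have e0 : rmap (at_u si) (as_fun_of_z (omega (size s).+1)) = correlator s := rmap_at_u si _.
have [/hasP[u us /eqP pu]|nps] := boolP (has (fun u => p == Some u) s).
  have iu : (index u s < size s)%N by rewrite index_mem.
  have := omega_holo_u s2 (Ordinal iu); rewrite diff_poleE negbK.
  move/(reg_diff_rmap (at_u si) (pchar_hom (@mC K _) K0)); rewrite e0 /=.
  by rewrite at_uX /= nth_index // -pu.
have [uix|nuix] := boolP (unit_diff (inv_p p) xd); last first.
  have [r Er rr] := ramification_descends K0 K_closed x_deriv nuix.
  have := omega_holo_ram s2 rr; rewrite diff_poleE negbK.
  move/(reg_diff_rmap (at_u si) (pchar_hom (@mC K _) K0)); rewrite e0 /=.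
  suff -> : omap (at_u si) (omap (@mC K (size s)) (involP a b c r)) = p by [].
  rewrite -[p](involPK nd) Er.
  have -> q : omap (at_u si) (omap (@mC K (size s)) q) = omap phi q.
    by case: q => [t|] //=; rewrite at_uC.
  exact: omap_involP.
apply: contraT => np.
have e1 : rmap (at_u si) (as_fun_of_z (identity_rhs a b c x omega (size s)))
    = at_q si (identity_rhs a b c x omega (size s)) := rmap_at_u si _.
have : diff_pole (correlator s) p ->
    diff_pole (at_q si (identity_rhs a b c x omega (size s))) p.
  by rewrite -e0 -e1; apply: omega_poles.
rewrite (diff_poleE p (correlator s)) np => /(_ isT).
rewrite (diff_poleE p (at_q si _)) => /negP h; exfalso; apply: h.
rewrite (at_q_rhs K0 omega nondeg x_deriv) big_nat_cond.
apply: (reg_diff_sum L0) => j; rewrite andbT => /andP[j2 _].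
apply: (reg_diff_sum L0) => P oP; apply: exchange_term_regular => // i.
have /andP[Pi0 Pim] := partition_size i j2 oP.
apply: ih.
- by rewrite size_subseq_of (leq_trans Pim).
- exact: subseq_of_indep.
- by rewrite size_subseq_of.
- by move=> u /mem_subseq_of; apply: ips.
- move=> _ u /mem_subseq_of us; apply: contraNneq nps => pu.
  by apply/hasP; exists u; rewrite // pu.
Qed.

End Regularity.

Section GoodPlaces.
Variables (L : fieldType) (phi : {rmorphism K -> L}).
Let L0 : [pchar L] =i pred0 := pchar_hom phi K0.
Let nd := nondeg_hom nondeg phi.
Local Notation inv_p := (involP (phi a) (phi b) (phi c)).
Local Notation inv_t := (invol (phi a) (phi b) (phi c)).
Local Notation xd := (rderiv (rmap phi x)).
Local Notation correlator := (correlator omega).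

Section Extend.
Variables (M : fieldType) (psi : {rmorphism L -> M}) (s : seq L).

Lemma indep_map : indep phi s -> indep (psi \o phi) (map psi s).
Proof.
move=> /(algindep_hom psi); have e : size s = size (map psi s) by rewrite size_map.
by apply: (indep_of e) => i; rewrite (nth_map 0).
Qed.

Lemma rmap_correlator : rmap psi (correlator phi s) = correlator (psi \o phi) (map psi s).
Proof.
have e : size s = size (map psi s) by rewrite size_map.
rewrite -(@correlatorE K omega M (psi \o phi) _ (fun i => psi s`_i) _ e) => [|i]; last first.
  by rewrite (nth_map 0).
rewrite /correlator (rmorph_mcomp (rmap psi)); apply: eq_mcomp => [k|i].
  by rewrite /= rmapC.
rewrite vcons_comp; apply: vcons_ext => [|j]; first exact: rmapX.
by rewrite /= rmapC.
Qed.
End Extend.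

Lemma correlator_poles (rs : seq K) (ps s : seq L) :
  (forall r, root (rnum (rderiv x)) r -> r \in rs) ->
  indep phi s -> (0 < size s)%N -> {subset map phi rs <= ps} ->
  {subset s <= ps} -> (forall u, u \in s -> inv_t u \in ps) ->
  poles_in ps (correlator phi s).
Proof.
move=> hrs si s0 rps sps ips; apply: poles_in_criterion => M psi t tn.
rewrite rmap_correlator -reg_diff_fin.
apply: correlator_regular.
- exact: indep_map.
- by rewrite size_map.
- apply: contraT => nu.
  have [[r|//] [Er] rr] := ramification_descends K0 K_closed x_deriv nu.
  case/negP: tn; rewrite Er; apply/map_f/rps/map_f/hrs; move: rr.
  rewrite /ramified /= -XsubC_dvd ?dvdp_XsubCl //.
  by apply: contraNneq x_deriv => e; rewrite [rderiv x]rfracE e tofrac0 mul0r.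
- move=> _ /mapP[u us ->]; apply: contraNneq tn => e.
  have e' : Some t = omap psi (inv_p (Some u)).
    by rewrite omap_involP /= -[Some t](involPK (nondeg_hom nondeg (psi \o phi))) e.
  by move: e'; rewrite (involP_point si nondeg us) => -[->]; apply/map_f/ips.
- by move=> _ _ /mapP[u us ->]; apply: contraNneq tn => -[->]; apply/map_f/sps.
Qed.

Variables (I : finType) (w : I -> L).
Hypothesis wi : forall s : seq I, uniq s -> indep phi (map w s).

(** Places where the only poles of the correlators between the points [w] are
    those of two-point correlators on the diagonal. *)
Definition good_place p := unit_diff p xd && [forall i, inv_p p != Some (w i)].

Let pair_indep i j : i != j -> indep phi [:: w i; w j].
Proof. by move=> ij; apply: (wi (s := [:: i; j])); rewrite /= inE ij. Qed.
Let single_indep i : indep phi [:: w i].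
Proof. exact: (wi (s := [:: i])). Qed.

Lemma point_neq i j : i != j -> w i != w j.
Proof. by move=> ij; have := indep_uniq (pair_indep ij); rewrite /= inE andbT. Qed.

Lemma invol_point_neq i j : inv_p (Some (w i)) != Some (w j).
Proof.
have [<-|ij] := eqVneq i j.
  by apply: (involP_neq K0 (@single_indep i) nondeg); rewrite mem_head.
by apply: (involP_neq K0 (pair_indep ij) nondeg); rewrite !inE eqxx ?orbT.
Qed.

Lemma invol_point_fin i : inv_p (Some (w i)) = Some (inv_t (w i)).
Proof. by apply: (involP_point (@single_indep i) nondeg); rewrite mem_head. Qed.

Lemma point_unit i : unit_diff (Some (w i)) xd.
Proof.
apply: contraT => nu.
have [[r|//] [Er] _] := ramification_descends K0 K_closed x_deriv nu.
have := indep_transc (@single_indep i) r (mem_head _ _).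
by rewrite Er eqxx.
Qed.

Lemma good_point i : good_place (Some (w i)).
Proof.
rewrite /good_place point_unit; apply/forallP=> j; exact: invol_point_neq.
Qed.

(** The bad places are the zeros of dx, whose images under the involution are
    not zeros of dx, and the images of the points [w]. *)
Lemma good_place_dichotomy p : good_place p || good_place (inv_p p).
Proof.
have [up|nup] := boolP (unit_diff p xd); last first.
  have [r Er rr] := ramification_descends K0 K_closed x_deriv nup.
  apply/orP; right; rewrite /good_place; apply/andP; split.
    apply: contraT => nip.
    have [r' Er' rr'] := ramification_descends K0 K_closed x_deriv nip.
    move: Er'; rewrite Er -omap_involP => /(inj_omap (fmorph_inj phi)) e.
    by have := invol_ram rr; rewrite e rr'.
  rewrite (involPK nd) Er; apply/forallP=> i; case: (r) => [r'|] //=.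
  by apply/eqP=> -[e]; have := indep_transc (@single_indep i) r' (mem_head _ _);
     rewrite e eqxx.
case: (pickP (fun i => inv_p p == Some (w i))) => [i /eqP ->|np].
  by rewrite good_point orbT.
by rewrite {1}/good_place up /=; apply/orP; left; apply/forallP=> i; rewrite np.
Qed.

Lemma good_place_regular (s : seq I) p : uniq s -> (0 < size s)%N ->
  (size s = 1 -> forall i, i \in s -> p != Some (w i)) ->
  good_place p -> reg_diff p (correlator phi (map w s)).
Proof.
move=> us s0 s1 /andP[up /forallP ip].
apply: correlator_regular => //.
- exact: wi.
- by rewrite size_map.
- by move=> _ /mapP[i _ ->].
- by rewrite size_map => h _ /mapP[i si ->]; apply: s1.
Qed.

End GoodPlaces.

(** * Generating series of the correlators *)

Section SeriesIdentity.
Variables (L : fieldType) (phi : {rmorphism K -> L}).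
Let L0 : [pchar L] =i pred0 := pchar_hom phi K0.
Local Notation inv_q := (invol_q (phi a) (phi b) (phi c)).
Local Notation xd := (rderiv (rmap phi x)).
Local Notation y := (rmap phi (yfun a b c x)).
Local Notation yd := (rderiv y).
Local Notation correlator := (correlator omega phi).

Variables (m : nat) (v : 'I_m -> L) (k : 'I_m).
Hypothesis vi : forall s : seq 'I_m, uniq s -> indep phi (map v s).
Local Notation ser := (mlseries 'I_m (ratfun L)).
Implicit Types (S T J : {set 'I_m}).

Definition points S : seq L := [seq v j | j <- enum S].

(** The generating series of the omega(q, T)/dx, T not containing [k]: at fixed x,
    it displaces the coordinate y of the curve. *)
Definition displacement : ser :=
  [ffun T : {set 'I_m} => if (T == set0) || (k \in T) then 0 else correlator (points T) / xd].

Definition variation : ser :=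
  [ffun T : {set 'I_m} => if k \in T then 0 else correlator (points (k |: T)) / yd].

Definition inv_fact (n : nat) : ratfun L := rC (n`!%:R^-1).

Local Notation pushed := (transposed_shift (ser_deriv (dby y))
  (fun n => ser_const 'I_m (inv_fact n))
  displacement m.+1).

Lemma points_indep S : indep phi (points S).
Proof. by apply: vi; apply: enum_uniq. Qed.

Lemma size_points S : size (points S) = #|S|.
Proof. by rewrite size_map -cardE. Qed.

Let total : ser := displacement + ser_mono _ [set k] * (ser_const _ (yd / xd) * variation).

Let total0 : total set0 = 0.
Proof.
rewrite ser_addE ser_monoM ffunE eqxx /= add0r ifN //.
by rewrite subset0; apply/set0Pn; exists k; rewrite inE.
Qed.

Let totalE T : T != set0 -> total T = correlator (points T) / xd.
Proof.
have yd0 := deriv_y_neq0 K0 nondeg x_deriv phi.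
move=> /negPf T0; rewrite ser_addE ser_monoM ffunE T0 sub1set /=.
case: ifP => kT; last by rewrite addr0.
rewrite add0r ser_constM ffunE setD11 setD1K // mulrC mulrA.
by congr (_ / _); rewrite divfK.
Qed.

Lemma displacement_free : free_of k displacement.
Proof. by move=> T kT; rewrite ffunE kT orbT. Qed.

Let displacement0 : displacement set0 = 0.
Proof. by rewrite ffunE eqxx. Qed.

Section AtJ.
Variable J : {set 'I_m}.
Hypothesis kJ : k \notin J.
Local Notation s := (points (k |: J)).

Let lt_enum (t : 'I_(size s)) : (t < size (enum (k |: J)))%N.
Proof. exact: leq_trans (ltn_ord t) (eq_leq (size_map _ _)). Qed.

Let i (t : 'I_(size s)) : 'I_m := nth k (enum (k |: J)) t.

Let i_homo : {homo i : t u / (t < u)%N}.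
Proof.
move=> t u tu; have tr : transitive (relpre (@nat_of_ord m) ltn).
  by move=> j j' l; apply: ltn_trans.
exact: (sorted_ltn_nth tr k (enum_sorted (k |: J)) t u (@lt_enum t) (@lt_enum u) tu).
Qed.

Let i_inj : injective i.
Proof.
move=> t u e; apply/val_inj/eqP.
by rewrite -(nth_uniq k (@lt_enum t) (@lt_enum u) (enum_uniq _)) -/(i t) -/(i u) e.
Qed.

Let i_setT : i @: [set: 'I_(size s)] = k |: J.
Proof.
apply/setP=> j; apply/imsetP/idP => [[t _ ->]|jS].
  by rewrite -mem_enum mem_nth.
have h : (index j (enum (k |: J)) < size s)%N.
  by rewrite size_map index_mem mem_enum.
by exists (Ordinal h); rewrite // /i /= nth_index // mem_enum.
Qed.

Let subseq_points (T : {set 'I_(size s)}) : subseq_of T = points (i @: T).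
Proof.
rewrite /points (enum_imset T i_homo) -map_comp /subseq_of.
by apply: eq_map => t /=; rewrite (nth_map k).
Qed.

Lemma partition_sum (n : nat) :
  \sum_(P : {ffun 'I_n -> {set 'I_(size s)}} | ordered_partition P)
     \prod_(j < n) (correlator (subseq_of (P j)) / xd)
  = (total ^+ n) (k |: J).
Proof.
have <- : (ser_restrict i total ^+ n) [set: 'I_(size s)] = (total ^+ n) (k |: J).
  by rewrite (ser_restrictX i_inj) ffunE i_setT.
rewrite ser_exp_partition; last by rewrite ffunE imset0 total0.
apply: eq_bigr => P /andP[/forallP ne _]; apply: eq_bigr => j _.
rewrite ffunE subseq_points totalE //.
by rewrite imset_eq0.
Qed.

(** In the power of order n + 2 of the generating series of all the correlators,
    the part linear in the parameter [k] has n + 1 factors [displacement] and one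
    [variation]; its coefficient n + 2 cancels the 1/s of the identity. *)
Lemma exchange_sum (n : nat) :
  \sum_(P : {ffun 'I_n.+2 -> {set 'I_(size s)}} | ordered_partition P)
     exchange_term a b c x omega phi P
  = - (yd * ((-1) ^+ n.+1 * inv_fact n.+1
            * iter n.+1 (dby y) ((displacement ^+ n.+1 * variation) J))).
Proof.
have xd0 := deriv_x_neq0 x_deriv phi.
have yd0 := deriv_y_neq0 K0 nondeg x_deriv phi.
pose G (w : ratfun L) := rC n.+2%:R^-1 * (yd * (rC ((-1) ^+ n.+2 / (n.+1)`!%:R) *
    iter n.+1 (dby y) (xd * w / yd))).
have GD w w' : G (w + w') = G w + G w'.
  by rewrite /G (quotient_additive_rule xd yd w w') iter_dbyD; exact: scaled_additive_rule.
have G0 : G 0 = 0 by rewrite /G (quotient_zero_rule xd yd) iter_dby0; exact: scaled_zero_rule.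
transitivity (G ((total ^+ n.+2) (k |: J))).
  rewrite -partition_sum (big_morph G GD G0).
  by apply: eq_bigr => P _.
rewrite /total (ser_exp_first_order _ _ displacement_free kJ).
rewrite (mulrCA (displacement ^+ n.+1)) ser_constM /G.
rewrite (first_order_rule _ _ xd0 yd0) -(rmorph_nat (@rC L)) iter_dbyCM fmorphV.
have -> : rC ((-1) ^+ n.+2 / (n.+1)`!%:R) = - ((-1) ^+ n.+1 * inv_fact n.+1).
  by rewrite /inv_fact exprS mulN1r mulNr rmorphN rmorphM rmorphXn rmorphN rmorph1.
apply: exchange_sign_rule; rewrite (rmorph_nat (@rC L)).
exact: ratfun_natr_neq0.
Qed.

Let term (n : nat) : ratfun L :=
  (-1) ^+ n * inv_fact n * iter n (dby y) ((displacement ^+ n * variation) J).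

Let term0 : term 0 = variation J.
Proof.
by rewrite /term /inv_fact fact0 invr1 rmorph1 /= !expr0 !mul1r.
Qed.

Let term_vanish (n : nat) : (#|J| < n)%N -> term n = 0.
Proof.
move=> hn; rewrite /term ser_mulE big1 ?iter_dby0 ?mulr0 // => A sA.
by rewrite ser_exp_vanish ?displacement0 ?mul0r // (leq_ltn_trans (subset_leq_card sA)).
Qed.

(** The involution identity for all subsets of the arguments at once: on the
    correlators having v_k among their arguments, the involution acts up to sign
    as the inverse of the shift of y by [displacement]. *)
Lemma variation_invol : pullback inv_q (correlator (points (k |: J))) / yd = - pushed variation J.
Proof.
have yd0 := deriv_y_neq0 K0 nondeg x_deriv phi.
rewrite transposed_shift_coef -(big_mkord xpredT term).
have hJ : (#|J| < m.+1)%N by rewrite ltnS -[X in (_ <= X)%N]card_ord max_card.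
rewrite (big_cat_nat (n := #|J|.+1)) //= [X in _ + X]big_nat_cond.
rewrite [X in _ + X]big1 ?addr0; last first.
  by move=> n /andP[/andP[hn _] _]; apply: term_vanish.
rewrite big_nat_recl // term0 ffunE (negPf kJ).
suff -> : pullback inv_q (correlator s)
    = - correlator s - yd * \sum_(0 <= n < #|J|) term n.+1.
  by rewrite mulrBl mulNr opprD; congr (_ - _); rewrite mulrC mulKf.
have sz : size s = #|J|.+1 by rewrite size_points cardsU1 kJ.
have [J0|J0] := posnP #|J|.
  rewrite J0 big_geq // mulr0 subr0.
  have s1 : s = [:: v k].
    have -> : J = set0 by apply/eqP; rewrite -cards_eq0 J0.
    by rewrite /points setU0 enum_set1.
  have si : indep phi [:: v k] by apply: (vi (s := [:: k])).
  by apply/eqP; rewrite s1 -addr_eq0 addrC (dipole_invol K0 nondeg omega_2 si).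
have s2 : (2 <= size s)%N by rewrite sz.
have := correlator_identity K0 nondeg x_deriv (@points_indep (k |: J)) omega_identity s2.
move/(canRL (addKr _)) => ->; congr (_ + _).
rewrite !big_add1 /= mulr_sumr -sumrN.
rewrite [X in \sum_(0 <= _ < X) _](_ : _ = #|J|); last by rewrite sz.
by apply: eq_big_nat => n _; rewrite exchange_sum /term.
Qed.
End AtJ.

End SeriesIdentity.
(** * Exchange of two arguments *)

Section Contour.
Variables (L : fieldType) (phi : {rmorphism K -> L}).
Let L0 : [pchar L] =i pred0 := pchar_hom phi K0.
Let nd := nondeg_hom nondeg phi.
Local Notation inv_q := (invol_q (phi a) (phi b) (phi c)).
Local Notation inv_p := (involP (phi a) (phi b) (phi c)).
Local Notation inv_t := (invol (phi a) (phi b) (phi c)).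
Local Notation xd := (rderiv (rmap phi x)).
Local Notation y := (rmap phi (yfun a b c x)).
Local Notation yd := (rderiv y).
Local Notation correlator := (correlator omega phi).
Let Di : rderiv inv_q != 0 := deriv_invol_q_neq0 nd.
Let yd0 : yd != 0 := deriv_y_neq0 K0 nondeg x_deriv phi.

(** A two-point correlator has a double pole at its second argument: it acts by
    residues as a derivation. *)
Lemma dipole_residue u g : indep phi [:: u] -> reg u g ->
  residue (correlator [:: u] * g) u = reval (rderiv g) u.
Proof.
move=> ui rg; have uu : u \in [:: u] by rewrite mem_head.
rewrite (dipoleE omega_2 ui); set p := dipole_primitive _ _ _ _ _.
have -> : rderiv p * g = rderiv (p * g) - p * rderiv g by rewrite rderivM addrK.
rewrite (residueB L0) (residue_deriv L0) sub0r.
have rDg : reg u (rderiv g) by exact: reg_deriv.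
rewrite /p /dipole_primitive opp_quotient_expand (residueD L0) (residueN L0).
rewrite (residue_simple L0 rDg) (residue_reg L0) ?addr0 ?opprK //.
apply: reg_atM rDg; apply: reg_atM; first exact: reg_atC.
rewrite -reg_fun_fin; apply: (reg_fun_inv_qminus K0 phi).
by rewrite -(involP_point ui nondeg uu) eq_sym (involP_neq K0 ui nondeg uu uu).
Qed.

Section Points.
Variables (m : nat) (w : 'I_m.+1 -> L).
Hypothesis wi : forall s : seq 'I_m.+1, uniq s -> indep phi (map w s).
Variable k : 'I_m.
Implicit Types (S T J : {set 'I_m}) (e : 'I_m -> 'I_m.+1).
Local Notation good := (good_place phi w).

Section Selection.
Variable e : 'I_m -> 'I_m.+1.
Hypothesis e_inj : injective e.
Local Notation v := (w \o e).
Local Notation block J := (correlator (points v (k |: J))).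

Lemma selection_indep (s : seq 'I_m) : uniq s -> indep phi (map v s).
Proof. by move=> us; rewrite map_comp; apply: wi; rewrite map_inj_uniq. Qed.

Lemma block_regular J p : (J = set0 -> p != Some (v k)) -> k \notin J -> good p ->
  reg_diff p (block J).
Proof.
move=> pk kJ gp.
have -> : points v (k |: J) = map w (map e (enum (k |: J))) by rewrite -map_comp.
have sz : size (map e (enum (k |: J))) = #|J|.+1 by rewrite size_map -cardE cardsU1 kJ.
have ue : uniq (map e (enum (k |: J))) by rewrite map_inj_uniq // enum_uniq.
have se : (0 < size (map e (enum (k |: J))))%N by rewrite sz.
have h := good_place_regular wi ue se.
apply: (h p _ gp); rewrite sz => -[/eqP]; rewrite cards_eq0 => /eqP J0 i.
by rewrite J0 setU0 enum_set1 inE => /eqP ->; apply: pk.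
Qed.

Local Notation pushed := (transposed_shift (ser_deriv (dby y))
  (fun n => ser_const 'I_m (inv_fact L n)) (displacement phi v k) m.+1).
Local Notation var := (variation phi v k).

Lemma ser_inv_factS n : n.+1%:R * ser_const 'I_m (inv_fact L n.+1) = ser_const 'I_m (inv_fact L n).
Proof.
rewrite -ser_constMn; congr ser_const; rewrite /inv_fact -(rmorph_nat (@rC L)).
apply: (etrans (esym (rmorphM (@rC L) _ _))); apply: congr1.
by rewrite factS natrM invfM mulVKf // natr_neq0.
Qed.

Lemma ser_deriv_inv_fact n : ser_deriv (dby y) (ser_const 'I_m (inv_fact L n)) = 0.
Proof. by apply: ser_deriv_const; rewrite /inv_fact /= dbyC. Qed.

Lemma ser_inv_fact0 : ser_const 'I_m (inv_fact L 0) = 1.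
Proof. by rewrite /inv_fact fact0 invr1 rmorph1 ser_const1. Qed.

Lemma displacement_nilp : displacement phi v k ^+ m.+1 = 0.
Proof.
have := @ser_exp_nilpotent 'I_m _ (displacement phi v k).
by rewrite card_ord; apply; rewrite ffunE eqxx.
Qed.

Lemma displacement_inj f : pushed f = 0 -> f = 0.
Proof.
apply: (transposed_shift_ser_inj (D := dby y) (e := inv_fact L)); last by rewrite ffunE eqxx.
by rewrite /inv_fact fact0 invr1 rmorph1.
Qed.

(** A differential is cohomologous to its image under a shift. *)
Lemma block_invol_exact J : k \notin J ->
  exists g, pullback inv_q (block J) = - block J - rderiv g.
Proof.
move=> kJ; have [g Eg] := transposed_shift_exact (ser_derivM (dbyM y))
  ser_inv_fact0 ser_inv_factS ser_deriv_inv_fact displacement_nilp displacement_inj var.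
exists (g J).
have := variation_invol selection_indep kJ.
move: Eg => /(congr1 (fun h : mlseries 'I_m (ratfun L) => h J)).
rewrite ser_addE ser_oppE => /(canRL (subrK _)) ->.
rewrite !ffunE (negPf kJ) /dby -mulrDl.
move/(quotient_eq_opp yd0) => ->; rewrite divfK //.
by rewrite opprD addrC.
Qed.

Section Primitive.
Variable J : {set 'I_m}.
Hypothesis kJ : k \notin J.

(** The residues at p and at its image add up to zero by [block_invol_exact],
    and at one of these two places the correlator is regular. *)
Lemma block_residue_free t : residue (block J) t = 0.
Proof.
have [J0|J0] := eqVneq J set0.
  have -> : block J = correlator [:: v k] by rewrite /points J0 setU0 enum_set1.
  have ui : indep phi [:: v k] by exact: (selection_indep (s := [:: k])).
  by rewrite (dipoleE omega_2 ui) (residue_deriv L0).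
rewrite -Res_fin; have reg_good p : good p -> Res p (block J) = 0.
  move=> gp; apply: (Res_reg L0); apply: block_regular => // J0'.
  by rewrite J0' eqxx in J0.
have := good_place_dichotomy wi (Some t).
case/orP=> [gt|gi]; first exact: (reg_good _ gt).
have [g Eg] := block_invol_exact kJ.
have := Res_invol L0 nd (Some t) (block J).
rewrite Eg (ResB L0) (ResN L0) (Res_deriv L0) subr0 (reg_good _ gi) => /eqP.
by rewrite oppr_eq0 => /eqP.
Qed.

Lemma block_primitive (ps : seq L) : uniq ps -> poles_in ps (block J) ->
  exists2 f, poles_in ps f & block J = rderiv f.
Proof.
move=> ups pb; have [f pf Ef] := partial_fractions L0 ups pb.
exists f => //; rewrite [LHS]Ef big1 ?addr0 // => t _.
by rewrite block_residue_free rmorph0 mul0r.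
Qed.
End Primitive.

(** The primitives of the correlators satisfy the hypothesis of
    [exchanged_product_exact], their images under the involution being primitives
    of the images of the correlators. *)
Lemma primitive_exchanged (alpha : {set 'I_m} -> ratfun L) :
  (forall J, k \notin J -> block J = rderiv (alpha J)) ->
  let A : mlseries 'I_m (ratfun L) := [ffun J : {set 'I_m} => if k \in J then 0 else alpha J] in
  let A' : mlseries 'I_m (ratfun L) :=
    [ffun J : {set 'I_m} => if k \in J then 0 else rcomp rC (alpha J) inv_q] in
  ser_deriv (dby y) A' = - pushed (ser_deriv (dby y) A).
Proof.
move=> hA A A'; have -> : ser_deriv (dby y) A = var.
  apply/ffunP=> J; rewrite !ffunE; case: ifP => kJ; first by rewrite raddf0.
  by rewrite hA ?kJ.
apply/ffunP=> J; rewrite ser_oppE; have [kJ|kJ] := boolP (k \in J).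
  rewrite !ffunE kJ raddf0 transposed_shift_coef big1 ?oppr0 // => n _.
  have fv : free_of k var by move=> T kT; rewrite ffunE kT.
  have := free_ofM (free_ofX n (@displacement_free L phi m v k)) fv.
  by move=> -> //; rewrite iter_dby0 mulr0.
have := variation_invol selection_indep kJ.
move=> <-; rewrite !ffunE (negPf kJ) hA // /dby.
by rewrite (pullback_deriv L0 Di).
Qed.

End Selection.

Section Exchange.
Variables e1 e2 : 'I_m -> 'I_m.+1.
Hypothesis e1_inj : injective e1.
Hypothesis e2_inj : injective e2.
Hypothesis e12 : forall j, j != k -> e1 j = e2 j.
Variables alpha beta : {set 'I_m} -> ratfun L.
Local Notation block e J := (correlator (points (w \o e) (k |: J))).
Hypothesis alphaE : forall J, k \notin J -> block e1 J = rderiv (alpha J).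
Hypothesis betaE : forall J, k \notin J -> block e2 J = rderiv (beta J).

Local Notation S := [set~ k].

Let kD J : J \subset S -> k \notin J.
Proof. by move=> /subsetP sJ; apply/negP=> /sJ; rewrite !inE eqxx. Qed.
Let kC J : k \notin S :\: J.
Proof. by rewrite !inE eqxx andbF. Qed.

(** With X_1 = w (e1 k) and X_2 = w (e2 k): primitives in q of the omega(q, X_1, J),
    multiplied by the omega(q, X_2, J'), for J' the complement of J in the
    arguments other than X_1 and X_2. This is a coefficient of the product of two
    generating series. *)
Definition exchange_diff : ratfun L :=
  \sum_(J : {set 'I_m} | J \subset [set~ k]) alpha J * block e2 ([set~ k] :\: J).

Lemma displacement_selection :
  displacement phi (w \o e1) k = displacement phi (w \o e2) k.
Proof.
apply/ffunP=> T; rewrite !ffunE; case: ifP => // /norP[_ kT].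
congr (correlator _ / _); apply/eq_in_map => j; rewrite mem_enum => jT /=.
by rewrite e12 //; apply: contraNneq kT => <-.
Qed.

(** The two series have the same displacement, which contains neither X_1 nor
    X_2. *)
Lemma exchange_diff_invol : exists g, pullback inv_q exchange_diff - exchange_diff = rderiv g.
Proof.
have ha := primitive_exchanged e1_inj alphaE.
have hb := primitive_exchanged e2_inj betaE.
rewrite displacement_selection in ha.
have [g Eg] := exchanged_product_exact (ser_derivM (dbyM y))
  ser_inv_fact0 ser_inv_factS ser_deriv_inv_fact (displacement_nilp _)
  (@displacement_inj _) ha hb.
exists (g [set~ k]).
move: Eg => /(congr1 (fun h : mlseries 'I_m (ratfun L) => h [set~ k])).
rewrite ser_addE ser_oppE !ser_mulE.
rewrite [X in X - _](_ : _ = pullback inv_q exchange_diff / yd); last first.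
  rewrite /exchange_diff (big_morph _ (pullbackD L0 Di) (pullback0 inv_q)) mulr_suml.
  apply: eq_bigr => J sJ; rewrite !ffunE (negPf (kD sJ)) (negPf (kC J)).
  rewrite betaE //= /dby -(pullback_deriv L0 Di) /pullback (substM L0 Di).
  exact: esym (pulled_product_rule _ _ _ _).
rewrite [X in _ - X](_ : _ = exchange_diff / yd); last first.
  rewrite /exchange_diff mulr_suml.
  apply: eq_bigr => J sJ; rewrite !ffunE (negPf (kD sJ)) (negPf (kC J)).
  by rewrite betaE //= /dby mulrA.
by rewrite ffunE => /(common_quotient_rule yd0).
Qed.

Hypothesis e12k : e1 k != e2 k.
Local Notation term J := (alpha J * block e2 (S :\: J)).

Let kS : k \notin S.
Proof. by rewrite !inE eqxx. Qed.
Let ui e : indep phi [:: w (e k)].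
Proof. exact: (wi (s := [:: e k])). Qed.
Let good_sel e : good (Some (w (e k))).
Proof. exact: (good_point wi). Qed.
Let w12 : Some (w (e1 k)) != Some (w (e2 k)).
Proof. by apply: contraNneq (point_neq wi e12k) => -[->]. Qed.
Let block0 e : block e set0 = correlator [:: w (e k)].
Proof. by rewrite /points setU0 enum_set1. Qed.

Lemma term_regular J p : J \subset S -> good p ->
  (J = set0 -> p != Some (w (e1 k))) -> (S :\: J = set0 -> p != Some (w (e2 k))) ->
  reg_diff p (term J).
Proof.
move=> sJ gp h1 h2; apply: (reg_fun_diffM L0).
  apply: (reg_fun_primitive L0); rewrite -alphaE ?kD //.
  exact: (block_regular e1_inj h1 (kD sJ) gp).
exact: (block_regular e2_inj h2 (kC J) gp).
Qed.

Lemma Res_exchange_regular p : good p -> p != Some (w (e1 k)) -> p != Some (w (e2 k)) ->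
  Res p exchange_diff = 0.
Proof.
move=> gp p1 p2; apply: (Res_reg L0); apply: (reg_diff_sum L0) => J sJ.
exact: term_regular.
Qed.

(** Only the term with a primitive of omega(q, X_1) has a pole at X_1; it is
    integrated by parts. *)
Lemma Res_exchange_first : Res (Some (w (e1 k))) exchange_diff = - reval (block e2 S) (w (e1 k)).
Proof.
have g1 := good_sel e1.
rewrite /exchange_diff (bigD1 set0) ?sub0set //= (ResD L0) addrC (Res_reg L0) ?add0r.
  have rb : reg (w (e1 k)) (beta S).
    rewrite -reg_fun_fin; apply: (reg_fun_primitive L0); rewrite -betaE ?kS //.
    by apply: (block_regular e2_inj _ kS g1) => _.
  rewrite Res_fin setD0 (betaE kS).
  have -> : alpha set0 * rderiv (beta S)
    = rderiv (alpha set0 * beta S) - rderiv (alpha set0) * beta S.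
    by rewrite rderivM addrC addKr.
  rewrite -alphaE ?inE // block0 (residueB L0) (residue_deriv L0) sub0r.
  by rewrite (dipole_residue (@ui e1) rb).
apply: (reg_diff_sum L0) => J /andP[sJ /eqP J0].
exact: term_regular.
Qed.

(** Only the term with omega(q, X_2) has a pole at X_2. *)
Lemma Res_exchange_second : Res (Some (w (e2 k))) exchange_diff = reval (block e1 S) (w (e2 k)).
Proof.
have g2 := good_sel e2.
rewrite /exchange_diff (bigD1 S) ?subxx //= (ResD L0) addrC (Res_reg L0) ?add0r.
  have ra : reg (w (e2 k)) (alpha S).
    rewrite -reg_fun_fin; apply: (reg_fun_primitive L0); rewrite -alphaE ?kS //.
    by apply: (block_regular e1_inj _ kS g2) => _; rewrite eq_sym.
  rewrite Res_fin setDv block0 mulrC (dipole_residue (@ui e2) ra).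
  by rewrite alphaE.
apply: (reg_diff_sum L0) => J /andP[sJ nJ].
apply: term_regular => // [_|]; first by rewrite eq_sym.
move/eqP; rewrite setD_eq0 => h; case/negP: nJ.
by rewrite eqEsubset sJ h.
Qed.

Lemma exchange_Res_invol p : Res (inv_p p) exchange_diff = Res p exchange_diff.
Proof.
have [g Eg] := exchange_diff_invol.
rewrite -(Res_invol L0 nd); apply/eqP; rewrite -subr_eq0 -(ResB L0) Eg.
by rewrite (Res_deriv L0).
Qed.

Lemma exchange_poles (ps : seq L) :
  (forall J, k \notin J -> poles_in ps (alpha J)) ->
  (forall J, k \notin J -> poles_in ps (block e2 J)) -> poles_in ps exchange_diff.
Proof.
move=> ha hb; apply: poles_in_sum => J sJ.
exact: (poles_inM (ha _ (kD sJ)) (hb _ (kC J))).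
Qed.

(** The residues of [exchange_diff] are invariant under the involution and
    supported on the two exchanged points and their images: those at the two
    points cancel. *)
Lemma exchange_contour (ps : seq L) : uniq ps -> poles_in ps exchange_diff ->
  (forall e, w (e k) \in ps) -> (forall e, inv_t (w (e k)) \in ps) ->
  reval (block e1 S) (w (e2 k)) = reval (block e2 S) (w (e1 k)).
Proof.
move=> ups pf wps ips.
have := residue_theorem L0 ups pf.
have -> : residue (pullback (rX L)^-1 exchange_diff) 0 = Res None exchange_diff by [].
have ip e : inv_p (Some (w (e k))) = Some (inv_t (w (e k))) by exact: invol_point_fin.
have neq_inv e e' : inv_p (Some (w (e k))) != Some (w (e' k)).
  exact: invol_point_neq.
have res0 p : p != Some (w (e1 k)) -> p != Some (w (e2 k)) ->
    inv_p p != Some (w (e1 k)) -> inv_p p != Some (w (e2 k)) -> Res p exchange_diff = 0.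
  move=> h1 h2 h3 h4.
  have := good_place_dichotomy wi p.
  case/orP=> gp; first exact: Res_exchange_regular.
  by rewrite -exchange_Res_invol; apply: Res_exchange_regular.
have invert (p : P1 L) e : p != Some (inv_t (w (e k))) -> inv_p p != Some (w (e k)).
  by apply: contraNneq => ei; rewrite -[p](involPK nd) ei ip.
(* The points where the residue may be non-zero, all listed in [ps]. *)
pose four := [:: w (e1 k); w (e2 k); inv_t (w (e1 k)); inv_t (w (e2 k))].
have Some_neq (t u : L) : Some t != Some u -> t != u.
  by apply: contraNneq => ->.
have ufour : uniq four.
  have inv12 : Some (inv_t (w (e1 k))) != Some (inv_t (w (e2 k))).
    by rewrite -!ip (can_eq (involPK nd)).
  rewrite /= !inE !negb_or !andbT (Some_neq _ _ w12) (Some_neq _ _ inv12).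
  have nwi e e' : w (e k) != inv_t (w (e' k)).
    by apply: Some_neq; rewrite -ip eq_sym neq_inv.
  by rewrite !nwi.
have sfour : {subset four <= ps}.
  by move=> t; rewrite !inE => /or4P[] /eqP ->.
have pe : perm_eq ps (four ++ [seq t <- ps | t \notin four]).
  apply: uniq_perm => //.
    rewrite cat_uniq ufour filter_uniq // andbT; apply/hasPn=> t.
    by rewrite mem_filter => /andP[].
  move=> t; rewrite mem_cat mem_filter.
  by case: (boolP (t \in four)) => //= /sfour ->.
rewrite (perm_big _ pe) big_cat /= [X in _ + X + _]big1_seq; last first.
  move=> t /andP[_]; rewrite mem_filter !inE !negb_or => /andP[/and4P[h1 h2 h3 h4] _].
  rewrite -Res_fin; apply: res0; [| |exact: (@invert (Some t) e1)|exact: (@invert (Some t) e2)].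
    by apply: contraNneq h1 => -[->].
  by apply: contraNneq h2 => -[->].
have -> : Res None exchange_diff = 0 by apply: res0 => //; apply: invert.
have res_inv e : residue exchange_diff (inv_t (w (e k))) = residue exchange_diff (w (e k)).
  by rewrite -Res_fin -ip exchange_Res_invol Res_fin.
rewrite !big_cons big_nil !res_inv -!Res_fin Res_exchange_first Res_exchange_second.
set r1 := reval _ _; set r2 := reval _ _ => h.
(* The sum of the four residues is twice the difference of the two values. *)
apply/eqP; rewrite -subr_eq0 -(mulrI_eq0 _ (mulfI (natr_neq0 L0 1))).
by rewrite -[X in _ == X]h; apply/eqP; ring.
Qed.

End Exchange.

(** [block_primitive] provides the primitives to which [exchange_contour]
    applies. *)
Lemma exchanged_evaluation (e1 e2 : 'I_m -> 'I_m.+1) : injective e1 -> injective e2 ->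
  (forall j, j != k -> e1 j = e2 j) -> e1 k != e2 k ->
  reval (correlator (points (w \o e1) [set: 'I_m])) (w (e2 k))
  = reval (correlator (points (w \o e2) [set: 'I_m])) (w (e1 k)).
Proof.
move=> e1_inj e2_inj e12 e12k.
have n0 : rnum (rderiv x) != 0.
  by apply: contraNneq x_deriv => E; rewrite [rderiv x]rfracE E tofrac0 mul0r.
have [rs hrs] := finite_roots n0.
(* The zeros of dx, the points, and their images under the involution. *)
pose ps := undup (map phi rs ++ codom w ++ codom (inv_t \o w)).
have ups : uniq ps by exact: undup_uniq.
have wps i : w i \in ps by rewrite mem_undup !mem_cat codom_f orbT.
have ips i : inv_t (w i) \in ps.
  by rewrite mem_undup !mem_cat (codom_f (inv_t \o w)) !orbT.
have pb e J : injective e -> k \notin J -> poles_in ps (correlator (points (w \o e) (k |: J))).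
  move=> ei kJ.
  apply: (correlator_poles hrs).
  - by apply: (selection_indep ei); apply: enum_uniq.
  - by rewrite size_points cardsU1 kJ.
  - by move=> r hr; rewrite mem_undup mem_cat hr.
  - by move=> _ /mapP[i _ ->]; exact: wps.
  - by move=> _ /mapP[i _ ->]; exact: ips.
have prim e : injective e -> exists f : {set 'I_m} -> ratfun L, forall J, k \notin J ->
    poles_in ps (f J) /\ correlator (points (w \o e) (k |: J)) = rderiv (f J).
  move=> ei; apply: (@fin_all_exists _ _ (fun J f => k \notin J ->
    poles_in ps f /\ correlator (points (w \o e) (k |: J)) = rderiv f)) => J.
  have [kJ|kJ] := boolP (k \in J); first by exists 0.
  by have [f pf Ef] := block_primitive ei kJ ups (pb e J ei kJ); exists f.
have [alpha ha] := prim e1 e1_inj; have [beta hb] := prim e2 e2_inj.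
have alphaE J (kJ : k \notin J) := (ha J kJ).2.
have betaE J (kJ : k \notin J) := (hb J kJ).2.
have pf := exchange_poles (fun J kJ => (ha J kJ).1) (fun J kJ => pb e2 J e2_inj kJ).
have := exchange_contour e1_inj e2_inj e12 alphaE betaE e12k ups pf
  (fun e => wps (e k)) (fun e => ips (e k)).
by rewrite setUCr.
Qed.

End Points.
End Contour.

(** * Symmetry *)

(** With the variables themselves as points, omega(q, X_0, J) at q = X_k is
    the permuted correlator, and omega(q, X_k, J) at q = X_0 the original one. *)
Lemma correlator_transposition m (k : 'I_m) :
  permute_vars (tperm ord0 (lift ord0 k)) (omega m.+1) = omega m.+1.
Proof.
pose w : 'I_m.+1 -> mratfun K m.+1 := mX.
have wi (s : seq 'I_m.+1) : uniq s -> indep (mC m.+1) (map w s).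
  move=> us; have e : size s = size (map w s) by rewrite size_map.
  have si : injective (fun i : 'I_(size s) => nth ord0 s i).
    by move=> i j /eqP; rewrite nth_uniq // => /eqP /val_inj.
  apply: (indep_of e) (algindep_inj si (@algindep_mX K m.+1)) => i.
  by rewrite (nth_map ord0).
pose e2 : 'I_m -> 'I_m.+1 := lift ord0.
(* Among the arguments of index j > 0, the first selection has X_0 for X_k. *)
pose e1 (j : 'I_m) : 'I_m.+1 := if j == k then ord0 else e2 j.
have e2_inj : injective e2 by exact: lift_inj.
have e1_inj : injective e1.
  move=> i j; rewrite /e1; case: eqP => [->|_]; case: eqP => [-> //|_] //.
  exact: e2_inj.
have e12 j : j != k -> e1 j = e2 j by rewrite /e1 => /negPf ->.
have e1k : e1 k = ord0 by rewrite /e1 eqxx.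
have correlatorT (e : 'I_m -> 'I_m.+1) : correlator omega (mC m.+1) (points (w \o e) [set: 'I_m])
   = mcomp (@rC _ \o mC m.+1) (vcons (rX _) (fun i => rC (w (e i)))) (omega m.+1).
  apply: esym; apply: correlatorE => [|i]; first by rewrite size_points cardsT card_ord.
  by rewrite /points enum_setT -enumT (nth_map k) ?nth_ord_enum // size_enum_ord.
have := @exchanged_evaluation _ _ m w wi k e1 e2 e1_inj e2_inj e12.
have swapE : vcons (w (e2 k)) (w \o e1) =1 (fun i => mX (tperm ord0 (lift ord0 k) i)).
  move=> i; case: (unliftP ord0 i) => [j ->|->]; last by rewrite vcons0 tpermL.
  rewrite vconsS /= /e1; case: eqP => [->|/eqP jk]; first by rewrite tpermR.
  by rewrite tpermD // (inj_eq (@lift_inj _ ord0)) eq_sym.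
have idE : vcons (w (e1 k)) (w \o e2) =1 mX.
  by move=> i; rewrite e1k; exact: vcons_eta.
have ev (e : 'I_m -> 'I_m.+1) z (ai : algindep (mC m.+1) (vcons z (w \o e))) :
    reval (correlator omega (mC m.+1) (points (w \o e) [set: 'I_m])) z
    = mcomp (mC m.+1) (vcons z (w \o e)) (omega m.+1).
  by rewrite correlatorT; exact: (reval_at_q (omega m.+1) ai).
have swap_ai := eq_algindep (frefl (mC m.+1)) (fsym swapE) (permuted_vars_algindep _).
have id_ai := eq_algindep (frefl (mC m.+1)) (fsym idE) (@algindep_mX K m.+1).
rewrite (ev e1 _ swap_ai) (ev e2 _ id_ai).
rewrite (eq_mcomp _ (frefl _) swapE) (eq_mcomp _ (frefl _) idE) => E.
rewrite /permute_vars E; last by rewrite e1k.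
exact: mcomp_mX.
Qed.

Lemma correlators_symmetric (n : nat) (s : 'S_n) : permute_vars s (omega n) = omega n.
Proof.
case: n s => [|m] s.
  have -> : s = 1%g by apply/permP=> -[].
  exact: permute_vars1.
exact: permute_vars_transpositions (@correlator_transposition m) s.
Qed.
End Correlators.

Theorem theorem2 (R : realType) (a b c : R[i]) (x : ratfun R[i])
    (omega : forall n : nat, mratfun R[i] n)
    (invol_nondeg : a ^+ 2 + b * c != 0)
    (x_nonconstant : forall k : R[i], x <> rC k)
    (ram_simple : forall p : P1 R[i], ramified x p -> simply_ramified x p)
    (invol_ram : forall p : P1 R[i],
       ramified x p -> ~~ ramified x (involP a b c p))
    (invol_ram_not_pole : forall p : P1 R[i],
       ramified x p -> ~~ fun_pole x (involP a b c p))
    (omega_2 : omega 2%N = omega2 a b c)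
    (omega_identity : forall m : nat, (2 <= m)%N ->
       involution_identity a b c x omega m)
    (omega_poles : forall m : nat, (2 <= m)%N ->
       poles_from_rhs a b c x omega m)
    (omega_holo_u : forall m : nat, (2 <= m)%N -> holomorphic_at_u omega m)
    (omega_holo_ram : forall m : nat, (2 <= m)%N ->
       holomorphic_at_invol_ram a b c x omega m) :
  forall (n : nat) (s : 'S_n), (2 <= n)%N ->
    permute_vars s (omega n) = omega n.
Proof.
have K0 : [pchar R[i]] =i pred0 by exact: pchar_num.
have K_closed (p : {poly R[i]}) : size p != 1 -> exists t, root p t.
  by move/closed_rootP.
have x_deriv : rderiv x != 0.
  by apply/eqP => /(rderiv_eq0 K0) [k]; apply: x_nonconstant.
move=> n s _.
exact: (correlators_symmetric K0 K_closed invol_nondeg x_deriv invol_ram omega_2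
  omega_identity omega_poles omega_holo_u omega_holo_ram).
Qed.
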